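(* Let $[x_k]=(x_0,\ldots,x_N)$ be a zero-mean nonsingular Gaussian (ZMNG) sequence of $\mathbb{R}^d$-valued random vectors. Then $[x_k]$ is reciprocal if and only if there exist $d\times d$ matrices $M_{k,k-1}$, $k\in[1,N]$, and $d\times d$ positive definite matrices $M_k$, $k\in[1,N]$, such that $[x_k]$ obeys $$x_k=G_{k,k-1}x_{k-1}+G_{k,N}x_N+e_k,\quad k\in[1,N-1],$$ $$x_N=e_N,\qquad x_0=G_{0,N}x_N+e_0,$$ for some matrix $G_{0,N}$ and some zero-mean white nonsingular Gaussian sequence $[e_k]$ with covariances $G_k=\mathrm{Cov}(e_k)$, $k\in[0,N]$, where the parameters $(G_{k,k-1},G_{k,N},G_k)$, $k\in[1,N-1]$, are given by $$G_{k,k-1}=M_{k,k-1}-G_{k,N}M_{N|k}M_{k,k-1},$$ $$G_{k,N}=G_kM_{N|k}'C_{N|k}^{-1},$$ $$G_k=\left(M_k^{-1}+M_{N|k}'C_{N|k}^{-1}M_{N|k}\right)^{-1},$$ with $M_{N|k}=M_{N,N-1}\cdots M_{k+1,k}$ for $k\in[1,N-1]$, $M_{N|N}=I$, and $C_{N|k}=\sum_{n=k}^{N-1}M_{N|n+1}M_{n+1}M_{N|n+1}'$ for $k\in[1,N-1]$. (The boundary parameters $G_{0,N}$, $G_0$, $G_N$ are not constrained by the $M$'s.)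
   Context: $N$ is a positive integer and $[i,j]=\{i,i+1,\ldots,j\}$; $[x_k]$ denotes $(x_k)_{k\in[0,N]}$, each $x_k$ being $\mathbb{R}^d$-valued. The prime denotes matrix transposition. A sequence is zero-mean nonsingular Gaussian (ZMNG) if the stacked vector $[x_0',\ldots,x_N']'$ is jointly Gaussian with zero mean and nonsingular covariance matrix. A zero-mean white nonsingular Gaussian sequence $[e_k]$ is a jointly Gaussian, zero-mean sequence whose terms are mutually uncorrelated, with each $\mathrm{Cov}(e_k)$ nonsingular. A sequence $[x_k]$ is reciprocal if, conditioned on the states at any two times $j<l$, the segment inside $(j,l)$ is independent of the two segments outside $[j,l]$; equivalently, the conditional distribution of $x_k$ given $(x_0,\ldots,x_j,x_l,\ldots,x_N)$ equals that given $(x_j,x_l)$ for all $j<k<l$ in $[0,N]$. The matrices $M_{k,k-1}$, $M_k$ are viewed as the parameters of a Markov model $y_k=M_{k,k-1}y_{k-1}+\epsilon_k$, $k\in[1,N]$, with $\mathrm{Cov}(\epsilon_k)=M_k$; the displayed $CM_L$ model of $[x_k]$ is then said to be induced by that Markov model. *)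

(* Defs.v *)
From HB Require Import structures.
From mathcomp Require Import all_boot all_order all_algebra.
From mathcomp Require Import all_classical all_reals all_analysis.

Set Implicit Arguments.
Unset Strict Implicit.
Unset Printing Implicit Defensive.

Import Order.TTheory GRing.Theory Num.Theory.

Local Open Scope classical_set_scope.
Local Open Scope ring_scope.

Definition posdefmx (R : realType) (n : nat) (A : 'M[R]_n) : Prop :=
  A^T = A /\ forall v : 'cV[R]_n, v != 0 -> 0 < (v^T *m A *m v) 0 0.

Section RandomVectors.
Context (disp : measure_display) (T : measurableType disp) (R : realType).
Variable P : probability T R.

(* [normal_prob m 0] is not a point mass (the library gives it the density
   \1_[0, 1]), so degenerate Gaussian laws are Dirac masses. *)
Definition gaussian_rv (Y : T -> R) : Prop :=
  measurable_fun setT Y /\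
  ((exists m s : R, s != 0 /\
      forall B, measurable B -> P (Y @^-1` B) = normal_prob m s B) \/
   (exists m : R, forall B, measurable B -> P (Y @^-1` B) = \d_m B)).

(* Joint Gaussianity: every linear combination of the components is a
   (possibly degenerate) scalar Gaussian. *)
Definition gaussian_vec n (X : T -> 'cV[R]_n) : Prop :=
  forall a : 'cV[R]_n, gaussian_rv (fun w => (a^T *m X w) 0 0).

Definition mean_vec n (X : T -> 'cV[R]_n) : 'cV[R]_n :=
  \col_i fine 'E_P[fun w => X w i 0].

Definition cov_mx m n (X : T -> 'cV[R]_m) (Y : T -> 'cV[R]_n) : 'M[R]_(m, n) :=
  \matrix_(i, j) fine (covariance P (fun w => X w i 0) (fun w => Y w j 0)).

Definition stack N d (x : 'I_N.+1 -> T -> 'cV[R]_d) (w : T) :=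
  \mxcol_(k < N.+1) x k w.

Definition ZMNG N d (x : 'I_N.+1 -> T -> 'cV[R]_d) : Prop :=
  [/\ gaussian_vec (stack x),
      mean_vec (stack x) = 0 &
      cov_mx (stack x) (stack x) \in unitmx].

Definition white_ZMNG N d (e : 'I_N.+1 -> T -> 'cV[R]_d) : Prop :=
  [/\ gaussian_vec (stack e),
      forall k, mean_vec (e k) = 0,
      forall k l, k != l -> cov_mx (e k) (e l) = 0 &
      forall k, cov_mx (e k) (e k) \in unitmx].

Definition sigma_of N d (x : 'I_N.+1 -> T -> 'cV[R]_d) (J : set 'I_N.+1) :
    set (set T) :=
  <<s [set A | exists k i (B : set R),
         [/\ J k, measurable B & A = (fun w => x k w i 0) @^-1` B]] >>.

(* [f] is a version of the conditional probability of [A] given the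
   sub-sigma-algebra [H]. *)
Definition is_cond_prob (H : set (set T)) (A : set T) (f : T -> R) : Prop :=
  [/\ forall B, measurable B -> H (f @^-1` B),
      P.-integrable setT (EFin \o f) &
      forall C, H C -> (\int[P]_(w in C) (f w)%:E)%E = P (A `&` C)].

(* P(A n B | H) = P(A | H) P(B | H) almost surely; versions exist and are
   almost surely unique, so it does not matter which ones are multiplied. *)
Definition cond_indep (H F G : set (set T)) : Prop :=
  forall A B, F A -> G B ->
    exists f g : T -> R,
      [/\ is_cond_prob H A f, is_cond_prob H B g &
          is_cond_prob H (A `&` B) (f \* g)].

Definition reciprocal N d (x : 'I_N.+1 -> T -> 'cV[R]_d) : Prop :=
  forall j l : 'I_N.+1, (j < l)%N ->
    cond_indep (sigma_of x [set k | k = j \/ k = l])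
               (sigma_of x [set k : 'I_N.+1 | (j < k < l)%N])
               (sigma_of x [set k : 'I_N.+1 | (k < j)%N \/ (l < k)%N]).

(* [G1 k] is G_{k,k-1} for k in [1, N-1]; [GN k] is G_{k,N} for k in
   [0, N-1]; other indices are unused. *)
Definition obeys_CML N d (x : 'I_N.+1 -> T -> 'cV[R]_d)
    (G1 GN : nat -> 'M[R]_d) (e : 'I_N.+1 -> T -> 'cV[R]_d) : Prop :=
  [/\ forall k : nat, (1 <= k <= N.-1)%N ->
        {ae P, forall w, x (inord k) w =
          G1 k *m x (inord k.-1) w + GN k *m x ord_max w + e (inord k) w},
      {ae P, forall w, x ord_max w = e ord_max w} &
      {ae P, forall w, x ord0 w = GN 0%N *m x ord_max w + e ord0 w}].

End RandomVectors.

(* Below, [M k] is M_{k,k-1} and [Mc k] is M_k. *)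

(* M_{N|k} = M_{N,N-1} ... M_{k+1,k}, with M_{N|N} = I. *)
Definition M_to (R : realType) (d : nat) (M : nat -> 'M[R]_d) (N k : nat) :
    'M[R]_d :=
  \big[mulmx/1%:M]_(0 <= i < N - k) M (N - i)%N.

Definition C_to (R : realType) (d : nat) (M Mc : nat -> 'M[R]_d) (N k : nat) :
    'M[R]_d :=
  \sum_(k <= n < N) M_to M N n.+1 *m Mc n.+1 *m (M_to M N n.+1)^T.

(* Main.v *)
(* Let [Z] be the stacked vector, [S] its covariance, and consider the blocks of
   the precision matrix [S^-1].

   For Gaussian vectors, conditional independence given [C] amounts to
   uncorrelated residuals of the regressions on [C], and for a partition of the
   indices into [F], [J], [G] this says that the [(F, G)] block of [S^-1] is zero.
   Hence the sequence is reciprocal iff the block rows 1, ..., N - 1 of [S^-1]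
   vanish outside the diagonals -1, 0, 1.

   The regression of x_k on x_{k-1} and x_N gives a CM_L model; its noise is white
   as soon as those blocks vanish. Conversely, if the noise e is white, then
   G_k^-1 e_k - G_{k+1,k}' G_{k+1}^-1 e_{k+1} is dual to x_k, so its coefficients
   are the k-th block row of [S^-1]. It involves x_{k-1}, x_k, x_{k+1} and x_N only,
   and the coefficient of x_N vanishes iff the gains B_k = G_k^-1 G_{k,N} satisfy
   B_k = G_{k+1,k}' B_{k+1}. This recursion holds exactly for the models induced by
   a Markov model, where B_k = M_{N|k}' C_{N|k}^-1. *)
Require Import Defs.
From HB Require Import structures.
From mathcomp Require Import all_boot all_order all_algebra.
From mathcomp Require Import all_classical all_reals all_analysis.
From mathcomp Require Import measurable_realfun lebesgue_integral_under ring lra zify.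

Set Implicit Arguments.
Unset Strict Implicit.
Unset Printing Implicit Defensive.

Import Order.TTheory GRing.Theory Num.Theory.
Import numFieldNormedType.Exports.

Local Open Scope classical_set_scope.
Local Open Scope ring_scope.

(** * Characteristic function of the normal law *)

Section NormalCharacteristic.
Context (R : realType).
Notation mu := (@lebesgue_measure R).

(** The obstacle is the distance between the hypotheses, which concern laws of scalar combinations
    and conditional probabilities given sigma-algebras, and identities between matrices.

    Fourier uniqueness carries product formulas from cosines to events, which gives independence of
    uncorrelated linear images of Z. Conditional independence follows because regression residuals
    are independent of the conditioning vector, so that the latter can be frozen. The converse is
    harder: conditional independence speaks only of events and of unspecified versions, and has to
    be integrated up to cosines before a covariance can be read off.

    On the matrix side, subvectors are represented by projections of the full space, so that
    regressions on varying index sets all live in one matrix algebra. *)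

Lemma Rintegral_dominated_cvg disp (T : measurableType disp)
    (P : {measure set T -> \bar R}) (f_ : nat -> T -> R) (f g : T -> R) :
  (forall n, measurable_fun setT (f_ n)) ->
  (forall x, f_ n x @[n --> \oo] --> f x) ->
  P.-integrable setT (EFin \o g) ->
  (forall n x, `|f_ n x| <= g x) ->
  P.-integrable setT (EFin \o f) /\
  Rintegral P setT (f_ n) @[n --> \oo] --> Rintegral P setT f.
Proof.
move=> mf ff ig fg.
have mf' : measurable_fun setT f.
  by apply: (@measurable_fun_cvg _ _ _ _ f_) => // x _; exact: ff.
have [| | | | |h1 _ h3] := @dominated_convergence _ _ _ P setT measurableT
   (fun n => EFin \o f_ n) (EFin \o f) (EFin \o g).
- by move=> n; apply/measurable_EFinP.
- exact/measurable_EFinP.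
- apply: aeW => x _; apply/fine_cvgP; split; first exact: nearW.
  exact: ff.
- exact: ig.
- by apply: aeW => x n _; rewrite lee_fin.
split => //.
apply: fine_cvg.
rewrite fineK; first exact: h3.
exact: integrable_fin_num.
Qed.

(** The change of variables formula produces an abstract Radon-Nikodym derivative; it agrees almost
    everywhere with [normal_pdf] because both have the same integral over every measurable set. *)
Lemma ge0_integral_normal_prob (m s : R) (f : R -> \bar R) :
  measurable_fun setT f -> (forall x, 0 <= f x)%E ->
  (\int[normal_prob m s]_x f x = \int[mu]_x (f x * (normal_pdf m s x)%:E))%E.
Proof.
move=> mf f0.
have dom := @normal_prob_dominates R m s.
rewrite -(Radon_Nikodym_SigmaFinite.change_of_variables dom f0)//.
set g := Radon_Nikodym_SigmaFinite.f _ _.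
have ig : mu.-integrable setT g by exact: Radon_Nikodym_SigmaFinite.f_integrable.
have mg := measurable_int _ ig.
have mpdf : measurable_fun setT (fun x => (normal_pdf m s x)%:E).
  by apply/measurable_EFinP; exact: measurable_normal_pdf.
apply: ge0_ae_eq_integral => //.
- exact: emeasurable_funM.
- exact: emeasurable_funM.
- move=> x _; apply: mule_ge0 => //; exact: Radon_Nikodym_SigmaFinite.f_ge0.
- by move=> x _; apply: mule_ge0 => //; rewrite lee_fin normal_pdf_ge0.
apply: ae_eqe_mul2l.
apply: integral_ae_eq => // E _ mE.
by rewrite -Radon_Nikodym_SigmaFinite.f_integral.
Qed.

Lemma integrable_normal_prob (m s : R) (f : R -> R) :
  measurable_fun setT f ->
  (normal_prob m s).-integrable setT (EFin \o f) <->
  mu.-integrable setT (fun x => (f x * normal_pdf m s x)%:E).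
Proof.
move=> mf.
have mpdf := measurable_normal_pdf m s.
have e : (\int[normal_prob m s]_x `|(f x)%:E| =
          \int[mu]_x `|(f x * normal_pdf m s x)%:E|)%E.
  rewrite ge0_integral_normal_prob//; last first.
    exact/measurableT_comp/measurable_EFinP.
  apply: eq_integral => x _.
  by rewrite EFinM abseM (gee0_abs (x := (normal_pdf _ _ _)%:E))// lee_fin normal_pdf_ge0.
split => /integrableP[_ h]; apply/integrableP; split => //.
- by apply/measurable_EFinP/measurable_funM.
- by rewrite -e.
- exact/measurable_EFinP.
- by rewrite /= e.
Qed.

Lemma Rintegral_normal_prob (m s : R) (f : R -> R) :
  measurable_fun setT f -> (normal_prob m s).-integrable setT (EFin \o f) ->
  Rintegral (normal_prob m s) setT f = Rintegral mu setT (fun x => f x * normal_pdf m s x).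
Proof.
move=> mf intf; rewrite /Rintegral; congr fine.
have dom := @normal_prob_dominates R m s.
have mpdf : measurable_fun setT (fun x => (normal_pdf m s x)%:E).
  by apply/measurable_EFinP; exact: measurable_normal_pdf.
have mEf : measurable_fun setT (EFin \o f) by exact/measurable_EFinP.
rewrite integralE [RHS]integralE; congr (_ - _)%E.
- rewrite ge0_integral_normal_prob//; last exact: measurable_funepos.
  apply: eq_integral => x _; rewrite !funeposE -!EFin_max -EFinM.
  by rewrite maxr_pMl ?mul0r// normal_pdf_ge0.
- rewrite ge0_integral_normal_prob//; last exact: measurable_funeneg.
  apply: eq_integral => x _; rewrite !funenegE -!EFinN -!EFin_max -EFinM.
  by rewrite maxr_pMl ?mul0r ?mulNr// normal_pdf_ge0.
Qed.

(** The fundamental theorem of calculus on [-(n + 1), n + 1], then dominated convergence with bound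
    |f|; [n.+1] keeps the intervals nondegenerate. *)
Lemma Rintegral_derive_eq0 (F f : R -> R) :
  continuous f -> (forall x, is_derive x (1:R) F (f x)) ->
  mu.-integrable setT (EFin \o f) ->
  F n.+1%:R @[n --> \oo] --> 0 -> F (- n.+1%:R) @[n --> \oo] --> 0 ->
  Rintegral mu setT f = 0.
Proof.
move=> cf dF intf Fp Fm.
pose I n := `[- n.+1%:R, n.+1%:R]%classic : set R.
have mf : measurable_fun setT f by exact: continuous_measurable_fun.
have cF : continuous F.
  by move=> x; apply/differentiable_continuous/derivable1_diffP; case: (dF x).
have [| | | |_] := @Rintegral_dominated_cvg _ _ mu (fun n => f \_ (I n)) f (fun x => `|f x|).
  - move=> n; apply/measurable_restrict => //; first exact: measurable_itv.
    exact: measurable_funS mf.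
  - move=> x; apply: cvg_near_cst.
    near=> n; rewrite patchE mem_set// /I /= in_itv /= -ler_norml.
    near: n; exists (Num.bound `|x|) => //= n /= nx.
    by rewrite ltW// (lt_le_trans (archi_boundP _))// ler_nat (leq_trans nx).
  - by apply: (@eq_integrable _ _ _ _ _ measurableT) (integrable_abse intf).
  - move=> n x; rewrite patchE; case: ifP => // _; by rewrite normr0.
rewrite (_ : (fun n => _) = (fun n => F n.+1%:R - F (- n.+1%:R))).
  move=> h; have h2 : F n.+1%:R - F (- n.+1%:R) @[n --> \oo] --> 0 - (0:R) by exact: cvgB.
  rewrite subr0 in h2.
  by apply: (cvg_unique _ h h2).
apply/funext => n; rewrite -Rintegral_mkcond /Rintegral (@continuous_FTC2 _ f F)//.
- by rewrite (lt_trans (y := 0))// ?oppr_lt0 ltr0n.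
- by apply: continuous_subspaceT.
- split.
  + by move=> x _; case: (dF x).
  + exact/cvg_at_right_filter/cF.
  + exact/cvg_at_left_filter/cF.
- by move=> x _; rewrite derive1E; case: (dF x).
Unshelve. all: by end_near. Qed.

Lemma is_derive_ext (f g : R -> R) (x df dg : R) :
  is_derive x (1:R) f df -> f =1 g -> df = dg -> is_derive x (1:R) g dg.
Proof. by move=> h /funext <- <-. Qed.

Section Pdf.
Variables (m s : R).
Hypothesis s0 : s != 0.
Notation phi := (normal_pdf m s).

Let pdfE : phi = fun x => normal_peak s * normal_fun m s x.
Proof. exact: normal_pdfE. Qed.

Lemma is_derive_normal_pdf x :
  is_derive x (1:R) phi (- (x - m) / s ^+ 2 * phi x).
Proof.
have h : is_derive x (1:R) (fun y => - (y - m) ^+ 2 / (s ^+ 2 *+ 2)) (- (x - m) / s ^+ 2).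
  have h1 := is_deriveZ (- (s ^+ 2 *+ 2)^-1)
    (is_deriveX 2 (is_deriveB (is_derive_id x (1:R)) (is_derive_cst m x (1:R)))).
  apply: (is_derive_ext h1) => [y|]; rewrite /GRing.scale/= !fctE ?/GRing.scale/=; last by field.
  by rewrite mulNr mulrC mulNr.
have h2 := @is_derive1_comp _ expR _ x _ _ (is_derive_expR _) h.
rewrite pdfE; have h3 := is_deriveZ (normal_peak s) h2.
rewrite (_ : - (x - m) / s ^+ 2 * _ = normal_peak s *: (expR (- (x - m) ^+ 2 / (s ^+ 2 *+ 2)) * (- (x - m) / s ^+ 2))).
  exact: h3.
rewrite -[RHS]/(normal_peak s * (expR _ * _)) /normal_fun; ring.
Qed.

Lemma normal_pdf_le x : phi x * (1 + (x - m) ^+ 2 / (s ^+ 2 *+ 2)) <= normal_peak s.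
Proof.
rewrite pdfE /normal_fun mulNr expRN.
set y := (_ ^+ 2 / _).
have y0 : 0 <= y by rewrite divr_ge0 ?sqr_ge0// mulrn_wge0// sqr_ge0.
rewrite -mulrA ler_piMr ?normal_peak_ge0// ler_pdivrMl ?expR_gt0// mulr1.
exact: expR_ge1Dx.
Qed.

(** Half of the exponent absorbs the quadratic factor through 1 + y <= exp y; the other half is, up
    to a constant, the density with standard deviation s sqrt 2. *)
Lemma integrable_normal_pdf_sqr :
  mu.-integrable setT (fun x => ((1 + (x - m) ^+ 2) * phi x)%:E).
Proof.
pose s' := s * Num.sqrt 2.
have s'0 : s' != 0 by rewrite mulf_neq0// gt_eqF// sqrtr_gt0.
pose K := (1 + s ^+ 2 *+ 4) * normal_peak s / normal_peak s'.
have iK : mu.-integrable setT (fun x => (K * normal_pdf m s' x)%:E).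
  under eq_fun do rewrite EFinM.
  by apply: integrableZl => //; exact: integrable_normal_pdf.
apply: le_integrable iK => //.
  apply/measurable_EFinP/measurable_funM; last exact: measurable_normal_pdf.
  by apply: measurable_funD => //; apply: measurable_funX; apply: measurable_funB.
move=> x _; rewrite !lee_fin.
rewrite !ger0_norm ?mulr_ge0 ?normal_pdf_ge0 ?addr_ge0 ?sqr_ge0//; last first.
  by rewrite invr_ge0 normal_peak_ge0.
all: try by rewrite ?normal_peak_ge0 ?mulrn_wge0 ?sqr_ge0.
rewrite pdfE normal_pdfE// /normal_fun /K.
rewrite [leRHS]mulrA divfK ?gt_eqF ?normal_peak_gt0// mulrCA [leRHS]mulrAC [leRHS]mulrC.
rewrite  ler_wpM2l ?normal_peak_ge0// !mulNr.
rewrite /s' exprMn sqr_sqrtr//.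
set y := (x - m) ^+ 2 / (s ^+ 2 * 2 *+ 2).
have -> : (x - m) ^+ 2 / (s ^+ 2 *+ 2) = y + y by rewrite /y; field.
rewrite opprD expRD mulrA ler_wpM2r ?expR_ge0//.
rewrite expRN ler_pdivrMr ?expR_gt0//.
apply: (@le_trans _ _ ((1 + s ^+ 2 *+ 4) * (1 + y))); last first.
  by rewrite ler_wpM2l ?expR_ge1Dx// addr_ge0// mulrn_wge0// sqr_ge0.
have y0 : 0 <= y by rewrite divr_ge0 ?sqr_ge0// mulrn_wge0// mulr_ge0// sqr_ge0.
have -> : (1 + s ^+ 2 *+ 4) * (1 + y) = 1 + s ^+ 2 *+ 4 + y + (x - m) ^+ 2.
  by rewrite /y; field.
have := sqr_ge0 s; lra.
Qed.

(** These are the boundary terms of an integration by parts. By [normal_pdf_le] the density decays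
    quadratically, and (1 + |z|)^2 <= (2 + 4 s^2) (1 + z^2 / (2 s^2)), so a factor of linear growth
    leaves a decay of order 1 / (1 + |x - m|). *)
Lemma normal_pdf_vanish (g : R -> R) : (forall x, `|g x| <= 1 + `|x - m|) ->
  g n.+1%:R * phi n.+1%:R @[n --> \oo] --> 0 /\
  g (- n.+1%:R) * phi (- n.+1%:R) @[n --> \oo] --> 0.
Proof.
move=> hg.
pose C := (2 + s ^+ 2 *+ 4) * normal_peak s.
have C0 : 0 <= C by rewrite mulr_ge0 ?normal_peak_ge0// addr_ge0// mulrn_wge0// sqr_ge0.
have bnd x : `|g x * phi x| * (1 + `|x - m|) <= C.
  have h := normal_pdf_le x.
  rewrite normrM (ger0_norm (normal_pdf_ge0 _ _ _)).
  have p0 := normal_pdf_ge0 m s x.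
  apply: (@le_trans _ _ (phi x * (1 + `|x - m|) ^+ 2)).
    rewrite expr2 mulrA ler_wpM2r ?addr_ge0// mulrC ler_wpM2l//.
  apply: (@le_trans _ _ ((2 + s ^+ 2 *+ 4) * (phi x * (1 + (x - m) ^+ 2 / (s ^+ 2 *+ 2))))).
    rewrite [leRHS]mulrCA ler_wpM2l//.
    have -> : (2 + s ^+ 2 *+ 4) * (1 + (x - m) ^+ 2 / (s ^+ 2 *+ 2)) =
       2 + s ^+ 2 *+ 4 + (x - m) ^+ 2 / s ^+ 2 + 2 * (x - m) ^+ 2 by field.
    rewrite -[in leRHS](real_normK (num_real (x - m))).
    set z := `|x - m|.
    have q0 : 0 <= z ^+ 2 / s ^+ 2 by rewrite divr_ge0// sqr_ge0.
    have := sqr_ge0 (1 - z); have := sqr_ge0 s; lra.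
  by rewrite /C ler_wpM2l// addr_ge0// mulrn_wge0// sqr_ge0.
have key (u : nat -> R) : (forall n, n%:R <= `|u n|) -> g (u n) * phi (u n) @[n --> \oo] --> 0.
  move=> hu; apply/cvgrPdist_le => e e0; near=> n.
  rewrite sub0r normrN.
  have n1 : C / e + `|m| <= n%:R.
    near: n; exists (Num.bound (C / e + `|m|)) => //= n nx.
    rewrite ltW// (lt_le_trans (archi_boundP _))// ?ler_nat//.
    by rewrite addr_ge0// divr_ge0// ltW.
  have n2 : C / e <= 1 + `|u n - m|.
    have := hu n; have := lerB_dist (u n) m; lra.
  have := bnd (u n).
  rewrite -ler_pdivlMr; last by rewrite ltr_pwDl.
  move=> /le_trans; apply.
  by rewrite ler_pdivrMr ?ltr_pwDl// mulrC -ler_pdivrMr.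
split; apply: key => n.
  by rewrite ger0_norm// ler_nat.
by rewrite normrN ger0_norm// ler_nat.
Unshelve. all: by end_near. Qed.

Let cphi : continuous phi. Proof. exact: continuous_normal_pdf. Qed.

Lemma integrable_normal_pdf_le (g : R -> R) : measurable_fun setT g ->
  (forall x, `|g x| <= 1 + (x - m) ^+ 2) ->
  mu.-integrable setT (fun x => (g x * phi x)%:E).
Proof.
move=> mg hg; apply: le_integrable integrable_normal_pdf_sqr => //.
  by apply/measurable_EFinP/measurable_funM => //; exact: measurable_normal_pdf.
move=> x _; rewrite !lee_fin normrM [leRHS]normrM.
rewrite [`|1 + _|]ger0_norm ?addr_ge0 ?sqr_ge0//.
by rewrite ler_wpM2r.
Qed.

Lemma integrable_normal_prob_le (g : R -> R) : measurable_fun setT g ->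
  (forall x, `|g x| <= 1 + (x - m) ^+ 2) ->
  (normal_prob m s).-integrable setT (EFin \o g).
Proof. by move=> mg hg; apply/integrable_normal_prob => //; exact: integrable_normal_pdf_le. Qed.

Lemma abs_le_sqr (z : R) : `|z| <= 1 + z ^+ 2.
Proof.
rewrite -[in leRHS](real_normK (num_real z)).
have := sqr_ge0 (`|z| - 1); have := normr_ge0 z; set y := `|z|; nra.
Qed.

(** Stein's identity: the derivative of s^2 g phi is s^2 g' phi - (x - m) g phi, and its integral
    vanishes. *)
Lemma normal_ibp (g g' : R -> R) :
  continuous g -> continuous g' ->
  (forall x, is_derive x (1:R) g (g' x)) ->
  (forall x, `|g x| <= 1 + `|x - m|) ->
  mu.-integrable setT (fun x => (g' x * phi x)%:E) ->
  mu.-integrable setT (fun x => ((x - m) * g x * phi x)%:E) ->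
  \int[mu]_x ((x - m) * g x * phi x) = s ^+ 2 * \int[mu]_x (g' x * phi x).
Proof.
move=> cg cg' dg hg i1 i2.
have cx : continuous (fun x : R => (x - m) * g x).
  move=> x; apply: cvgM; last exact: cg.
  by apply: cvgB; [exact: cvg_id|exact: cvg_cst].
have i3 : mu.-integrable setT (fun x => (s ^+ 2 * (g' x * phi x))%:E).
  by under eq_fun do rewrite EFinM; exact: integrableZl.
rewrite -RintegralZl//; apply/eqP; rewrite eq_sym -subr_eq0; apply/eqP.
rewrite -RintegralB//.
have [v1 v2] := normal_pdf_vanish hg.
have vZ (u : nat -> R) : u n @[n --> \oo] --> 0 -> s ^+ 2 * u n @[n --> \oo] --> 0.
  by move=> hu; rewrite -[X in _ --> X](mulr0 (s ^+ 2)); apply: cvgM => //; exact: cvg_cst.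
apply: (@Rintegral_derive_eq0 (fun x => s ^+ 2 * (g x * phi x))).
- move=> x; apply: cvgB; last by apply: cvgM; [exact: cx|exact: cphi].
  by apply: cvgM; [exact: cvg_cst|apply: cvgM; [exact: cg'|exact: cphi]].
- move=> x.
  have h := is_deriveZ (s ^+ 2) (is_deriveM (dg x) (is_derive_normal_pdf x)).
  apply: (is_derive_eq h).
  by rewrite /GRing.scale/=; field.
- under [X in _.-integrable _ X]eq_fun do rewrite /= EFinB.
  exact: integrableB.
- exact: vZ v1.
- exact: vZ v2.
Qed.

Lemma Rintegral_normal_pdf : \int[mu]_x (phi x) = 1.
Proof. by rewrite /Rintegral integral_normal_pdf. Qed.

Lemma normal_mean : \int[normal_prob m s]_x (x - m) = 0.
Proof.
have mx : measurable_fun setT (fun x : R => x - m) by exact: measurable_funB.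
rewrite Rintegral_normal_prob//; last first.
  by apply: integrable_normal_prob_le => // x; exact: abs_le_sqr.
have := @normal_ibp (cst 1) (cst 0).
rewrite (_ : \int[mu]_x (cst 0 x * phi x) = 0); last first.
  by rewrite /Rintegral; under eq_integral do rewrite mul0r; rewrite integral0.
rewrite mulr0; under [X in X = _]eq_Rintegral do rewrite mulr1.
apply.
- exact: cst_continuous.
- exact: cst_continuous.
- by move=> x; rewrite normr1 lerDl.
- by apply: integrable_normal_pdf_le => // x; rewrite normr0 addr_ge0// sqr_ge0.
- under eq_fun do rewrite mulr1.
  by apply: integrable_normal_pdf_le => // x; exact: abs_le_sqr.
Qed.

Lemma normal_variance : \int[normal_prob m s]_x ((x - m) ^+ 2) = s ^+ 2.
Proof.
have mx : measurable_fun setT (fun x : R => (x - m) ^+ 2).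
  by apply: measurable_funX; exact: measurable_funB.
rewrite Rintegral_normal_prob//; last first.
  by apply: integrable_normal_prob_le => // x; rewrite ger0_norm ?sqr_ge0// lerDr.
have := @normal_ibp (fun x => x - m) (cst 1).
under [X in _ = _ * X]eq_Rintegral do rewrite mul1r.
rewrite Rintegral_normal_pdf mulr1; apply.
- by move=> x; apply: cvgB; [exact: cvg_id|exact: cvg_cst].
- exact: cst_continuous.
- move=> x; have h := is_deriveB (is_derive_id x (1:R)) (is_derive_cst m x (1:R)).
  by apply: (is_derive_ext h) => //; rewrite subr0.
- by move=> x; rewrite lerDr.
- by apply: integrable_normal_pdf_le => // x; rewrite normr1 lerDl sqr_ge0.
- under eq_fun do rewrite -expr2.
  by apply: integrable_normal_pdf_le => // x; rewrite ger0_norm ?sqr_ge0// lerDr.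
Qed.

(** Let F(t) be the left-hand side. Differentiation under the integral, dominated by (1 + (x - m)^2)
    phi, and Stein's identity for the sine give F' = - s^2 t F, so F(t) exp(s^2 t^2 / 2) is
    constant. *)
Lemma normal_cos (t c : R) :
  \int[normal_prob m s]_x cos (t * (x - m) + c) = cos c * expR (- (s ^+ 2 * t ^+ 2 / 2)).
Proof.
have cl (u : R) : continuous (fun x : R => u * (x - m) + c).
  move=> x; apply: cvgD; last exact: cvg_cst.
  by apply: cvgM; [exact: cvg_cst|apply: cvgB; [exact: cvg_id|exact: cvg_cst]].
have ccos (u : R) : continuous (fun x : R => cos (u * (x - m) + c)).
  by move=> x; apply: continuous_comp; [exact: cl|exact: continuous_cos].
have csin (u : R) : continuous (fun x : R => sin (u * (x - m) + c)).
  by move=> x; apply: continuous_comp; [exact: cl|exact: continuous_sin].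
have mcos u := continuous_measurable_fun (ccos u).
have msin u := continuous_measurable_fun (csin u).
have le1 (u : R) x : `|u| <= 1 -> `|u| <= 1 + (x - m) ^+ 2.
  by move=> /le_trans; apply; rewrite lerDl sqr_ge0.
have cos1 (y : R) : `|cos y| <= 1 by rewrite ler_norml cos_geN1 cos_le1.
have sin1 (y : R) : `|sin y| <= 1 by rewrite ler_norml sin_geN1 sin_le1.
rewrite Rintegral_normal_prob//; last first.
  by apply: integrable_normal_prob_le => // x; exact: le1.
pose f (u x : R) := cos (u * (x - m) + c) * phi x.
pose F u := \int[mu]_x (f u x).
have dl (u x : R) : is_derive u (1:R) (fun v => v * (x - m) + c) (x - m).
  have h := is_deriveD (is_deriveZ (x - m) (is_derive_id u (1:R))) (is_derive_cst c u (1:R)).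
  apply: (is_derive_ext h) => [v|]; rewrite /GRing.scale/= ?addr0 ?mulr1//.
  by rewrite fctE /GRing.scale/= mulrC.
have dlx (u x : R) : is_derive x (1:R) (fun v => u * (v - m) + c) u.
  have h := is_deriveD (is_deriveZ u (is_deriveB (is_derive_id x (1:R)) (is_derive_cst m x (1:R)))) (is_derive_cst c x (1:R)).
  by apply: (is_derive_ext h) => [v|]; rewrite /GRing.scale/= ?addr0 ?subr0 ?mulr1.
have df (u x : R) : is_derive u (1:R) (f ^~ x) (- ((x - m) * sin (u * (x - m) + c) * phi x)).
  have h := is_deriveZ (phi x) (is_derive1_comp (is_derive_cos _) (dl u x)).
  apply: (is_derive_ext h) => [v|]; rewrite /f /GRing.scale/=; last by ring.
  exact: mulrC.
have dF u : is_derive u (1:R) F (- (s ^+ 2 * u) * F u).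
  have hyp1 : forall v, v \in `]u - 1, u + 1[ -> mu.-integrable setT (EFin \o f v).
    by move=> v _; apply: integrable_normal_pdf_le => // x; exact: le1.
  have hyp2 : forall v x, v \in `]u - 1, u + 1[ -> setT x -> derivable (f ^~ x) v 1.
    by move=> v x _ _; case: (df v x).
  have hypu : u \in `]u - 1, u + 1[ by rewrite in_itv/= ltrDl ltrBlDl ltrDr ltr01.
  have hypG : forall v x, v \in `]u - 1, u + 1[ -> setT x ->
      `|partial1of2 f v x| <= (1 + (x - m) ^+ 2) * phi x.
    move=> v x _ _; rewrite partial1of2E; have [_ ->] := df v x.
    have p0 := normal_pdf_ge0 m s x.
    rewrite normrN normrM (ger0_norm p0) ler_wpM2r// normrM.
    by rewrite (le_trans _ (abs_le_sqr _))// ler_piMr.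
  have hypG0 x : 0 <= (1 + (x - m) ^+ 2) * phi x.
    by rewrite mulr_ge0 ?normal_pdf_ge0// addr_ge0// sqr_ge0.
  have D1 := @derivable_under_integral R _ _ mu f setT measurableT u (u-1) (u+1) hypu
    hyp1 hyp2 _ hypG0 integrable_normal_pdf_sqr hypG.
  have D2 := @differentiation_under_integral R _ _ mu f setT measurableT u (u-1) (u+1) hypu
    hyp1 hyp2 _ hypG0 integrable_normal_pdf_sqr hypG.
  apply: DeriveDef => //.
  rewrite -derive1E D2.
  under eq_Rintegral do rewrite partial1of2E (@derive_val _ _ _ _ _ _ _ (df _ _)).
  have i1 : mu.-integrable setT (fun x => ((x - m) * sin (u * (x - m) + c) * phi x)%:E).
    apply: integrable_normal_pdf_le => [|x].
      by apply: measurable_funM => //; exact: measurable_funB.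
    by rewrite normrM (le_trans _ (abs_le_sqr _))// ler_piMr.
  transitivity (- \int[mu]_x ((x - m) * sin (u * (x - m) + c) * phi x)).
    rewrite -[RHS]mulN1r -RintegralZl//.
    by apply: eq_Rintegral => x _; rewrite mulN1r.
  rewrite mulNr; congr (- _); rewrite -mulrA.
  have iF : mu.-integrable setT (fun x => (f u x)%:E).
    by apply: integrable_normal_pdf_le => // x; exact: le1.
  rewrite -RintegralZl//.
  have dsin (x : R) : is_derive x (1:R) (fun x => sin (u * (x - m) + c)) (u * cos (u * (x - m) + c)).
    have h := is_derive1_comp (is_derive_sin _) (dlx u x).
    by apply: (is_derive_ext h) => //; rewrite mulrC.
  rewrite (@normal_ibp _ (fun x => u * cos (u * (x - m) + c)))//.
  - by congr (_ * _); apply: eq_Rintegral => x _; rewrite /f mulrA.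
  - by move=> x; apply: cvgM; [exact: cvg_cst|exact: ccos].
  - by move=> x; rewrite (le_trans (sin1 _))// lerDl.
  - under eq_fun do rewrite -mulrA EFinM.
    exact: integrableZl.
pose H (u : R) : R := F u * expR (s ^+ 2 * u ^+ 2 / 2).
have dH u : is_derive u (1:R) H 0.
  have h1 := is_deriveZ (s ^+ 2 / 2) (is_deriveX 2 (is_derive_id u (1:R))).
  have h2 : is_derive u (1:R) (fun v : R => s ^+ 2 * v ^+ 2 / 2) (s ^+ 2 * u).
    apply: (is_derive_ext h1) => [v|]; rewrite /GRing.scale/= ?fctE /GRing.scale/=; by field.
  have h3 := is_deriveM (dF u) (is_derive1_comp (is_derive_expR _) h2).
  apply: (is_derive_ext h3) => //.
  rewrite -[LHS]/(F u * (expR (s ^+ 2 * u ^+ 2 / 2) * (s ^+ 2 * u)) +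
    expR (s ^+ 2 * u ^+ 2 / 2) * (- (s ^+ 2 * u) * F u)).
  by ring.
have := is_derive_0_is_cst t 0 dH.
rewrite /H expr0n/= mulr0 mul0r expR0 mulr1.
have -> : F 0 = cos c.
  rewrite /F /f; under eq_Rintegral do rewrite mul0r add0r.
  rewrite RintegralZl ?Rintegral_normal_pdf ?mulr1//.
  exact: integrable_normal_pdf.
by rewrite /F expRN => <-; rewrite mulfK// gt_eqF// expR_gt0.
Qed.

End Pdf.
End NormalCharacteristic.

Lemma bounded_integrable (R : realType) (disp : measure_display)
    (T : measurableType disp) (P : probability T R) (f : T -> R) (M : R) :
  measurable_fun setT f -> (forall w, `|f w| <= M) ->
  P.-integrable setT (EFin \o f).
Proof.
move=> mf fM; apply: measurable_bounded_integrable => //.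
  by rewrite (le_lt_trans (probability_le1 _ measurableT))// ltry.
exists M; split; first exact: num_real.
by move=> K MK w _ /=; rewrite (le_trans (fM w)) ?ltW.
Qed.

(** * Moments of Gaussian vectors *)

Section GaussianVariables.
Context (R : realType) (disp : measure_display) (T : measurableType disp).
Variable P : probability T R.

Lemma Rintegral_probability_cst (c : R) : \int[P]_w c = c.
Proof.
rewrite -[LHS]/(\int[P]_w (cst c w)) Rintegral_cst//= .
by rewrite [X in fine X]probability_setT mulr1.
Qed.

Lemma integral_law (nu : {measure set (measurableTypeR R) -> \bar R}) (Y : T -> R) (f : R -> R) :
  measurable_fun setT Y ->
  (forall B, measurable B -> P (Y @^-1` B) = nu B) ->
  measurable_fun setT f ->
  nu.-integrable setT (EFin \o f) ->
  P.-integrable setT (EFin \o (f \o Y)) /\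
  \int[P]_w f (Y w) = \int[nu]_y f y.
Proof.
move=> mY hY mf inuf.
have mEf : measurable_fun setT (EFin \o f) by exact/measurable_EFinP.
pose Y' : T -> measurableTypeR R := Y.
have mY' : measurable_fun setT Y' by [].
have e (g : R -> \bar R) : (\int[nu]_y g y = \int[pushforward P Y']_y g y)%E.
  by apply: eq_measure_integral => A mA _; rewrite -hY.
have int : P.-integrable setT (EFin \o (f \o Y)).
  apply/integrableP; split; first exact/measurable_EFinP/measurableT_comp.
  have /integrableP[_] := inuf; rewrite e ge0_integral_pushforward//.
  exact/measurableT_comp.
split => //; rewrite /Rintegral e integral_pushforward//.
Qed.

(** Merges the normal and the Dirac law, with v = s^2 or v = 0; later arguments see only
    measurability, these moments and the means of cosines. *)
Lemma gaussian_rvE (Y : T -> R) : gaussian_rv P Y ->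
  measurable_fun setT Y /\
  exists m v, [/\ P.-integrable setT (EFin \o Y),
    P.-integrable setT (EFin \o (fun w => (Y w) ^+ 2)),
    \int[P]_w Y w = m, \int[P]_w (Y w - m) ^+ 2 = v &
    forall t c, \int[P]_w cos (t * (Y w - m) + c) = cos c * expR (- (v * t ^+ 2 / 2))].
Proof.
have mid (m : R) : measurable_fun setT (fun x : R => x - m) by exact: measurable_funB.
have mcos (t m c : R) : measurable_fun setT (fun x : R => cos (t * (x - m) + c)).
  apply: (@measurableT_comp _ _ _ _ _ _ (@cos R)).
    by apply: continuous_measurable_fun; exact: continuous_cos.
  by apply: measurable_funD => //; exact: measurable_funM.
have msq (m : R) : measurable_fun setT (fun x : R => (x - m) ^+ 2).
  exact: measurable_funX.
case=> mY hlaw; split => //.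
suff H : forall (nu : {measure set (measurableTypeR R) -> \bar R}) m v,
   (forall B, measurable B -> P (Y @^-1` B) = nu B) ->
   [/\ nu.-integrable setT (EFin \o (fun x => x - m)),
     nu.-integrable setT (EFin \o (fun x => (x - m) ^+ 2)),
     forall t c, nu.-integrable setT (EFin \o (fun x => cos (t * (x - m) + c))) &
     [/\ \int[nu]_x (x - m) = 0, \int[nu]_x (x - m) ^+ 2 = v &
      forall t c, \int[nu]_x cos (t * (x - m) + c) = cos c * expR (- (v * t ^+ 2 / 2))]] ->
   exists m v, [/\ P.-integrable setT (EFin \o Y),
    P.-integrable setT (EFin \o (fun w => (Y w) ^+ 2)),
    \int[P]_w Y w = m, \int[P]_w (Y w - m) ^+ 2 = v &
    forall t c, \int[P]_w cos (t * (Y w - m) + c) = cos c * expR (- (v * t ^+ 2 / 2))].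
  case: hlaw => [[m [s [s0 hs]]]|[m hm]].
  - apply: (H (normal_prob m s) m (s ^+ 2) hs); split => //.
    + by apply: (integrable_normal_prob_le s0) => // x; exact: abs_le_sqr.
    + by apply: (integrable_normal_prob_le s0) => // x; rewrite ger0_norm ?sqr_ge0// lerDr.
    + move=> t c; apply: (@bounded_integrable _ _ _ _ _ 1) => [|x]; first exact: mcos.
      by rewrite ler_norml cos_geN1 cos_le1.
    + split; [exact: normal_mean|exact: normal_variance|].
      by move=> t c; exact: normal_cos.
  - have ed (f : R -> R) : measurable_fun setT f -> \int[\d_(m : measurableTypeR R)]_x f x = f m.
      move=> mf; rewrite /Rintegral integral_dirac//; last exact/measurable_EFinP.
      by rewrite diracT mul1e.
    have di (f : R -> R) : measurable_fun setT f -> (\d_(m : measurableTypeR R)).-integrable setT (EFin \o f).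
      move=> mf; apply/integrableP; split; first exact/measurable_EFinP.
      rewrite integral_dirac//; last exact/measurableT_comp/measurable_EFinP.
      by rewrite diracT mul1e/= ltry.
    apply: (H (\d_(m : measurableTypeR R)) m 0 hm); split => //; [exact: di|exact: di|by move=> t c; exact: di|].
    split => [||t c]; rewrite ed// ?subrr ?expr0n//.
    by rewrite mulr0 add0r !mul0r oppr0 expR0 mulr1.
move=> nu m v hnu [i1 i2 i3 [j1 j2 j3]].
have [k1 l1] := integral_law mY hnu (mid m) i1.
have [k2 l2] := integral_law mY hnu (msq m) i2.
have k0 : P.-integrable setT (EFin \o Y).
  have -> : EFin \o Y = (fun w => (Y w - m)%:E + m%:E)%E.
    by apply/funext => w /=; rewrite -EFinD subrK.
  by apply: integrableD => //; exact: finite_measure_integrable_cst.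
have eY : \int[P]_w Y w = m.
  have : \int[P]_w (Y w - m) = 0 by rewrite l1.
  rewrite RintegralB//; last exact: finite_measure_integrable_cst.
  rewrite Rintegral_probability_cst.
  by move/eqP; rewrite subr_eq0 => /eqP.
exists m, v; split => //.
- have -> : EFin \o (fun w => Y w ^+ 2) =
      (fun w => ((Y w - m) ^+ 2)%:E + ((2 * m)%:E * (Y w)%:E + (- m ^+ 2)%:E))%E.
    by apply/funext => w /=; rewrite -EFinM -!EFinD; congr EFin; ring.
  apply: integrableD => //; apply: integrableD => //; last exact: finite_measure_integrable_cst.
  exact: integrableZl.
- by rewrite l2.
- by move=> t c; have [_ ->] := integral_law mY hnu (mcos t m c) (i3 t c).
Qed.

Notation cmp a Z := (fun w => (a^T *m Z w) 0 0).

Section CenteredGaussianVector.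
Variables (n : nat) (Z : T -> 'cV[R]_n).
Hypotheses (gZ : gaussian_vec P Z) (mZ : mean_vec P Z = 0).
Notation S := (cov_mx P Z Z).

Lemma coord_delta i w : (delta_mx i 0 : 'cV[R]_n)^T *m Z w = (Z w i 0)%:M.
Proof.
by rewrite trmx_delta -rowE; apply/matrixP => a b; rewrite !mxE !ord1 eqxx mulr1n.
Qed.

Lemma gaussian_coord i : gaussian_rv P (fun w => Z w i 0).
Proof.
have := gZ (delta_mx i 0).
by under eq_fun do rewrite coord_delta mxE eqxx mulr1n.
Qed.

Lemma measurable_coord i : measurable_fun setT (fun w => Z w i 0).
Proof. by have [] := gaussian_rvE (gaussian_coord i). Qed.

Lemma integrable_coord i : P.-integrable setT (fun w => (Z w i 0)%:E).
Proof. by have [_ [? [? []]]] := gaussian_rvE (gaussian_coord i). Qed.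

Lemma mean_coord i : \int[P]_w (Z w i 0) = 0.
Proof.
have := congr1 (fun v : 'cV_n => v i 0) mZ; rewrite !mxE => <-.
by rewrite unlock.
Qed.

Lemma integrable_coordM i j : P.-integrable setT (fun w => (Z w i 0 * Z w j 0)%:E).
Proof.
have [mi [? [? [_ ii _ _ _]]]] := gaussian_rvE (gaussian_coord i).
have [mj [? [? [_ jj _ _ _]]]] := gaussian_rvE (gaussian_coord j).
apply: le_integrable (integrableD measurableT ii jj) => //.
  by apply/measurable_EFinP/measurable_funM.
move=> w _ /=; rewrite lee_fin [leRHS]ger0_norm ?addr_ge0 ?sqr_ge0// normrM.
rewrite -(real_normK (num_real (Z w i 0))) -(real_normK (num_real (Z w j 0))).
have := sqr_ge0 (`|Z w i 0| - `|Z w j 0|).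
have := sqr_ge0 (`|Z w i 0|); have := sqr_ge0 (`|Z w j 0|).
set a := `|_|; set b := `|_|; nra.
Qed.

Lemma cov_coord i j : \int[P]_w (Z w i 0 * Z w j 0) = S i j.
Proof.
have E0 k : fine (\int[P]_w (Z w k 0)%:E)%E = 0 := mean_coord k.
rewrite mxE covariance.unlock expectation.unlock !E0 /Rintegral; congr fine.
apply: eq_integral => w _; congr (_%:E).
by rewrite -[RHS]/((Z w i 0 - 0) * (Z w j 0 - 0)) !subr0.
Qed.

Lemma sum_coord (a : 'cV[R]_n) w : (a^T *m Z w) 0 0 = \sum_i a i 0 * Z w i 0.
Proof. by rewrite mxE; apply: eq_bigr => i _; rewrite mxE. Qed.

Lemma Rintegral_sum (I : Type) (r : seq I) (F : I -> T -> R) :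
  (forall i, P.-integrable setT (fun w => (F i w)%:E)) ->
  P.-integrable setT (fun w => (\sum_(i <- r) F i w)%:E) /\
  \int[P]_w (\sum_(i <- r) F i w) = \sum_(i <- r) \int[P]_w F i w.
Proof.
move=> iF; elim: r => [|i r [IH1 IH2]].
  under eq_fun do rewrite big_nil.
  split; first exact: finite_measure_integrable_cst.
  by under eq_Rintegral do rewrite big_nil; rewrite Rintegral_probability_cst big_nil.
under eq_fun do rewrite big_cons EFinD.
split; first exact: integrableD.
by under eq_Rintegral do rewrite big_cons; rewrite (RintegralD measurableT (iF i) IH1) IH2 big_cons.
Qed.

Lemma mean_cmp (a : 'cV[R]_n) : \int[P]_w cmp a Z w = 0.
Proof.
under eq_Rintegral do rewrite sum_coord.
have [|_ ->] := @Rintegral_sum _ (index_enum 'I_n) (fun i w => a i 0 * Z w i 0).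
  by move=> i; under eq_fun do rewrite EFinM; apply: integrableZl => //; exact: integrable_coord.
rewrite big1// => i _; rewrite RintegralZl// ?mean_coord ?mulr0//.
exact: integrable_coord.
Qed.

Lemma cov_cmp (a b : 'cV[R]_n) :
  P.-integrable setT (fun w => (cmp a Z w * cmp b Z w)%:E) /\
  \int[P]_w (cmp a Z w * cmp b Z w) = (a^T *m S *m b) 0 0.
Proof.
have iM i j : P.-integrable setT (fun w => (a i 0 * (b j 0 * (Z w i 0 * Z w j 0)))%:E).
  under eq_fun do rewrite mulrA EFinM.
  by apply: integrableZl => //; exact: integrable_coordM.
have [i1 e1] := @Rintegral_sum _ (index_enum 'I_n)
  (fun i w => \sum_j (a i 0 * (b j 0 * (Z w i 0 * Z w j 0))))
  (fun i => (@Rintegral_sum _ (index_enum 'I_n) _ (iM i)).1).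
have e w : cmp a Z w * cmp b Z w = \sum_i \sum_j (a i 0 * (b j 0 * (Z w i 0 * Z w j 0))).
  rewrite !sum_coord mulr_suml; apply: eq_bigr => i _.
  by rewrite mulr_sumr; apply: eq_bigr => j _; ring.
split; first by under eq_fun do rewrite e.
under eq_Rintegral do rewrite e.
rewrite e1 -mulmxA mxE; apply: eq_bigr => i _.
rewrite (@Rintegral_sum _ (index_enum 'I_n) _ (iM i)).2 !mxE mulr_sumr.
have iM' j : P.-integrable setT (fun w => (b j 0 * (Z w i 0 * Z w j 0))%:E).
  by under eq_fun do rewrite EFinM; apply: integrableZl => //; exact: integrable_coordM.
apply: eq_bigr => j _; rewrite RintegralZl//; last exact: iM'.
rewrite RintegralZl//; last exact: integrable_coordM.
by rewrite cov_coord; ring.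
Qed.

Lemma measurable_cmp (a : 'cV[R]_n) : measurable_fun setT (cmp a Z).
Proof. by have [] := gaussian_rvE (gZ a). Qed.

Lemma gaussian_cos (a : 'cV[R]_n) (c : R) :
  \int[P]_w cos (cmp a Z w + c) = cos c * expR (- ((a^T *m S *m a) 0 0 / 2)).
Proof.
have [ma [m [v [_ _ em ev h]]]] := gaussian_rvE (gZ a).
rewrite mean_cmp in em; rewrite -em in h ev.
have ev' : v = (a^T *m S *m a) 0 0.
  rewrite -(cov_cmp a a).2 -ev; apply: eq_Rintegral => w _.
  by rewrite subr0 expr2.
have := h 1 c; rewrite expr1n mulr1 -ev' => <-.
by apply: eq_Rintegral => w _; rewrite mul1r subr0.
Qed.

End CenteredGaussianVector.
End GaussianVariables.

Lemma integrable_scale (R : realType) (disp : measure_display) (T : measurableType disp)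
    (P : {measure set T -> \bar R}) (k : R) (f : T -> R) :
  P.-integrable setT (fun w => (f w)%:E) -> P.-integrable setT (fun w => (k * f w)%:E).
Proof. by move=> h; under eq_fun do rewrite EFinM; exact: integrableZl. Qed.

Definition sigma_vec (R : realType) (disp : measure_display) (T : measurableType disp)
    (p : nat) (X : T -> 'cV[R]_p) : set (set T) :=
  <<s [set A | exists i (B : set R), measurable B /\ A = (fun w => X w i 0) @^-1` B] >>.

(** * Uncorrelated Gaussian vectors are independent *)

Section FourierUniqueness.
Context (R : realType) (disp : measure_display) (T : measurableType disp).
Variable P : probability T R.
Notation cmp a Z := (fun w => (a^T *m Z w) 0 0).

Definition bounded_measurable (f : T -> R) : Prop :=
  measurable_fun setT f /\ exists M, forall w, `|f w| <= M.

Lemma bounded_measurable_integrable f : bounded_measurable f ->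
  P.-integrable setT (fun w => (f w)%:E).
Proof. by case=> mf [M fM]; exact: (bounded_integrable P mf fM). Qed.

Lemma bounded_measurable_cst c : bounded_measurable (fun=> c).
Proof. by split => //; exists `|c|. Qed.

Lemma bounded_measurableD f g : bounded_measurable f -> bounded_measurable g ->
  bounded_measurable (fun w => f w + g w).
Proof.
move=> [mf [M fM]] [mg [K gK]]; split; first exact: measurable_funD.
by exists (M + K) => w; rewrite (le_trans (ler_normD _ _))// lerD.
Qed.

Lemma bounded_measurableM f g : bounded_measurable f -> bounded_measurable g ->
  bounded_measurable (fun w => f w * g w).
Proof.
move=> [mf [M fM]] [mg [K gK]]; split; first exact: measurable_funM.
by exists (M * K) => w; rewrite normrM ler_pM.
Qed.

Lemma bounded_measurableB f g : bounded_measurable f -> bounded_measurable g ->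
  bounded_measurable (fun w => f w - g w).
Proof.
move=> hf hg; have := bounded_measurableD hf (bounded_measurableM (bounded_measurable_cst (-1)) hg).
by congr bounded_measurable; apply/funext => w; rewrite mulN1r.
Qed.

Lemma bounded_measurable_indic (E : set T) : measurable E -> bounded_measurable (\1_E : T -> R).
Proof.
move=> mE; split; first exact: measurable_indic.
by exists 1 => w; rewrite indicE; case: (_ \in _); rewrite ?normr0 ?normr1.
Qed.

Lemma bounded_measurable_cos (f : T -> R) : measurable_fun setT f ->
  bounded_measurable (fun w => cos (f w)).
Proof.
move=> mf; split; last by exists 1 => w; rewrite ler_norml cos_geN1 cos_le1.
apply: (@measurableT_comp _ _ _ _ _ _ (@cos R)) => //.
by apply: continuous_measurable_fun; exact: continuous_cos.
Qed.

Variables (p : nat) (X : T -> 'cV[R]_p).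
Hypothesis mX : forall s : 'cV[R]_p, measurable_fun setT (cmp s X).

(* The multipliers form an algebra that is closed under bounded limits and contains
   the functions [cos (s.X + c)]; hence it contains the indicators of [sigma_vec X]. *)
Definition fourier_null (V : T -> R) : Prop :=
  bounded_measurable V /\
  forall (s : 'cV[R]_p) (c : R), \int[P]_w (cos (cmp s X w + c) * V w) = 0.

(** Asking for stability under multiplication, rather than for orthogonality to a fixed V, closes
    the class under products by mere composition. *)
Definition multiplier (h : T -> R) : Prop :=
  bounded_measurable h /\
  forall V, fourier_null V -> fourier_null (fun w => h w * V w).

Lemma bounded_measurable_cos_cmp (s : 'cV[R]_p) c : bounded_measurable (fun w => cos (cmp s X w + c)).
Proof. by apply: bounded_measurable_cos; exact: measurable_funD. Qed.

Lemma multiplier_cst c : multiplier (fun=> c).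
Proof.
split; first exact: bounded_measurable_cst.
move=> V [bV hV]; split; first by apply: bounded_measurableM => //; exact: bounded_measurable_cst.
move=> s c'; under eq_Rintegral do rewrite mulrCA.
rewrite RintegralZl// ?hV ?mulr0//.
by apply: bounded_measurable_integrable; apply: bounded_measurableM => //; exact: bounded_measurable_cos_cmp.
Qed.

Lemma multiplierD h k : multiplier h -> multiplier k -> multiplier (fun w => h w + k w).
Proof.
move=> [bh hh] [bk hk]; split; first exact: bounded_measurableD.
move=> V QV; have [b1 i1] := hh V QV; have [b2 i2] := hk V QV.
split.
  by apply: bounded_measurableM; [exact: bounded_measurableD|case: QV].
move=> s c; under eq_Rintegral do rewrite mulrDl mulrDr.
rewrite RintegralD// ?i1 ?i2 ?addr0//;
  by apply: bounded_measurable_integrable; apply: bounded_measurableM => //; exact: bounded_measurable_cos_cmp.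
Qed.

Lemma multiplierM h k : multiplier h -> multiplier k -> multiplier (fun w => h w * k w).
Proof.
move=> [bh hh] [bk hk]; split; first exact: bounded_measurableM.
move=> V QV; have := hh _ (hk V QV).
by congr fourier_null; apply/funext => w; rewrite mulrA.
Qed.

Lemma multiplierX h n : multiplier h -> multiplier (fun w => h w ^+ n).
Proof.
move=> hh; elim: n => [|n IH]; first exact: multiplier_cst.
by under eq_fun do rewrite exprS; exact: multiplierM.
Qed.

Lemma multiplierB h k : multiplier h -> multiplier k -> multiplier (fun w => h w - k w).
Proof.
move=> hh hk; have := multiplierD hh (multiplierM (multiplier_cst (-1)) hk).
by congr multiplier; apply/funext => w; rewrite mulN1r.
Qed.

(** A product of two cosines is half the sum of the cosines at frequencies s' + s and s' - s, and V
    is null at both. *)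
Lemma multiplier_cos (s : 'cV[R]_p) c : multiplier (fun w => cos (cmp s X w + c)).
Proof.
split; first exact: bounded_measurable_cos_cmp.
move=> V [bV hV]; split; first by apply: bounded_measurableM => //; exact: bounded_measurable_cos_cmp.
move=> s' c'.
transitivity (\int[P]_w (2^-1 * (cos (cmp (s' + s) X w + (c' + c)) * V w)
   + 2^-1 * (cos (cmp (s' - s) X w + (c' - c)) * V w))).
  apply: eq_Rintegral => w _.
  rewrite linearD/= linearB/= mulmxDl mulmxBl !mxE.
  set a := \sum_j _; set b := \sum_j _.
  rewrite (_ : a + b + (c' + c) = (a + c') + (b + c)); last by ring.
  rewrite (_ : a - b + (c' - c) = (a + c') - (b + c)); last by ring.
  by rewrite (cosD (a + c')) (cosB (a + c')); field.
have i (u : 'cV[R]_p) e : P.-integrable setT (fun w => (cos (cmp u X w + e) * V w)%:E).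
  by apply: bounded_measurable_integrable; apply: bounded_measurableM => //; exact: bounded_measurable_cos_cmp.
rewrite RintegralD//; last 2 first.
- by apply: integrable_scale; exact: i.
- by apply: integrable_scale; exact: i.
by rewrite !RintegralZl ?hV ?mulr0 ?addr0//; exact: i.
Qed.

Lemma multiplier_lim (h_ : nat -> T -> R) (h : T -> R) (M : R) :
  (forall n, multiplier (h_ n)) -> (forall n w, `|h_ n w| <= M) ->
  (forall w, h_ n w @[n --> \oo] --> h w) -> multiplier h.
Proof.
move=> hh hM hlim.
have bh : bounded_measurable h.
  split.
    apply: (@measurable_fun_cvg _ _ _ setT h_) => [n|w _]; last exact: hlim.
    by have [[]] := hh n.
  exists M => w.
  have hn : `|h_ n w| @[n --> \oo] --> `|h w| by apply: cvg_norm; exact: hlim.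
  rewrite -(cvg_lim _ hn)//.
  by apply: limr_le; [apply/cvg_ex; eexists; exact: hn|exact: nearW].
split => // V QV; have [bV hV] := QV; split; first exact: bounded_measurableM.
move=> s c.
have [K VK] := bV.2.
have K0 : 0 <= K by rewrite (le_trans (normr_ge0 (V point)) (VK _)).
have M0 : 0 <= M by rewrite (le_trans (normr_ge0 (h_ 0%N point)) (hM _ _)).
have [| | | |_ lim] := @Rintegral_dominated_cvg R _ _ P
   (fun n w => cos (cmp s X w + c) * (h_ n w * V w))
   (fun w => cos (cmp s X w + c) * (h w * V w)) (fun=> M * K).
- move=> n; have [[mh _] _] := hh n.
  by apply: measurable_funM; [case: (bounded_measurable_cos_cmp s c)|apply: measurable_funM => //; case: bV].
- move=> w; apply: cvgM; first exact: cvg_cst.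
  by apply: cvgM; [exact: hlim|exact: cvg_cst].
- exact: finite_measure_integrable_cst.
- move=> n w; rewrite normrM -[leRHS]mul1r ler_pM//.
    by rewrite ler_norml cos_geN1 cos_le1.
  by rewrite normrM ler_pM.
apply/esym; move: lim; rewrite (_ : (fun n => _) = cst 0); last first.
  by apply/funext => n; have [_] := hh n; move=> /(_ V QV) [_ ->].
by move=> /cvg_lim <- //; rewrite lim_cst.
Qed.

(* The odd cubic [y |-> (3 y - y^3) / 2] maps [-1, 1] to itself, and its
   iterates converge to the sign function there. *)
Definition sg_step (y : R) : R := (3 * y - y ^+ 3) / 2.

Lemma sg_step_le1 y : `|y| <= 1 -> `|sg_step y| <= 1.
Proof.
rewrite !ler_norml /sg_step => /andP[y1 y2]; apply/andP; split.
  have : 0 <= (1 + y) ^+ 2 * (2 - y) by rewrite mulr_ge0 ?sqr_ge0//; lra.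
  have -> : (1 + y) ^+ 2 * (2 - y) = 2 + (3 * y - y ^+ 3) by ring.
  lra.
have : 0 <= (1 - y) ^+ 2 * (2 + y) by rewrite mulr_ge0 ?sqr_ge0//; lra.
have -> : (1 - y) ^+ 2 * (2 + y) = 2 - (3 * y - y ^+ 3) by ring.
lra.
Qed.

Lemma sg_stepN y : sg_step (- y) = - sg_step y.
Proof. by rewrite /sg_step; field. Qed.

Lemma iter_sg_step_le1 n y : `|y| <= 1 -> `|iter n sg_step y| <= 1.
Proof. by move=> y1; elim: n => //= n; exact: sg_step_le1. Qed.

Lemma iter_sg_stepN n y : iter n sg_step (- y) = - iter n sg_step y.
Proof. by elim: n => //= n ->; exact: sg_stepN. Qed.

(** From 1 - sg_step u = (1 - u)^2 (1 + u / 2): for u >= y the distance to 1 shrinks by the factor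
    (1 - u) (1 + u / 2) <= 1 - y / 2. *)
Lemma iter_sg_step_gt0 n y : 0 < y <= 1 ->
  y <= iter n sg_step y <= 1 /\ 1 - iter n sg_step y <= (1 - y / 2) ^+ n.
Proof.
move=> /andP[y0 y1]; elim: n => [|n [/andP[h1 h2] h3]] /=.
  by rewrite lexx y1 expr0; split => //; lra.
set u := iter n sg_step y in h1 h2 h3 *.
have e : 1 - sg_step u = (1 - u) * ((1 - u) * (1 + u / 2)) by rewrite /sg_step; field.
have le : (1 - u) * (1 + u / 2) <= 1 - y / 2 by nra.
have ge : 0 <= (1 - u) * (1 + u / 2) by nra.
split.
  apply/andP; split; last by rewrite -subr_ge0 e mulr_ge0// subr_ge0.
  rewrite (le_trans h1)// -subr_ge0.
  by have -> : sg_step u - u = u * (1 - u) * (1 + u) / 2 by [rewrite /sg_step; field]; nra.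
by rewrite e exprSr ler_pM// subr_ge0.
Qed.

Lemma iter_sg_step_cvg y : `|y| <= 1 -> iter n sg_step y @[n --> \oo] --> Num.sg y.
Proof.
have pos z : 0 < z <= 1 -> iter n sg_step z @[n --> \oo] --> (1 : R).
  move=> z01; have /andP[z0 z1] := z01.
  have c0 : (1 - z / 2) ^+ n @[n --> \oo] --> (0:R).
    by apply: cvg_expr; rewrite ger0_norm; lra.
  have : 1 - (1 - z / 2) ^+ n @[n --> \oo] --> (1 - 0 : R).
    by apply: cvgB => //; exact: cvg_cst.
  rewrite subr0 => c1.
  apply: (squeeze_cvgr _ c1 (cvg_cst (1 : R))).
  apply: nearW => n; have [/andP[_ h2] h3] := iter_sg_step_gt0 n z01.
  by rewrite h2 andbT lerBlDl -lerBlDr.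
rewrite ler_norml => /andP[y1 y2]; case: (ltrgt0P y) => y0.
- by rewrite gtr0_sg//; apply: pos; rewrite y0.
- rewrite ltr0_sg//.
  have : - iter n sg_step (- y) @[n --> \oo] --> - (1 : R).
    by apply: cvgN; apply: pos; rewrite oppr_gt0 y0 lerNl.
  by under eq_fun do rewrite iter_sg_stepN opprK.
- rewrite y0 sgr0; have e n : iter n sg_step 0 = 0 :> R.
    by elim: n => //= n ->; rewrite /sg_step mulr0 expr0n subrr mul0r.
  by under eq_fun do rewrite e; exact: cvg_cst.
Qed.

(** The iterates of [sg_step] at h are polynomials in h bounded by 1, hence multipliers; their limit
    is the sign of h, and the indicator is (sg^2 + sg) / 2. *)
Lemma multiplier_gt0 h : multiplier h -> (forall w, `|h w| <= 1) ->
  multiplier (\1_[set w | 0 < h w]).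
Proof.
move=> mh h1.
have ms n : multiplier (fun w => iter n sg_step (h w)).
  elim: n => [|n IH] //=; rewrite /sg_step.
  under eq_fun do rewrite mulrC.
  apply: multiplierM; first exact: multiplier_cst.
  apply: multiplierB; last exact: multiplierX.
  by apply: multiplierM => //; exact: multiplier_cst.
have msg : multiplier (fun w => Num.sg (h w)).
  apply: (multiplier_lim ms (M := 1)) => [n w|w]; first exact: iter_sg_step_le1.
  exact: iter_sg_step_cvg.
rewrite (_ : \1_ _ = fun w => 2^-1 * (Num.sg (h w) ^+ 2 + Num.sg (h w))).
  apply: multiplierM; first exact: multiplier_cst.
  by apply: multiplierD => //; exact: multiplierX.
apply/funext => w; rewrite indicE; case: (ltrgt0P (h w)) => hw.
- by rewrite mem_set//= gtr0_sg//; field.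
- by rewrite memNset/= ?ltr0_sg//; [field|apply/negP; rewrite -leNgt ltW].
- by rewrite memNset/= hw ?sgr0 ?ltxx//; field.
Qed.

Definition multiplier_set : set (set T) := [set E | multiplier (\1_E)].

(** Finite unions come from the algebra, as 1_A + 1_B - 1_A 1_B; countable ones are bounded limits
    of these. *)
Lemma multiplier_set_sigma_algebra : sigma_algebra setT multiplier_set.
Proof.
have h0 : multiplier_set set0.
  by rewrite /multiplier_set/= indic0; exact: multiplier_cst.
have hU A B : multiplier_set A -> multiplier_set B -> multiplier_set (A `|` B).
  rewrite /multiplier_set/= => mA mB.
  have := multiplierB (multiplierD mA mB) (multiplierM mA mB).
  congr multiplier; apply/funext => w; rewrite !indicE in_setU.
  by case: (w \in A); case: (w \in B) => /=; ring.
split => //.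
- move=> A mA; have := multiplierB (multiplier_cst 1) mA.
  congr multiplier; apply/funext => w; rewrite !indicE setTD in_setC.
  by case: (w \in A) => /=; ring.
- move=> F mF.
  have mF' n : multiplier (\1_(\big[setU/set0]_(i < n) F i)).
    elim: n => [|n IH]; first by rewrite big_ord0.
    by rewrite big_ord_recr/=; exact: hU.
  apply: (multiplier_lim mF' (M := 1)) => [n w|w].
    by rewrite indicE; case: (_ \in _); rewrite ?normr0 ?normr1.
  apply: cvg_near_cst; rewrite !indicE.
  have [|nw] := boolP (w \in \bigcup_i F i).
    rewrite inE => -[k _ Fk]; exists k.+1 => // n /= kn.
    rewrite indicE mem_set// -bigcup_mkord; exists k => //.
  apply: nearW => n; rewrite indicE memNset// -bigcup_mkord => -[k _ Fk].
  by move/negP: nw; apply; rewrite inE; exists k.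
Qed.

(** The sine of (s.X - a) / (n + 1) is a cosine with shifted phase, hence a multiplier; for n large
    its argument lies in ]-pi, pi[, where the sine has the sign of s.X - a. *)
Lemma multiplier_set_ray (s : 'cV[R]_p) (a : R) : multiplier_set [set w | a < cmp s X w].
Proof.
pose h n w : R := sin (n.+1%:R^-1 * (cmp s X w - a)).
have mh n : multiplier (h n).
  have := multiplier_cos (n.+1%:R^-1 *: s) (- (n.+1%:R^-1 * a) - pi / 2).
  congr multiplier; apply/funext => w; rewrite /h linearZ/= -scalemxAl mxE.
  by rewrite addrA -mulrBr cosBpihalf.
have m1 n : multiplier (\1_[set w | 0 < h n w]).
  by apply: multiplier_gt0 => // w; rewrite ler_norml sin_geN1 sin_le1.
apply: (multiplier_lim m1 (M := 1)) => [n w|w].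
  by rewrite indicE; case: (_ \in _); rewrite ?normr0 ?normr1.
apply: cvg_near_cst; exists (Num.bound `|cmp s X w - a|) => // n /= hn.
set y := cmp s X w - a in hn.
have yn : `|n.+1%:R^-1 * y| < pi.
  apply: (@lt_trans _ _ 1); last by rewrite (lt_le_trans _ (pi_ge2 R))// ltr1n.
  rewrite normrM ger0_norm// mulrC ltr_pdivrMr// mul1r.
  by rewrite (lt_le_trans (archi_boundP _))// ler_nat ltnW.
rewrite !indicE; congr (nat_of_bool _)%:R.
apply/idP/idP; rewrite !inE /= => H.
- rewrite -subr_gt0 -/y ltNge; apply/negP => y0.
  have : 0 <= - h n w.
    rewrite /h -/y -sinN -mulrN; apply: sin_ge0_pi.
    rewrite mulr_ge0 ?oppr_ge0//=; move: yn; rewrite ltr_norml => /andP[].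
    by rewrite mulrN lerNl => /ltW.
  by rewrite oppr_ge0 leNgt H.
- rewrite /h -/y; apply: sin_gt0_pi; rewrite mulr_gt0//= ?subr_gt0//.
  by move: yn; rewrite ltr_norml => /andP[].
Qed.

Lemma sigma_vec_multiplier : sigma_vec X `<=` multiplier_set.
Proof.
apply: smallest_sub; first exact: multiplier_set_sigma_algebra.
move=> _ [i [B [mB ->]]].
have : (@RGenOInfty.G R).-sigma.-measurable B.
  by rewrite -RGenOInfty.measurableE.
have cX w : X w i 0 = ((delta_mx i 0 : 'cV[R]_p)^T *m X w) 0 0.
  by rewrite trmx_delta -rowE mxE.
apply: (@smallest_sub _ (sigma_algebra setT) _ [set B | multiplier_set ((fun w => X w i 0) @^-1` B)]).
- have [s0 sC sU] := multiplier_set_sigma_algebra; split => //=.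
  + by move=> A /sC; rewrite !setTD preimage_setC.
  + by move=> F /sU; rewrite preimage_bigcup.
- move=> _ [a ->] /=.
  have := multiplier_set_ray (delta_mx i 0) a.
  congr multiplier_set; apply/seteqP; split => w /=; rewrite in_itv/= andbT cX//.
Qed.

(** Fourier uniqueness: multiplication by the indicator keeps V null, and the null condition at
    frequency 0 is the integral. *)
Lemma fourier_null_sigma_vec (V : T -> R) (E : set T) : fourier_null V ->
  sigma_vec X E -> \int[P]_w (\1_E w * V w) = 0.
Proof.
move=> hV /sigma_vec_multiplier [_ /(_ V hV) [_ /(_ 0 0)]].
under eq_Rintegral do rewrite trmx0 mul0mx mxE addr0 cos0 mul1r.
by [].
Qed.

End FourierUniqueness.

Section GaussianIndependence.
Context (R : realType) (disp : measure_display) (T : measurableType disp).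
Variable P : probability T R.
Variables (n : nat) (Z : T -> 'cV[R]_n).
Hypotheses (gZ : gaussian_vec P Z) (mZ : mean_vec P Z = 0).
Notation S := (cov_mx P Z Z).
Notation cmp a Z := (fun w => (a^T *m Z w) 0 0).

Lemma cmp_linear p (A : 'M[R]_(p, n)) (s : 'cV[R]_p) w :
  (s^T *m (A *m Z w)) 0 0 = ((A^T *m s)^T *m Z w) 0 0.
Proof. by rewrite trmx_mul trmxK mulmxA. Qed.

Lemma measurable_linear p (A : 'M[R]_(p, n)) (s : 'cV[R]_p) :
  measurable_fun setT (fun w => (s^T *m (A *m Z w)) 0 0).
Proof. by under eq_fun do rewrite cmp_linear; exact: (measurable_cmp gZ). Qed.

Lemma sigma_vec_measurable p (A : 'M[R]_(p, n)) :
  sigma_vec (fun w => A *m Z w) `<=` measurable.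
Proof.
apply: smallest_sub; first exact: sigma_algebra_measurable.
move=> _ [i [B [mB ->]]].
rewrite -[X in measurable X]setTI.
have := @measurable_linear _ A (delta_mx i 0) measurableT B mB.
by under eq_fun do rewrite trmx_delta -rowE mxE.
Qed.

(* cos (u + c) cos (v + c') is half the sum of the cosines of u + v + (c + c') and
   u - v + (c - c'), and u + v and u - v both have variance Var u + Var v. *)
Lemma gaussian_cosM (a b : 'cV[R]_n) (c c' : R) : a^T *m S *m b = 0 ->
  \int[P]_w (cos (cmp a Z w + c) * cos (cmp b Z w + c')) =
  \int[P]_w cos (cmp a Z w + c) * \int[P]_w cos (cmp b Z w + c').
Proof.
move=> ab.
have STr : S^T = S by apply/matrixP => i j; rewrite !mxE covarianceC.
have ba : b^T *m S *m a = 0.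
  by rewrite -[LHS]trmxK trmx_mul (trmx_mul b^T) (trmxK b) STr mulmxA ab trmx0.
transitivity (\int[P]_w (2^-1 * cos (cmp (a + b) Z w + (c + c'))
   + 2^-1 * cos (cmp (a - b) Z w + (c - c')))).
  apply: eq_Rintegral => w _.
  rewrite linearD/= linearB/= mulmxDl mulmxBl !mxE.
  set x := \sum_j _; set y := \sum_j _.
  rewrite (_ : x + y + (c + c') = (x + c) + (y + c')); last by ring.
  rewrite (_ : x - y + (c - c') = (x + c) - (y + c')); last by ring.
  by rewrite (cosD (x + c)) (cosB (x + c)); field.
have i (u : 'cV_n) e : P.-integrable setT (fun w => (cos (cmp u Z w + e))%:E).
  apply: bounded_measurable_integrable; apply: bounded_measurable_cos.
  by apply: measurable_funD => //; exact: (measurable_cmp gZ).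
rewrite RintegralD//; last 2 first.
- by apply: integrable_scale; exact: i.
- by apply: integrable_scale; exact: i.
rewrite !RintegralZl//; [|exact: i..].
rewrite !(gaussian_cos gZ mZ).
have -> : (a + b)^T *m S *m (a + b) = a^T *m S *m a + b^T *m S *m b.
  have -> : (a + b)^T = a^T + b^T by rewrite linearD.
  by rewrite !mulmxDl !mulmxDr ab ba addr0 add0r.
have -> : (a - b)^T *m S *m (a - b) = a^T *m S *m a + b^T *m S *m b.
  have -> : (a - b)^T = a^T - b^T by rewrite linearB.
  by rewrite !mulmxBl !mulmxBr ab ba subr0 sub0r opprK.
have eD (M1 M2 : 'M[R]_1) : (M1 + M2) 0 0 = M1 0 0 + M2 0 0 by rewrite mxE.
rewrite eD; set u := (_ *m a) 0 0; set v := (_ *m b) 0 0.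
by rewrite mulrDl opprD expRD cosD cosB; field.
Qed.

Lemma gaussian_fourier_null p (A : 'M[R]_(p, n)) (b : 'cV[R]_n) (c : R) :
  A *m S *m b = 0 ->
  fourier_null P (fun w => A *m Z w)
    (fun w => cos (cmp b Z w + c) - \int[P]_w' cos (cmp b Z w' + c)).
Proof.
move=> ASb.
have bcos (a : 'cV[R]_n) e : bounded_measurable (fun w => cos (cmp a Z w + e)).
  by apply: bounded_measurable_cos; apply: measurable_funD => //; exact: (measurable_cmp gZ).
have bI := @bounded_measurable_integrable R _ T P.
split; first by apply: bounded_measurableB => //; exact: bounded_measurable_cst.
move=> s e; under eq_Rintegral do rewrite cmp_linear mulrBr.
rewrite RintegralB//; last 2 first.
- by apply: bI; apply: bounded_measurableM; exact: bcos.
- by apply: bI; apply: bounded_measurableM; [exact: bcos|exact: bounded_measurable_cst].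
rewrite RintegralZr//; last by apply: bI; exact: bcos.
rewrite gaussian_cosM ?subrr//.
by rewrite trmx_mul trmxK -!mulmxA (mulmxA A) ASb mulmx0.
Qed.

(** Fourier uniqueness is used twice: for A Z against the centred cosines of B Z, which shows that
    1_E - P(E) is null for B Z, and then for B Z against this function. *)
Lemma gaussian_indep p q (A : 'M[R]_(p, n)) (B : 'M[R]_(q, n)) (E F : set T) :
  A *m S *m B^T = 0 ->
  sigma_vec (fun w => A *m Z w) E -> sigma_vec (fun w => B *m Z w) F ->
  P (E `&` F) = (P E * P F)%E.
Proof.
move=> ASB hE hF.
have mE := sigma_vec_measurable hE; have mF := sigma_vec_measurable hF.
have mA := @measurable_linear _ A; have mB := @measurable_linear _ B.
have bB (b : 'cV_n) c : bounded_measurable (fun w => cos (cmp b Z w + c)).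
  by apply: bounded_measurable_cos; apply: measurable_funD => //; exact: (measurable_cmp gZ).
have b1E : bounded_measurable (\1_E : T -> R) by exact: bounded_measurable_indic.
have b1F : bounded_measurable (\1_F : T -> R) by exact: bounded_measurable_indic.
have bI := @bounded_measurable_integrable R _ T P.
have bc := @bounded_measurable_cst R _ T.
have intE : \int[P]_w (\1_E w : R) = fine (P E).
  by rewrite /Rintegral integral_indic// setIT.
have nullB : fourier_null P (fun w => B *m Z w) (fun w => \1_E w - fine (P E)).
  split; first exact: bounded_measurableB.
  move=> t c.
  have ASb : A *m S *m (B^T *m t) = 0 by rewrite mulmxA ASB mul0mx.
  have := fourier_null_sigma_vec mA (gaussian_fourier_null c ASb) hE.
  under eq_Rintegral do rewrite mulrBr.
  rewrite RintegralB//; last 2 first.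
  - by apply: bI; exact: (bounded_measurableM b1E (bB _ _)).
  - by apply: bI; exact: bounded_measurableM.
  rewrite RintegralZr//; last exact: bI.
  rewrite intE => h; under eq_Rintegral do rewrite cmp_linear mulrBr.
  rewrite RintegralB//; last 2 first.
  - by apply: bI; exact: (bounded_measurableM (bB _ _) b1E).
  - by apply: bI; exact: (bounded_measurableM (bB _ _)).
  rewrite RintegralZr//; last exact: (bI _ (bB _ _)).
  by rewrite [X in _ - X]mulrC -[RHS]h; congr (_ - _); apply: eq_Rintegral => w _; exact: mulrC.
have := fourier_null_sigma_vec mB nullB hF.
under eq_Rintegral do rewrite mulrBr.
rewrite RintegralB//; last 2 first.
- by apply: bI; exact: bounded_measurableM.
- by apply: bI; exact: bounded_measurableM.
rewrite RintegralZr//; last exact: bI.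
have intF : \int[P]_w (\1_F w : R) = fine (P F).
  by rewrite /Rintegral integral_indic// setIT.
have intEF : \int[P]_w (\1_F w * \1_E w : R) = fine (P (E `&` F)).
  have mEF : measurable (E `&` F) by exact: measurableI.
  under eq_Rintegral do rewrite mulrC -[_ * _]/((\1_E \* \1_F) _) -indicI.
  by rewrite /Rintegral integral_indic// setIT.
rewrite intF intEF => /eqP; rewrite subr_eq0 mulrC => /eqP e.
have fP D : measurable D -> P D \is a fin_num by move=> mD; exact: fin_num_measure.
by rewrite -[LHS]fineK ?fP ?e ?EFinM ?fineK ?fP//; exact: measurableI.
Qed.

End GaussianIndependence.

(** * Conditional independence of Gaussian vectors *)

Section ConditionalTransfer.
Context (R : realType) (disp : measure_display) (T : measurableType disp).
Variable P : probability T R.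
Context d1 d2 (T1 : measurableType d1) (T2 : measurableType d2).
Variables (X : T -> T1) (Y : T -> T2).
Hypotheses (mX : measurable_fun setT X) (mY : measurable_fun setT Y).
Hypothesis indepXY : forall A B, measurable A -> measurable B ->
  P (X @^-1` A `&` Y @^-1` B) = (P (X @^-1` A) * P (Y @^-1` B))%E.

Let fX : {mfun T >-> T1} := MeasurableFun.Pack (MeasurableFun.Class (isMeasurableFun.Build _ _ _ _ _ mX)).
Let fY : {mfun T >-> T2} := MeasurableFun.Pack (MeasurableFun.Class (isMeasurableFun.Build _ _ _ _ _ mY)).
Let mXY : measurable_fun setT (fun w => (X w, Y w)).
Proof. exact: measurable_fun_pair. Qed.
Let fXY : {mfun T >-> (T1 * T2)%type} := MeasurableFun.Pack (MeasurableFun.Class (isMeasurableFun.Build _ _ _ _ _ mXY)).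

Lemma joint_law (D : set (T1 * T2)) : measurable D ->
  P [set w | D (X w, Y w)] = (distribution P fX \x distribution P fY)%E D.
Proof.
move=> mD; by rewrite (@product_measure_unique _ _ _ _ _ _ _ (distribution P fXY)).
Qed.

(* Since [X] and [Y] are independent, conditioning on [X] amounts to freezing it. *)
Lemma cond_prob_freeze (H : set (set T)) (D : set (T1 * T2)) :
  (forall E, H E <-> exists2 C, measurable C & E = X @^-1` C) ->
  measurable D ->
  is_cond_prob P H [set w | D (X w, Y w)]
    (fun w => fine (P (Y @^-1` xsection D (X w)))).
Proof.
move=> hH mD.
have mD1 x : measurable (Y @^-1` xsection D x).
  by rewrite -[X in measurable X]setTI; apply: mY => //; exact: measurable_xsection.
have fin x : P (Y @^-1` xsection D x) \is a fin_num by exact: fin_num_measure.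
pose F x := fine (P (Y @^-1` xsection D x)).
have mF : measurable_fun setT F.
  apply: measurableT_comp; first exact: fine_measurable.
  exact: (measurable_fun_xsection (distribution P fY) mD).
have mFX : measurable_fun setT (F \o X) by exact: measurableT_comp.
split.
- move=> B mB; apply/hH; exists (F @^-1` B) => //.
  by rewrite -[X in measurable X]setTI; exact: mF.
- apply: (@bounded_integrable _ _ _ _ _ 1) => // w.
  rewrite ger0_norm ?fine_ge0// -lee_fin fineK//; exact: probability_le1.
- move=> E /hH[C mC ->].
  have mCD : measurable (D `&` (C `*` setT)).
    by apply: measurableI => //; exact: measurableX.
  have -> : [set w | D (X w, Y w)] `&` X @^-1` C =
            [set w | (D `&` (C `*` setT)) (X w, Y w)].
    by apply/seteqP; split => w /=; [move=> [? ?]|move=> [? []]].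
  rewrite joint_law// /product_measure1.
  rewrite ge0_integral_distribution//; last first.
    exact: (measurable_fun_xsection (distribution P fY) mCD).
  rewrite integral_mkcond; apply: eq_integral => w _; rewrite patchE /=.
  rewrite /distribution /pushforward/= xsectionI.
  case: ifPn => [|nC].
    rewrite inE /= => Cw; rewrite fineK//; congr (P _).
    by rewrite in_xsectionX ?inE// setIT.
  by rewrite notin_xsectionX ?setI0 ?preimage_set0 ?measure0//; apply: contraNN nC; rewrite !inE.
Qed.

End ConditionalTransfer.

(** * Column vectors as a measurable space *)

Section VectorMeasurability.
Variables (R : realType).

Definition coord_sets (p : nat) : set (set 'cV[R]_p) :=
  [set A | exists i (B : set R), measurable B /\ A = (fun v : 'cV[R]_p => v i 0) @^-1` B].

(** With the sigma-algebra generated by the coordinates, [sigma_vec X] is exactly the preimage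
    sigma-algebra of X, and pairs of vectors fall under the product measures of [joint_law]. *)
Definition vecT (p : nat) := g_sigma_algebraType (@coord_sets p).

HB.instance Definition _ p := Measurable.on (vecT p).

Lemma measurable_vec_coord p (i : 'I_p) : measurable_fun setT (fun v : vecT p => (v : 'cV[R]_p) i 0).
Proof.
move=> _ B mB; rewrite setTI; apply: sub_sigma_algebra.
by exists i, B.
Qed.

Lemma measurable_vecP d (T : measurableType d) p (X : T -> vecT p) :
  (forall i, measurable_fun setT (fun w => (X w : 'cV[R]_p) i 0)) -> measurable_fun setT X.
Proof.
move=> mX; apply: (@measurability _ _ T (vecT p) setT X (@coord_sets p)) => //.
by move=> _ [_ [i [B [mB ->]]] <-]; exact: mX.
Qed.

Lemma sigma_vecE d (T : measurableType d) p (X : T -> 'cV[R]_p) (E : set T) :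
  sigma_vec X E <-> exists2 C : set (vecT p), measurable C & E = X @^-1` C.
Proof.
have -> : sigma_vec X = <<s preimage_set_system setT X (@coord_sets p) >>.
  congr (<<s _ >>); apply/seteqP; split => A.
    move=> [i [B [mB ->]]]; exists ((fun v : 'cV[R]_p => v i 0) @^-1` B); last by rewrite setTI.
    by exists i, B.
  by move=> [_ [i [B [mB ->]]] <-]; exists i, B; rewrite setTI.
rewrite (@g_sigma_preimageE T (vecT p)); split.
  by move=> [C mC <-]; exists C => //; rewrite setTI.
by move=> [C mC ->]; exists C => //; rewrite setTI.
Qed.

Lemma measurable_affine q p r (K : 'M[R]_(p, q)) (L : 'M[R]_(p, r)) :
  measurable_fun setT (fun z : vecT q * vecT r => (K *m z.1 + L *m z.2 : 'cV[R]_p) : vecT p).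
Proof.
have mlin m (k : 'I_m -> R) d (T : measurableType d) (f : 'I_m -> T -> R) :
    (forall i, measurable_fun setT (f i)) -> measurable_fun setT (fun w => \sum_i k i * f i w).
  by move=> mf; apply: measurable_sum => i; exact: measurable_funM.
apply: measurable_vecP => i.
under eq_fun do rewrite !mxE; apply: measurable_funD.
- apply: (mlin _ (fun j => K i j) _ _ (fun j (z : vecT q * vecT r) => (z.1 : 'cV[R]_q) j 0)) => j.
  by apply: (@measurableT_comp _ _ _ _ _ _ (fun v : vecT q => (v : 'cV[R]_q) j 0)) => //; exact: measurable_vec_coord.
- apply: (mlin _ (fun j => L i j) _ _ (fun j (z : vecT q * vecT r) => (z.2 : 'cV[R]_r) j 0)) => j.
  by apply: (@measurableT_comp _ _ _ _ _ _ (fun v : vecT r => (v : 'cV[R]_r) j 0)) => //; exact: measurable_vec_coord.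
Qed.

End VectorMeasurability.

(** * Uncorrelated residuals give conditional independence *)

Section GaussianConditionalIndependence.
Context (R : realType) (disp : measure_display) (T : measurableType disp).
Variable P : probability T R.
Variables (n : nat) (Z : T -> 'cV[R]_n).
Hypotheses (gZ : gaussian_vec P Z) (mZ : mean_vec P Z = 0).
Notation S := (cov_mx P Z Z).
Notation cmp a Z := (fun w => (a^T *m Z w) 0 0).

Lemma measurable_linear_vec p (A : 'M[R]_(p, n)) :
  measurable_fun setT (fun w => (A *m Z w : 'cV[R]_p) : vecT R p).
Proof.
apply: measurable_vecP => i.
have := @measurable_linear _ _ _ _ _ _ gZ _ A (delta_mx i 0).
by under eq_fun do rewrite trmx_delta -rowE mxE.
Qed.

Lemma gaussian_cond_indep c p q (C : 'M[R]_(c, n)) (A : 'M[R]_(p, n)) (B : 'M[R]_(q, n))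
    (K : 'M[R]_(p, c)) (L : 'M[R]_(q, c)) :
  (A - K *m C) *m S *m C^T = 0 ->
  (B - L *m C) *m S *m C^T = 0 ->
  (A - K *m C) *m S *m (B - L *m C)^T = 0 ->
  cond_indep P (sigma_vec (fun w => C *m Z w)) (sigma_vec (fun w => A *m Z w))
    (sigma_vec (fun w => B *m Z w)).
Proof.
set U := A - K *m C; set V := B - L *m C => USC VSC USV.
move=> E F /sigma_vecE[E' mE' EE] /sigma_vecE[F' mF' FF].
pose X w : vecT R c := C *m Z w.
pose Y w : vecT R (p + q) := col_mx U V *m Z w.
have mX : measurable_fun setT X := measurable_linear_vec C.
have mY : measurable_fun setT Y := measurable_linear_vec (col_mx U V).
have indepXY G H : measurable G -> measurable H ->
    P (X @^-1` G `&` Y @^-1` H) = (P (X @^-1` G) * P (Y @^-1` H))%E.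
  move=> mG mH; rewrite setIC muleC; apply: (gaussian_indep gZ mZ (A := col_mx U V) (B := C)).
  - by rewrite !mul_col_mx USC VSC col_mx0.
  - by apply/sigma_vecE; exists H.
  - by apply/sigma_vecE; exists G.
pose DE : set (vecT R c * vecT R (p + q)) :=
  [set z | E' (K *m (z.1 : 'cV[R]_c) + row_mx 1%:M 0 *m (z.2 : 'cV[R]_(p + q)))].
pose DF : set (vecT R c * vecT R (p + q)) :=
  [set z | F' (L *m (z.1 : 'cV[R]_c) + row_mx 0 1%:M *m (z.2 : 'cV[R]_(p + q)))].
have mDE : measurable DE.
  by rewrite -[X in measurable X]setTI; exact: (measurable_affine K (row_mx 1%:M 0)).
have mDF : measurable DF.
  by rewrite -[X in measurable X]setTI; exact: (measurable_affine L (row_mx 0 1%:M)).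
have AE w : A *m Z w = K *m (X w : 'cV[R]_c) + row_mx 1%:M 0 *m (Y w : 'cV[R]_(p + q)).
  by rewrite /X /Y mul_col_mx mul_row_col mul1mx mul0mx addr0 !mulmxA -mulmxDl addrC subrK.
have BF w : B *m Z w = L *m (X w : 'cV[R]_c) + row_mx 0 1%:M *m (Y w : 'cV[R]_(p + q)).
  by rewrite /X /Y mul_col_mx mul_row_col mul1mx mul0mx add0r !mulmxA -mulmxDl addrC subrK.
have EE' : E = [set w | DE (X w, Y w)].
  by rewrite EE; apply/seteqP; split => w /=; rewrite AE.
have FF' : F = [set w | DF (X w, Y w)].
  by rewrite FF; apply/seteqP; split => w /=; rewrite BF.
have hH G : sigma_vec (fun w => C *m Z w) G <-> exists2 D, measurable D & G = X @^-1` D.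
  exact: sigma_vecE.
exists (fun w => fine (P (Y @^-1` xsection DE (X w)))),
  (fun w => fine (P (Y @^-1` xsection DF (X w)))); split.
- rewrite EE'; exact: cond_prob_freeze.
- rewrite FF'; exact: cond_prob_freeze.
- have -> : (fun w => fine (P (Y @^-1` xsection DE (X w)))) \*
     (fun w => fine (P (Y @^-1` xsection DF (X w)))) =
     (fun w => fine (P (Y @^-1` xsection (DE `&` DF) (X w)))).
    apply/funext => w /=; rewrite xsectionI preimage_setI.
    rewrite (gaussian_indep gZ mZ (A := U) (B := V))//.
    + rewrite fineM//; apply: fin_num_measure; rewrite -[X in measurable X]setTI;
        by apply: mY => //; exact: measurable_xsection.
    + apply/sigma_vecE.
      exists (xsection [set z : vecT R c * vecT R p | E' (K *m (z.1 : 'cV[R]_c) + 1%:M *m (z.2 : 'cV[R]_p))] (X w)).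
        apply: measurable_xsection; rewrite -[X in measurable X]setTI.
        exact: (measurable_affine K 1%:M).
      apply/seteqP; split => w' /=; rewrite !xsectionE /DE /Y /= mul_col_mx mul_row_col mul0mx addr0//.
    + apply/sigma_vecE.
      exists (xsection [set z : vecT R c * vecT R q | F' (L *m (z.1 : 'cV[R]_c) + 1%:M *m (z.2 : 'cV[R]_q))] (X w)).
        apply: measurable_xsection; rewrite -[X in measurable X]setTI.
        exact: (measurable_affine L 1%:M).
      apply/seteqP; split => w' /=; rewrite !xsectionE /DF /Y /= mul_col_mx mul_row_col mul0mx add0r//.
  have -> : E `&` F = [set w | (DE `&` DF) (X w, Y w)] by rewrite EE' FF'.
  by apply: cond_prob_freeze => //; exact: measurableI.
Qed.

End GaussianConditionalIndependence.

(** * Integrals against conditional probabilities, and their uniqueness *)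

Section ConditionalProbabilityMoments.
Context (R : realType) (disp : measure_display) (T : measurableType disp).
Variable P : probability T R.
Variable H : set (set T).
Hypotheses (sH : sigma_algebra setT H) (mH : H `<=` measurable).

Lemma Rintegral_indicM (D : set T) (W : T -> R) : measurable D ->
  \int[P]_(w in D) W w = \int[P]_w (\1_D w * W w).
Proof.
move=> mD; rewrite Rintegral_mkcond; apply: eq_Rintegral => w _.
by rewrite patchE indicE; case: (w \in D); rewrite ?mul1r ?mul0r.
Qed.

(* Uniform approximation of [h] by [n^-1 * #{i < n | h >= (i + 1) / n}]. *)
Lemma Rintegral_null_unit (W h : T -> R) :
  P.-integrable setT (EFin \o W) ->
  (forall D, H D -> \int[P]_w (\1_D w * W w) = 0) ->
  (forall B, measurable B -> H (h @^-1` B)) -> (forall w, 0 <= h w <= 1) ->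
  \int[P]_w (h w * W w) = 0.
Proof.
move=> iW H0 mh h01.
have mW : measurable_fun setT W by apply/measurable_EFinP; case/integrableP: iW.
pose D n i : set T := [set w | i.+1%:R / n.+1%:R <= h w].
have HD n i : H (D n i).
  have -> : D n i = h @^-1` `[i.+1%:R / n.+1%:R, +oo[%classic.
    by apply/seteqP; split => w /=; rewrite in_itv/= andbT.
  exact: mh.
have mD n i : measurable (D n i) by exact: mH.
pose hn n w : R := \sum_(i < n.+1) n.+1%:R^-1 * \1_(D n i) w.
have hnE n w : `|hn n w - h w| <= n.+1%:R^-1.
  have /andP[h0 h1] := h01 w.
  pose k := Num.truncn (n.+1%:R * h w).
  have nh0 : 0 <= n.+1%:R * h w by rewrite mulr_ge0.
  have kle : k%:R <= n.+1%:R * h w by rewrite truncn_le.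
  have kn : (k <= n.+1)%N by rewrite -(ler_nat R) (le_trans kle)// ler_piMr.
  have -> : hn n w = k%:R / n.+1%:R.
    rewrite /hn -mulr_sumr mulrC; congr (_ * _).
    have e (i : 'I_n.+1) : \1_(D n i) w = ((i < k)%N%:R : R).
      rewrite indicE; congr (nat_of_bool _)%:R.
      have -> : (i < k)%N = (i.+1%:R <= n.+1%:R * h w) by rewrite /k truncn_ge_nat.
      by apply/idP/idP; rewrite ?inE /D/= ler_pdivrMr// mulrC.
    under eq_bigr do rewrite e.
    rewrite -natr_sum -(big_mkord xpredT (fun i => (i < k)%N : nat)).
    rewrite (big_cat_nat (n := k))//= big_nat (eq_bigr (fun=> 1%N)); last by move=> i /andP[_ ->].
    rewrite -big_nat sum_nat_const_nat subn0 muln1.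
    rewrite big_nat big1 ?addn0// => i /andP[ki _].
    by rewrite ltnNge ki.
  rewrite distrC ger0_norm; last first.
    by rewrite subr_ge0 ler_pdivrMr// mulrC.
  rewrite -(ler_pM2l (ltr0Sn R n)) mulfV// mulrBr mulrCA mulfV// mulr1.
  have := truncnS_gt (n.+1%:R * h w); rewrite -/k -[X in _ < X]natr1; lra.
have ihn n : \int[P]_w (hn n w * W w) = 0.
  under eq_Rintegral do rewrite mulr_suml.
  have i1 i : P.-integrable setT (fun w => (n.+1%:R^-1 * \1_(D n i) w * W w)%:E).
    under eq_fun do rewrite -mulrA; apply: integrable_scale.
    apply: le_integrable iW => //; first by apply/measurable_EFinP/measurable_funM.
    move=> w _ /=; rewrite lee_fin normrM ler_piMl// indicE.
    by case: (_ \in _); rewrite ?normr0 ?normr1.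
  have [_ ->] := @Rintegral_sum _ _ _ P _ (index_enum 'I_n.+1) (fun (i : 'I_n.+1) w => n.+1%:R^-1 * \1_(D n i) w * W w) (fun i => i1 i).
  rewrite big1// => i _; under eq_Rintegral do rewrite -mulrA.
  rewrite RintegralZl// ?H0 ?mulr0//.
  apply: le_integrable iW => //; first by apply/measurable_EFinP/measurable_funM.
  move=> w _ /=; rewrite lee_fin normrM ler_piMl// indicE.
  by case: (_ \in _); rewrite ?normr0 ?normr1.
have [| | | |_ lim] := @Rintegral_dominated_cvg R _ _ P (fun n w => hn n w * W w)
   (fun w => h w * W w) (fun w => 2 * `|W w|).
- move=> n; apply: measurable_funM => //.
  by apply: measurable_sum => i; apply: measurable_funM.
- move=> w; apply: cvgM; last exact: cvg_cst.
  apply/cvgrPdist_le => e e0; near=> n.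
  rewrite distrC (le_trans (hnE n w))//.
  near: n; exists (Num.bound e^-1) => //= n hn'.
  rewrite -[leRHS]invrK lef_pV2 ?posrE ?invr_gt0// ltW//.
  by rewrite (lt_le_trans (archi_boundP _)) ?ler_nat ?leqW// invr_ge0 ltW.
- by apply: integrable_scale; exact: (integrable_norm iW).
- move=> n w; rewrite normrM ler_wpM2r//.
  have /andP[h0 h1] := h01 w.
  have := hnE n w; have : n.+1%:R^-1 <= 1 :> R by rewrite invf_le1// ler1n.
  move=> n1 hnw; have := le_trans hnw n1; rewrite !ler_norml => /andP[a b].
  by apply/andP; split; lra.
apply/esym; move: lim; rewrite (_ : (fun n => _) = cst 0); last by apply/funext => n; exact: ihn.
by move=> /cvg_lim <- //; rewrite lim_cst.
Unshelve. all: by end_near. Qed.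

Lemma Rintegral_null_bounded (W h : T -> R) (M : R) :
  P.-integrable setT (EFin \o W) ->
  (forall D, H D -> \int[P]_w (\1_D w * W w) = 0) ->
  (forall B, measurable B -> H (h @^-1` B)) -> (forall w, `|h w| <= M) ->
  \int[P]_w (h w * W w) = 0.
Proof.
move=> iW H0 mh hM.
have mW : measurable_fun setT W by apply/measurable_EFinP; case/integrableP: iW.
have M0 : 0 <= M by rewrite (le_trans (normr_ge0 (h point)) (hM _)).
(* [M + 1] rather than [M], because the affine map of [-K, K] onto [0, 1] divides by 2 K and M may
   be 0. *)
pose K := M + 1; have K0 : 0 < K by rewrite ltr_pwDr.
pose g w := (h w + K) / (2 * K).
have hE w : h w = 2 * K * g w - K.
  by rewrite /g mulrCA mulfV ?mulr1 ?addrK// mulf_neq0// gt_eqF.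
have mg : measurable_fun setT (fun x : R => (x + K) / (2 * K)).
  by apply: measurable_funM => //; exact: measurable_funD.
have g01 w : 0 <= g w <= 1.
  have := hM w; rewrite ler_norml /g => /andP[a b]; apply/andP; split.
    by rewrite divr_ge0 ?mulr_ge0 ?(ltW K0)// /K; lra.
  by rewrite ler_pdivrMr ?mulr_gt0// /K; lra.
have Hg B : measurable B -> H (g @^-1` B).
  move=> mB; apply: (mh ((fun x : R => (x + K) / (2 * K)) @^-1` B)).
  by rewrite -[X in measurable X]setTI; exact: mg.
have mg' : measurable_fun setT g.
  by move=> _ B mB; rewrite setTI; apply: mH; exact: Hg.
have i1 : P.-integrable setT (fun w => (g w * W w)%:E).
  apply: le_integrable iW => //; first by apply/measurable_EFinP/measurable_funM.
  move=> w _ /=; rewrite lee_fin normrM ler_piMl//.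
  by have /andP[a b] := g01 w; rewrite ger0_norm.
under eq_Rintegral do rewrite hE mulrBl -(mulrA (2 * K)).
rewrite RintegralB//; last 2 first.
- exact: integrable_scale.
- exact: integrable_scale.
rewrite !RintegralZl// (Rintegral_null_unit iW H0 Hg g01) mulr0 sub0r.
have HT : H setT by case: sH => a b _; rewrite -(setD0 setT); exact: b.
have := H0 _ HT; under eq_Rintegral do rewrite indicT mul1r.
by move=> ->; rewrite mulr0 oppr0.
Qed.

Lemma cond_prob_integrable (E : set T) f : is_cond_prob P H E f ->
  P.-integrable setT (fun w => (f w)%:E).
Proof. by case. Qed.

Lemma measurable_Rintegral_sub (E : set T) f D : is_cond_prob P H E f -> H D ->
  measurable E -> \int[P]_w (\1_D w * f w) = \int[P]_w (\1_D w * \1_E w).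
Proof.
move=> [_ _ hf] HD mE; have mD := mH HD.
rewrite -!Rintegral_indicM// /Rintegral hf// integral_indic//.
Qed.

(** The sign of f - f' is bounded and H-measurable, so testing f - f' against it gives E |f - f'| =
    0. *)
Lemma cond_prob_uniq (E : set T) f f' : measurable E ->
  is_cond_prob P H E f -> is_cond_prob P H E f' ->
  {ae P, forall w, f w = f' w}.
Proof.
move=> mE hf hf'.
have i1 := cond_prob_integrable hf; have i2 := cond_prob_integrable hf'.
have [m1 _ _] := hf; have [m2 _ _] := hf'.
pose W w := f w - f' w.
have iW : P.-integrable setT (fun w => (f w - f' w)%:E).
  by under eq_fun do rewrite EFinB; exact: integrableB.
(* Regarding f and f' as functions on T equipped with H turns H-measurability into ordinary
   measurability, which passes to the difference and to its sign. *)
have HE : H.-sigma.-measurable = H by exact: measurable_g_measurableTypeE.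
have mfun_H (g : T -> R) : (forall B, measurable B -> H (g @^-1` B)) ->
    measurable_fun setT (g : g_sigma_algebraType H -> R).
  by move=> hg _ B mB; rewrite setTI HE; exact: hg.
have mW : measurable_fun setT (W : g_sigma_algebraType H -> R).
  by apply: measurable_funB; exact: mfun_H.
have msg : measurable_fun setT (fun x : R => Num.sg x).
  have -> : (fun x : R => Num.sg x) = (fun x => \1_[set y | 0 < y] x - \1_[set y | y < 0] x).
    apply/funext => x; rewrite !indicE; case: (ltrgt0P x) => x0.
    - by rewrite gtr0_sg// mem_set// memNset/= ?subr0//; apply/negP; rewrite -leNgt ltW.
    - rewrite ltr0_sg// (mem_set (x0 : [set y | y < 0] x)) memNset/= ?sub0r//.
      by apply/negP; rewrite -leNgt ltW.
    - by rewrite x0 sgr0 !memNset/= ?ltxx// subrr.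
  apply: measurable_funB; apply: measurable_indic.
    rewrite (_ : [set y | 0 < y] = `]0, +oo[%classic)//.
    by apply/seteqP; split => y /=; rewrite in_itv/= andbT.
  by rewrite (_ : [set y | y < 0] = `]-oo, 0[%classic).
have := @Rintegral_null_bounded W (fun w => Num.sg (W w)) 1 iW.
have h1 : forall D, H D -> \int[P]_w (\1_D w * W w) = 0.
  move=> D HD; under eq_Rintegral do rewrite mulrBr.
  have b1 g : P.-integrable setT (fun w => (g w)%:E) -> P.-integrable setT (fun w => (\1_D w * g w)%:E).
    move=> ig; have mg : measurable_fun setT g by apply/measurable_EFinP; case/integrableP: ig.
    apply: le_integrable ig => //; first by apply/measurable_EFinP/measurable_funM => //; exact/measurable_indic/mH.
    move=> w _ /=; rewrite lee_fin normrM ler_piMl// indicE.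
    by case: (_ \in _); rewrite ?normr0 ?normr1.
  rewrite RintegralB//; [|exact: b1..].
  by rewrite (measurable_Rintegral_sub hf)// (measurable_Rintegral_sub hf')// subrr.
have h2 : forall B, measurable B -> H ((fun w => Num.sg (W w)) @^-1` B).
  move=> B mB.
  have := measurableT_comp msg mW measurableT mB.
  by rewrite setTI HE.
move=> /(_ h1 h2 _) e.
have {e} : \int[P]_w `|W w| = 0.
  rewrite -[RHS]e; first by apply: eq_Rintegral => w _; rewrite normrEsg.
  by move=> w; rewrite normr_sg lern1 leq_b1.
move=> e0.
have mWT : measurable_fun setT W by apply/measurable_EFinP; case/integrableP: iW.
have : (\int[P]_w `|(W w)%:E| = 0)%E.
  have fin : (\int[P]_w `|(W w)%:E|)%E \is a fin_num.
    by apply: integrable_fin_num => //; exact: integrable_abse.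
  by rewrite -[LHS]fineK// -[X in X%:E]/(\int[P]_w `|W w|) e0.
have mEW : measurable_fun setT (fun w => (W w)%:E) by exact/measurable_EFinP.
move/(ae_eq_integral_abs _ measurableT mEW).
apply: filterS => w /(_ Logic.I) /= [] /eqP; rewrite subr_eq0 => /eqP.
by [].
Qed.

End ConditionalProbabilityMoments.

(** * Conditional independence gives uncorrelated residuals *)

Section GaussianConditionalCovariance.
Context (R : realType) (disp : measure_display) (T : measurableType disp).
Variable P : probability T R.
Variables (n : nat) (Z : T -> 'cV[R]_n).
Hypotheses (gZ : gaussian_vec P Z) (mZ : mean_vec P Z = 0).
Notation S := (cov_mx P Z Z).
Notation cmp a Z := (fun w => (a^T *m Z w) 0 0).

Lemma sigma_vec_algebra p (X : T -> 'cV[R]_p) : sigma_algebra setT (sigma_vec X).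
Proof. exact: smallest_sigma_algebra. Qed.

Lemma sigma_vec_cos p (X : T -> 'cV[R]_p) (t : 'cV[R]_p) (e : R) (B : set R) :
  measurable B -> sigma_vec X ((fun w => cos ((t^T *m X w) 0 0 + e)) @^-1` B).
Proof.
move=> mB; apply/sigma_vecE.
exists ((fun v : vecT R p => cos ((t^T *m (v : 'cV[R]_p)) 0 0 + e)) @^-1` B) => //.
rewrite -[X in measurable X]setTI.
suff : measurable_fun setT (fun v : vecT R p => cos ((t^T *m (v : 'cV[R]_p)) 0 0 + e)) by exact.
apply: (@measurableT_comp _ _ _ _ _ _ (@cos R)).
  by apply: continuous_measurable_fun; exact: continuous_cos.
apply: measurable_funD => //; under eq_fun do rewrite mxE.
by apply: measurable_sum => i; apply: measurable_funM => //; exact: measurable_vec_coord.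
Qed.

(** Expand cos(u + v) as cos u cos v - sin u sin v. The factorization at c = 0 and at c = - pi / 2,
    where the means of the sines vanish, gives E cos(u + v) = E cos u E cos v; comparing exponents,
    Var(u + v) = Var u + Var v. *)
Lemma gaussian_cov0 (a b : 'cV[R]_n) :
  (forall c, \int[P]_w (cos (cmp a Z w + c) * cos (cmp b Z w + c)) =
     \int[P]_w cos (cmp a Z w + c) * \int[P]_w cos (cmp b Z w + c)) ->
  a^T *m S *m b = 0.
Proof.
move=> h.
have i (u : 'cV_n) e : bounded_measurable (fun w => cos (cmp u Z w + e)).
  apply: bounded_measurable_cos.
  by apply: measurable_funD => //; exact: (measurable_cmp gZ).
have bI := @bounded_measurable_integrable R _ T P.
have STr : S^T = S by apply/matrixP => j k; rewrite !mxE covarianceC.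
have ba : b^T *m S *m a = (a^T *m S *m b)^T.
  by rewrite trmx_mul (trmx_mul a^T) (trmxK a) STr mulmxA.
have : \int[P]_w cos (cmp (a + b) Z w + 0) =
    \int[P]_w cos (cmp a Z w + 0) * \int[P]_w cos (cmp b Z w + 0).
  transitivity (\int[P]_w (cos (cmp a Z w + 0) * cos (cmp b Z w + 0) -
      cos (cmp a Z w - pi / 2) * cos (cmp b Z w - pi / 2))).
    apply: eq_Rintegral => w _.
    by rewrite linearD/= mulmxDl mxE !addr0 cosD !cosBpihalf.
  rewrite RintegralB//; last 2 first.
  - by apply: bI; exact: (bounded_measurableM (i a _) (i b _)).
  - by apply: bI; exact: (bounded_measurableM (i a _) (i b _)).
  rewrite !h !(gaussian_cos gZ mZ) cosN cos_pihalf !mul0r subr0.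
  by [].
rewrite !(gaussian_cos gZ mZ) cos0 !mul1r -expRD.
have -> : (a + b)^T *m S *m (a + b) =
    a^T *m S *m a + a^T *m S *m b + (b^T *m S *m a + b^T *m S *m b).
  have -> : (a + b)^T = a^T + b^T by rewrite linearD.
  by rewrite !mulmxDl !mulmxDr.
move=> /expR_inj; rewrite ba.
have eD (M1 M2 : 'M[R]_1) : (M1 + M2) 0 0 = M1 0 0 + M2 0 0 by rewrite mxE.
rewrite !eD [(_ ^T) 0 0]mxE => e.
by apply/matrixP => j k; rewrite !ord1 [RHS]mxE; lra.
Qed.

(* If [B - L C] and [A - K C] are the residuals of the regressions on [C], then
   [P(E | C)] has a version depending on [E] only, so that conditional independence
   reads [E(1_F 1_D (1_E - P(E | C))) = 0]. Integrating the cosine of the residual of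
   [B] against this shows that it is uncorrelated with the cosine of [A]. *)
Lemma cond_indep_cov0 c p q (C : 'M[R]_(c, n)) (A : 'M[R]_(p, n)) (B : 'M[R]_(q, n))
    (K : 'M[R]_(p, c)) (L : 'M[R]_(q, c)) :
  (A - K *m C) *m S *m C^T = 0 ->
  (B - L *m C) *m S *m C^T = 0 ->
  cond_indep P (sigma_vec (fun w => C *m Z w)) (sigma_vec (fun w => A *m Z w))
    (sigma_vec (fun w => B *m Z w)) ->
  A *m S *m (B - L *m C)^T = 0.
Proof.
set U := A - K *m C; set V := B - L *m C => USC VSC ci.
have STr : S^T = S by apply/matrixP => j k; rewrite !mxE covarianceC.
pose H := sigma_vec (fun w => C *m Z w).
have sH : sigma_algebra setT H by exact: sigma_vec_algebra.
have mH : H `<=` measurable by exact: (sigma_vec_measurable gZ).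
have mA E : sigma_vec (fun w => A *m Z w) E -> measurable E by exact: (sigma_vec_measurable gZ).
have mB F : sigma_vec (fun w => B *m Z w) F -> measurable F by exact: (sigma_vec_measurable gZ).
have HI D D' : H D -> H D' -> H (D `&` D').
  move=> /sigma_vecE[G mG ->] /sigma_vecE[G' mG' ->]; apply/sigma_vecE.
  by exists (G `&` G') => //; exact: measurableI.
have HT : H setT.
  by case: sH => a b _; rewrite -(setD0 setT); exact: b.
have bI := @bounded_measurable_integrable R _ T P.
have bc := @bounded_measurable_cst R _ T.
have bcos (u : 'cV_n) e : bounded_measurable (fun w => cos (cmp u Z w + e)).
  apply: bounded_measurable_cos.
  by apply: measurable_funD => //; exact: (measurable_cmp gZ).
have cos1 (x : R) : `|cos x| <= 1 by rewrite ler_norml cos_geN1 cos_le1.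
(* Freezing C Z yields a version with values in [0, 1]; the versions provided by [cond_indep] may
   depend on both events and need not be bounded. *)
have version E : sigma_vec (fun w => A *m Z w) E ->
    exists2 f, is_cond_prob P H E f & forall w, 0 <= f w <= 1.
  move=> /sigma_vecE[E' mE' EE].
  pose X w : vecT R c := C *m Z w.
  pose Y w : vecT R p := U *m Z w.
  have mX : measurable_fun setT X := measurable_linear_vec gZ C.
  have mY : measurable_fun setT Y := measurable_linear_vec gZ U.
  pose D : set (vecT R c * vecT R p) :=
    [set z | E' (K *m (z.1 : 'cV[R]_c) + 1%:M *m (z.2 : 'cV[R]_p))].
  have mD : measurable D.
    by rewrite -[X in measurable X]setTI; exact: (measurable_affine K 1%:M).
  have AE w : A *m Z w = K *m (X w : 'cV[R]_c) + 1%:M *m (Y w : 'cV[R]_p).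
    by rewrite /X /Y mul1mx !mulmxA -mulmxDl addrC subrK.
  have -> : E = [set w | D (X w, Y w)].
    by rewrite EE; apply/seteqP; split => w /=; rewrite AE.
  exists (fun w => fine (P (Y @^-1` xsection D (X w)))).
    apply: cond_prob_freeze => //; last by move=> G; exact: sigma_vecE.
    move=> G1 G2 mG1 mG2; rewrite setIC muleC.
    apply: (gaussian_indep gZ mZ (A := U) (B := C)) => //.
      by apply/sigma_vecE; exists G2.
    by apply/sigma_vecE; exists G1.
  move=> w; rewrite fine_ge0//= -lee_fin fineK; last first.
    by apply: fin_num_measure; rewrite -[X in measurable X]setTI; apply: mY => //; exact: measurable_xsection.
  apply: probability_le1.
  by rewrite -[X in measurable X]setTI; apply: mY => //; exact: measurable_xsection.
(* By [gaussian_cov0] it is enough that cosines be uncorrelated; the delta vectors select one entry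
   of the matrix. *)
suff key : forall (a : 'cV[R]_p) (b : 'cV[R]_q) e e',
   \int[P]_w (cos (cmp (A^T *m a) Z w + e') *
      (cos (cmp (V^T *m b) Z w + e) - \int[P]_w' cos (cmp (V^T *m b) Z w' + e))) = 0.
  apply/matrixP => i j; rewrite [RHS]mxE.
  pose a : 'cV[R]_p := delta_mx i 0; pose b : 'cV[R]_q := delta_mx j 0.
  have -> : (A *m S *m V^T) i j = ((A^T *m a)^T *m S *m (V^T *m b)) 0 0.
    rewrite [in RHS]trmx_mul trmxK mulmxA -(mulmxA a^T) -(mulmxA a^T).
    by rewrite trmx_delta -rowE -colE !mxE.
  rewrite gaussian_cov0 ?mxE// => e.
  have := key a b e e; under eq_Rintegral do rewrite mulrBr.
  rewrite RintegralB//; last 2 first.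
  - by apply: bI; apply: bounded_measurableM; exact: bcos.
  - by apply: bI; apply: bounded_measurableM.
  by rewrite RintegralZr//; [move=> /eqP; rewrite subr_eq0 => /eqP|apply: bI].
move=> a b e e'; set v := V^T *m b; set kappa := \int[P]_w' cos (cmp v Z w' + e).
apply: (@Rintegral_null_bounded R _ T P (sigma_vec (fun w => A *m Z w)) _ mA _ _ 1) => //.
- exact: sigma_vec_algebra.
- by apply: bI; exact: bounded_measurableB.
- move=> E hE; have mE := mA _ hE.
  have [f hf f01] := version E hE.
  have bE : bounded_measurable (\1_E : T -> R) by exact: bounded_measurable_indic.
  have bf : bounded_measurable f.
    split; last by exists 1 => w; have /andP[f0 f1] := f01 w; rewrite ger0_norm.
    by have [hmf _ _] := hf => _ G mG; rewrite setTI; apply: mH; exact: hmf.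
  have bW : bounded_measurable (fun w => \1_E w - f w) by exact: bounded_measurableB.
  have W0 F D : sigma_vec (fun w => B *m Z w) F -> H D ->
      \int[P]_w (\1_D w * (\1_F w * (\1_E w - f w))) = 0.
    move=> hF HD; have mF := mB _ hF; have mD := mH _ HD.
    have bD : bounded_measurable (\1_D : T -> R) by exact: bounded_measurable_indic.
    have bF : bounded_measurable (\1_F : T -> R) by exact: bounded_measurable_indic.
    have [f0 [g [hf0 hg hfg]]] := ci E F hE hF.
    have ig := cond_prob_integrable hg.
    have ibM (h k : T -> R) : bounded_measurable h -> P.-integrable setT (fun w => (k w)%:E) ->
        P.-integrable setT (fun w => (h w * k w)%:E).
      move=> [mh [M hM]] ik.
      have mk : measurable_fun setT k by apply/measurable_EFinP; case/integrableP: ik.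
      have iMk : P.-integrable setT (fun w => (M * k w)%:E) by exact: integrable_scale.
      apply: le_integrable iMk => //; first by apply/measurable_EFinP/measurable_funM.
      move=> w _ /=; rewrite lee_fin !normrM ler_wpM2r//.
      by rewrite (le_trans (hM w))// ler_norm.
    have e1 : \int[P]_w (f w * (\1_D w * (\1_F w - g w))) = 0.
      have i1 : P.-integrable setT (fun w => (\1_F w - g w)%:E).
        by under eq_fun do rewrite EFinB; apply: integrableB => //; exact: bI.
      apply: (@Rintegral_null_bounded R _ T P H sH mH _ _ 1) => //.
      - exact: ibM.
      - move=> D' HD'; have HDD := HI _ _ HD' HD.
        transitivity (\int[P]_w (\1_(D' `&` D) w * \1_F w - \1_(D' `&` D) w * g w)).
          apply: eq_Rintegral => w _; rewrite indicI/=; ring.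
        rewrite RintegralB//; last 2 first.
        + by apply: ibM; [exact/bounded_measurable_indic/mH|exact: bI].
        + by apply: ibM => //; exact/bounded_measurable_indic/mH.
        by rewrite (measurable_Rintegral_sub mH hg)// subrr.
      - by case: hf.
      - by move=> w; have /andP[f0' f1'] := f01 w; rewrite ger0_norm.
    have e2 : \int[P]_w (\1_D w * (f w * g w)) = \int[P]_w (\1_D w * (\1_E w * \1_F w)).
      transitivity (\int[P]_w (\1_D w * (f0 w * g w))).
        have [_ ifg _] := hfg.
        have i1 := ibM _ _ bD ifg.
        have i2 := ibM _ _ bD (ibM _ _ bf ig).
        rewrite /Rintegral; congr fine; apply: ae_eq_integral => //.
        - exact: (measurable_int P i2).
        - exact: (measurable_int P i1).
        apply: filterS (cond_prob_uniq sH mH mE hf hf0) => w /= ffw _.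
        by rewrite ffw.
      rewrite (measurable_Rintegral_sub mH hfg)//; last exact: measurableI.
      by apply: eq_Rintegral => w _; rewrite indicI.
    (* 1_D 1_F (1_E - f) equals 1_D 1_E 1_F minus f 1_D (1_F - g) minus 1_D f g; the middle term
       integrates to 0 by [e1] and the outer ones cancel by [e2]. *)
    transitivity (\int[P]_w (\1_D w * (\1_E w * \1_F w)) -
       (\int[P]_w (f w * (\1_D w * (\1_F w - g w))) + \int[P]_w (\1_D w * (f w * g w)))).
      rewrite -RintegralD//; last 2 first.
      - apply: (ibM _ _ bf); apply: (ibM _ _ bD).
        by under eq_fun do rewrite EFinB; apply: integrableB => //; exact: bI.
      - exact: (ibM _ _ bD (ibM _ _ bf ig)).
      rewrite -RintegralB//; last 2 first.
      - by apply: bI; apply: bounded_measurableM => //; exact: bounded_measurableM.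
      - have : P.-integrable setT (fun w => (f w * (\1_D w * \1_F w))%:E).
          by apply: bI; apply: bounded_measurableM => //; exact: bounded_measurableM.
        by congr (_.-integrable _ _); apply/funext => w /=; congr (_%:E); ring.
      by apply: eq_Rintegral => w _; ring.
    by rewrite e1 e2 add0r subrr.
  (* The indicators of D and then of F are replaced by cosines of C Z and of B Z. *)
  have W1 F : sigma_vec (fun w => B *m Z w) F -> forall (t : 'cV[R]_c) d,
      \int[P]_w (\1_F w * (cos ((t^T *m (C *m Z w)) 0 0 + d) * (\1_E w - f w))) = 0.
    move=> hF t d.
    under eq_Rintegral do rewrite mulrCA.
    apply: (@Rintegral_null_bounded R _ T P H sH mH _ _ 1) => //.
    + by apply: bI; apply: bounded_measurableM => //; exact/bounded_measurable_indic/mB.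
    + by move=> D HD; exact: W0.
    + by move=> G mG; exact: sigma_vec_cos.
  have W2 (t : 'cV[R]_c) (d d' : R) :
      \int[P]_w (cos ((b^T *m (B *m Z w)) 0 0 + d') *
        (cos ((t^T *m (C *m Z w)) 0 0 + d) * (\1_E w - f w))) = 0.
    apply: (@Rintegral_null_bounded R _ T P (sigma_vec (fun w => B *m Z w)) _ mB _ _ 1) => //.
    + exact: sigma_vec_algebra.
    + apply: bI; apply: bounded_measurableM => //.
      by under eq_fun do rewrite cmp_linear; exact: bcos.
    + by move=> F hF; exact: W1.
    + by move=> G mG; exact: sigma_vec_cos.
  (* The residual is b.(B Z) minus (L' b).(C Z); the subtraction formula splits its cosine into
     products covered by [W2], sines being cosines with phase - pi / 2. *)
  have W3 : \int[P]_w (cos (cmp v Z w + e) * (\1_E w - f w)) = 0.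
    have vE w : cmp v Z w = (b^T *m (B *m Z w)) 0 0 - ((L^T *m b)^T *m (C *m Z w)) 0 0.
      rewrite /v /V trmx_mul trmxK mulmxBr mulmxBl trmx_mul trmxK !mulmxA [LHS]mxE.
      by rewrite [X in _ + X]mxE.
    transitivity (\int[P]_w (cos ((b^T *m (B *m Z w)) 0 0 + e) *
        (cos (((L^T *m b)^T *m (C *m Z w)) 0 0 + 0) * (\1_E w - f w)) +
        cos ((b^T *m (B *m Z w)) 0 0 + (e - pi / 2)) *
        (cos (((L^T *m b)^T *m (C *m Z w)) 0 0 - pi / 2) * (\1_E w - f w)))).
      apply: eq_Rintegral => w _; rewrite vE addr0 addrA !cosBpihalf.
      set y := (b^T *m _) 0 0; set l := (_ *m (C *m _)) 0 0.
      by rewrite (_ : y - l + e = y + e - l); [rewrite cosB; ring|ring].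
    rewrite RintegralD ?W2 ?addr0//;
      by apply: bI; apply: bounded_measurableM;
        [under eq_fun do rewrite cmp_linear; exact: bcos
        |apply: bounded_measurableM => //; under eq_fun do rewrite cmp_linear; exact: bcos].
  (* The version f is measurable with respect to C Z, and the centred cosine of the residual is
     Fourier-null for C Z. *)
  have W4 : \int[P]_w (f w * (cos (cmp v Z w + e) - kappa)) = 0.
    have CSv : C *m S *m v = 0.
      rewrite /v mulmxA (_ : C *m S *m V^T = 0) ?mul0mx//.
      by apply: trmx_inj; rewrite trmx0 trmx_mul trmxK trmx_mul STr mulmxA.
    apply: (@Rintegral_null_bounded R _ T P H sH mH _ _ 1) => //.
    - by apply: bI; exact: bounded_measurableB.
    - move=> D HD; apply: (fourier_null_sigma_vec _ (gaussian_fourier_null gZ mZ e CSv) HD).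
      exact: (measurable_linear gZ).
    - by case: hf.
    - by move=> w; have /andP[f0' f1'] := f01 w; rewrite ger0_norm.
  have W5 : \int[P]_w (\1_E w - f w) = 0.
    have := measurable_Rintegral_sub mH hf HT mE.
    under eq_Rintegral do rewrite indicT mul1r.
    under [X in _ = X -> _]eq_Rintegral do rewrite indicT mul1r.
    by move=> fE; rewrite RintegralB ?fE ?subrr//; exact: bI.
  (* 1_E (cos - kappa) = cos (1_E - f) + f (cos - kappa) - kappa (1_E - f); the three terms are
     [W3], [W4] and [W5]. *)
  transitivity (\int[P]_w (cos (cmp v Z w + e) * (\1_E w - f w) +
      (f w * (cos (cmp v Z w + e) - kappa) - kappa * (\1_E w - f w)))).
    by apply: eq_Rintegral => w _; ring.
  have b1 : bounded_measurable (fun w => f w * (cos (cmp v Z w + e) - kappa)).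
    by apply: bounded_measurableM => //; exact: bounded_measurableB.
  have b2 : bounded_measurable (fun w => kappa * (\1_E w - f w)).
    exact: (bounded_measurableM (bc kappa) bW).
  rewrite RintegralD//; last 2 first.
  - by apply: bI; exact: bounded_measurableM.
  - by apply: bI; exact: bounded_measurableB.
  rewrite RintegralB//; [|exact: bI..].
  by rewrite W3 W4 RintegralZl ?W5 ?mulr0 ?subrr ?addr0//; exact: bI.
- move=> G mG.
  rewrite (_ : (fun w => cos (cmp (A^T *m a) Z w + e')) =
               (fun w => cos ((a^T *m (A *m Z w)) 0 0 + e'))).
    exact: sigma_vec_cos.
  by apply/funext => w; rewrite cmp_linear.
Qed.

End GaussianConditionalCovariance.

(** * Positive definite matrices *)

Section PositiveDefinite.
Variable R : realType.
Implicit Types n p : nat.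

Definition possemidefmx n (A : 'M[R]_n) : Prop :=
  A^T = A /\ forall v : 'cV[R]_n, 0 <= (v^T *m A *m v) 0 0.

Lemma posdef_semi n (A : 'M[R]_n) : posdefmx A -> possemidefmx A.
Proof.
move=> [As A0]; split => // v; have [->|v0] := eqVneq v 0; last exact/ltW/A0.
by rewrite mulmx0 mxE.
Qed.

Lemma mxsum11 (M1 M2 : 'M[R]_1) : (M1 + M2) 0 0 = M1 0 0 + M2 0 0.
Proof. by rewrite mxE. Qed.

Lemma posdefD n (A B : 'M[R]_n) : posdefmx A -> possemidefmx B -> posdefmx (A + B).
Proof.
move=> [As A0] [Bs B0]; split; first by rewrite linearD/= As Bs.
by move=> v v0; rewrite mulmxDr mulmxDl mxsum11 ltr_pwDl ?A0.
Qed.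

Lemma possemidef_cong n p (A : 'M[R]_n) (B : 'M[R]_(p, n)) : possemidefmx A ->
  possemidefmx (B *m A *m B^T).
Proof.
move=> [As A0]; split; first by rewrite !trmx_mul trmxK As mulmxA.
by move=> v; have := A0 (B^T *m v); rewrite trmx_mul trmxK !mulmxA.
Qed.

(** The left inverse [C] makes [B^T] injective. *)
Lemma posdef_cong n p (A : 'M[R]_n) (B : 'M[R]_(p, n)) (C : 'M[R]_(p, n)) :
  posdefmx A -> C *m B^T = 1%:M -> posdefmx (B *m A *m B^T).
Proof.
move=> [As A0] CB; split; first by rewrite !trmx_mul trmxK As mulmxA.
move=> v v0; have := A0 (B^T *m v); rewrite trmx_mul trmxK !mulmxA; apply.
by apply: contra_neq v0 => Bv; rewrite -[v]mul1mx -CB -mulmxA Bv mulmx0.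
Qed.

Lemma posdef_unit n (A : 'M[R]_n) : posdefmx A -> A \in unitmx.
Proof.
move=> [As A0]; rewrite -row_free_unit -kermx_eq0; apply/eqP; apply/row_matrixP => i.
rewrite row0; apply/eqP/negPn/negP => v0.
pose v : 'cV[R]_n := (row i (kermx A))^T.
have vA : v^T *m A = 0 by rewrite trmxK -row_mul mulmx_ker row0.
have : v != 0 by apply: contra_neq v0 => h; rewrite -[row i _]trmxK -/v h trmx0.
by move/A0; rewrite vA mul0mx mxE ltxx.
Qed.

Lemma posdef_inv n (A : 'M[R]_n) : posdefmx A -> posdefmx (invmx A).
Proof.
move=> pA; have uA := posdef_unit pA; have [As _] := pA.
have -> : invmx A = invmx A *m A *m (invmx A)^T by rewrite trmx_inv As mulVmx// mul1mx.
by apply: (posdef_cong (C := A)) => //; rewrite trmx_inv As mulmxV.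
Qed.

Lemma mxB11 (M1 M2 : 'M[R]_1) : (M1 - M2) 0 0 = M1 0 0 - M2 0 0.
Proof. by rewrite !mxE. Qed.

Lemma mxZ11 (a : R) (M1 : 'M[R]_1) : (a *: M1) 0 0 = a * M1 0 0.
Proof. by rewrite mxE. Qed.

Lemma sqnormE n (v : 'cV[R]_n) : (v^T *m v) 0 0 = \sum_k v k 0 ^+ 2.
Proof. by rewrite mxE; apply: eq_bigr => k _; rewrite mxE expr2. Qed.

Lemma sqnorm_gt0 n (v : 'cV[R]_n) : v != 0 -> 0 < (v^T *m v) 0 0.
Proof.
move=> v0; rewrite sqnormE lt_def sumr_ge0 ?andbT; last by move=> k _; exact: sqr_ge0.
apply: contra_neq v0 => h; apply/matrixP => j k; rewrite ord1 [RHS]mxE.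
by apply/eqP; rewrite -sqrf_eq0; apply/eqP; apply: psumr_eq0P h _ _ => // i _; exact: sqr_ge0.
Qed.

Lemma posdef_scalar n (l : R) : 0 < l -> posdefmx (l%:M : 'M[R]_n).
Proof.
move=> l0; split; first exact: tr_scalar_mx.
move=> v v0; rewrite mul_mx_scalar -scalemxAl mxZ11 mulr_gt0//.
exact: sqnorm_gt0.
Qed.

(** If v' A v = 0, the form at v - t A v equals - 2 t |A v|^2 + t^2 b and is nonnegative for every
    t, which forces A v = 0. *)
Lemma possemidef_unit_posdef n (A : 'M[R]_n) : possemidefmx A -> A \in unitmx -> posdefmx A.
Proof.
move=> [As A0] uA; split => // v v0; rewrite lt_def A0 andbT.
apply: contra_neq v0 => vAv.
pose w := A *m v; pose a := (w^T *m w) 0 0; pose b := (w^T *m A *m w) 0 0.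
have q0 t : 0 <= - t * a - t * a + t ^+ 2 * b.
  have := A0 (v - t *: w).
  have -> : (v - t *: w)^T = v^T - t *: w^T by rewrite linearB/= linearZ.
  rewrite !mulmxBl !mulmxBr -?scalemxAl -?scalemxAr -?scalemxAl ?scalerA -?expr2.
  rewrite -[w^T *m A *m v]mulmxA -/w.
  have -> : v^T *m A *m w = w^T *m w by rewrite /w trmx_mul As.
  by rewrite !(mxB11, mxZ11) vAv -/a -/b; congr (0 <= _); ring.
have [//|w0] := eqVneq w 0.
  by move=> w0; rewrite -[v](mulKmx uA) -/w w0 mulmx0.
have a0 : 0 < a := sqnorm_gt0 w0.
have b0 : 0 <= b := A0 w.
(* This t gives the value - a^2 (b + 2) / (b + 1)^2 < 0; the denominator b + 1 is safe when b =
   0. *)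
have := q0 (a / (b + 1)).
have -> : - (a / (b + 1)) * a - a / (b + 1) * a + (a / (b + 1)) ^+ 2 * b =
   - (a ^+ 2 * (b + 2) / (b + 1) ^+ 2) by field; rewrite gt_eqF// ltr_pwDr.
rewrite oppr_ge0 leNgt divr_gt0 ?exprn_gt0 ?mulr_gt0 ?exprn_gt0//; by rewrite ?ltr_pwDr.
Qed.

(** One plus the sum of all |Q_ij| is large enough, since |v_i v_j| <= |v|^2. *)
Lemma exists_dominating_scalar n (Q : 'M[R]_n) : Q^T = Q ->
  exists2 l : R, 0 < l & posdefmx (l%:M - Q).
Proof.
move=> Qs; pose c := \sum_i \sum_j `|Q i j|.
have c0 : 0 <= c by apply: sumr_ge0 => i _; apply: sumr_ge0.
exists (c + 1); first by rewrite ltr_pwDr.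
have -> : (c + 1)%:M - Q = 1%:M + (c%:M - Q) by rewrite raddfD/= addrAC addrC.
apply: posdefD; first exact: posdef_scalar.
split; first by rewrite linearB/= tr_scalar_mx Qs.
move=> v; rewrite mulmxBr mulmxBl mxB11 subr_ge0 mul_mx_scalar -scalemxAl mxZ11 sqnormE.
set s := \sum_k _.
have le k : v k 0 ^+ 2 <= s.
  by rewrite /s (bigD1 k)//= lerDl; apply: sumr_ge0 => i _; exact: sqr_ge0.
have -> : (v^T *m Q *m v) 0 0 = \sum_i \sum_j Q i j * (v i 0 * v j 0).
  rewrite -mulmxA mxE; apply: eq_bigr => i _; rewrite !mxE mulr_sumr.
  by apply: eq_bigr => j _; ring.
rewrite /c mulr_suml; apply: ler_sum => i _; rewrite mulr_suml; apply: ler_sum => j _.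
rewrite (le_trans (ler_norm _))// normrM ler_wpM2l//.
have := le i; have := le j; rewrite normrM.
rewrite -(real_normK (num_real (v i 0))) -(real_normK (num_real (v j 0))).
have := sqr_ge0 (`|v i 0| - `|v j 0|).
set x := `|v i 0|; set y := `|v j 0|; nra.
Qed.

End PositiveDefinite.

(** * Models induced by a Markov model *)

Section InducedModel.
Variables (R : realType) (d : nat).
Implicit Types (M Mc G B : nat -> 'M[R]_d).

HB.instance Definition _ := Monoid.isLaw.Build 'M[R]_d 1%:M mulmx
  (@mulmxA R d d d d) (@mul1mx R d d) (@mulmx1 R d d).

Lemma M_to_last M N : M_to M N N = 1%:M.
Proof. by rewrite /M_to subnn big_geq. Qed.

Lemma M_to_rec M N k : (k < N)%N -> M_to M N k = M_to M N k.+1 *m M k.+1.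
Proof.
move=> kN; rewrite /M_to -[(N - k)%N](subnSK kN) big_nat_recr//=.
by rewrite subKn.
Qed.

Lemma C_to_rec M Mc N k : (k < N)%N -> C_to M Mc N k =
  C_to M Mc N k.+1 + M_to M N k.+1 *m Mc k.+1 *m (M_to M N k.+1)^T.
Proof. by move=> kN; rewrite /C_to big_ltn// addrC. Qed.

Lemma C_to_geq M Mc N : C_to M Mc N N = 0.
Proof. by rewrite /C_to big_geq. Qed.

Lemma C_to_posdef M Mc N k : (forall k, (1 <= k <= N)%N -> posdefmx (Mc k)) ->
  (k < N)%N -> posdefmx (C_to M Mc N k).
Proof.
(* Descending induction from N - 1, indexed by m; beyond m = N - 1 the truncated subtraction stays
   at 0. *)
move=> hMc kN; have [m ->] : exists m, k = (N.-1 - m)%N.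
  by exists (N.-1 - k)%N; rewrite subKn// -ltnS prednK// (leq_ltn_trans _ kN).
have N0 : (0 < N)%N by exact: leq_ltn_trans kN.
elim: m => [|m IH].
  rewrite subn0 C_to_rec ?prednK// C_to_geq add0r M_to_last mul1mx trmx1 mulmx1.
  by apply: hMc; rewrite N0 leqnn.
have [mN|Nm] := ltnP m N.-1; last first.
  by move: IH; rewrite (eqP Nm) (eqP (leqW Nm)).
have lt : (N.-1 - m.+1 < N)%N by rewrite (leq_ltn_trans (leq_subr _ _))// ltn_predL.
rewrite C_to_rec//= subnSK//.
apply: posdefD => //; apply: possemidef_cong; apply: posdef_semi; apply: hMc.
by rewrite subn_gt0 mN (leq_trans (leq_subr _ _))// leq_pred.
Qed.

(** (C + A Q A') C^-1 A = A Q (Q^-1 + A' C^-1 A) = A Q G^-1. *)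
Lemma push_through (A C Q G : 'M[R]_d) : C \in unitmx -> Q \in unitmx -> G \in unitmx ->
  C + A *m Q *m A^T \in unitmx ->
  invmx G = invmx Q + A^T *m invmx C *m A ->
  invmx (C + A *m Q *m A^T) *m A = invmx C *m A *m G *m invmx Q.
Proof.
move=> uC uQ uG uK hG.
apply: (can_inj (mulKmx uK)); rewrite mulKVmx// !mulmxA.
rewrite mulmxDl mulmxV// mulmxDl mul1mx.
have -> : A + A *m Q *m A^T *m invmx C *m A = A *m (Q *m invmx G).
  by rewrite hG mulmxDr mulmxV// mulmxDr mulmx1 !mulmxA.
by rewrite -!mulmxA (mulmxA (invmx G)) mulVmx// mul1mx mulmxV// mulmx1.
Qed.

(** Primed parameters belong to k, the others to k + 1. With A, C, Q for M_{N|k+1}, C_{N|k+1},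
    M_{k+1}, the formula for G gives I - G_{k+1,N} A = G Q^-1, so [G1] = G Q^-1 M_{k+1,k}. As
    M_{N|k} = A M_{k+1,k} and C_{N|k} = C + A Q A', the transposed claim is [push_through] times
    M_{k+1,k}. *)
Lemma induced_gain_compat M Mc N k (G G1 GN G' GN' : 'M[R]_d) :
  (forall k, (1 <= k <= N)%N -> posdefmx (Mc k)) -> (0 < k)%N -> (k.+1 < N)%N ->
  GN' = G' *m (M_to M N k)^T *m invmx (C_to M Mc N k) -> G' \in unitmx ->
  G1 = M k.+1 - GN *m M_to M N k.+1 *m M k.+1 ->
  GN = G *m (M_to M N k.+1)^T *m invmx (C_to M Mc N k.+1) ->
  G = invmx (invmx (Mc k.+1) + (M_to M N k.+1)^T *m invmx (C_to M Mc N k.+1) *m M_to M N k.+1) ->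
  invmx G' *m GN' = G1^T *m invmx G *m GN.
Proof.
move=> hMc k0 kN hGN' uG' hG1 hGN hG.
set A := M_to M N k.+1 in hG1 hGN hG *; set C := C_to M Mc N k.+1 in hGN hG *.
set Q := Mc k.+1 in hG *.
have pQ : posdefmx Q by apply: hMc; rewrite /= ltnW.
have pC : posdefmx C by exact: C_to_posdef.
have pCi := posdef_inv pC; have pQi := posdef_inv pQ.
have pGi : posdefmx (invmx Q + A^T *m invmx C *m A).
  by apply: posdefD => //; have := possemidef_cong A^T (posdef_semi pCi); rewrite trmxK.
have uGi := posdef_unit pGi.
have pG : posdefmx G by rewrite hG; exact: posdef_inv.
have [Gs _] := pG; have [Cs _] := pC; have [Qs _] := pQ.
have uG := posdef_unit pG.
have hGi : invmx G = invmx Q + A^T *m invmx C *m A by rewrite hG invmxK.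
have pK : posdefmx (C + A *m Q *m A^T).
  by apply: posdefD => //; exact/possemidef_cong/posdef_semi.
have [Ks _] := pK.
have hG1' : G1 = G *m invmx Q *m M k.+1.
  rewrite hG1 hGN -[X in X - _]mul1mx -mulmxBl; congr (_ *m _).
  by rewrite -(mulmxV uG) -!mulmxA -mulmxBr hGi !mulmxA addrK.
have -> : invmx G' *m GN' = (M_to M N k)^T *m invmx (C_to M Mc N k).
  by rewrite hGN' -mulmxA mulKmx.
have -> : G1^T *m invmx G *m GN = G1^T *m (A^T *m invmx C).
  by rewrite hGN -(mulmxA G) -(mulmxA G1^T) mulKmx.
have -> : M_to M N k = A *m M k.+1 by apply: M_to_rec; exact: ltnW.
have -> : C_to M Mc N k = C + A *m Q *m A^T by apply: C_to_rec; exact: ltnW.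
apply: trmx_inj; rewrite !trmx_mul !trmx_inv !trmxK Ks Cs.
rewrite mulmxA (push_through (posdef_unit pC) (posdef_unit pQ) uG (posdef_unit pK) hGi).
by rewrite hG1' !mulmxA.
Qed.

Lemma induced_model_exists N (G1 : nat -> 'M[R]_d) G B :
  (0 < N)%N ->
  (forall k, (1 <= k <= N.-1)%N -> posdefmx (G k)) ->
  (forall k, (1 <= k)%N -> (k.+1 <= N.-1)%N -> B k = (G1 k.+1)^T *m B k.+1) ->
  exists (M Mc : nat -> 'M[R]_d), (forall k, (1 <= k <= N)%N -> posdefmx (Mc k)) /\
    forall k, (1 <= k <= N.-1)%N ->
      [/\ G1 k = M k - (G k *m B k) *m M_to M N k *m M k,
          G k *m B k = G k *m (M_to M N k)^T *m invmx (C_to M Mc N k) &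
          G k = invmx (invmx (Mc k) +
            (M_to M N k)^T *m invmx (C_to M Mc N k) *m M_to M N k)].
Proof.
move=> N0 hG hB.
(* Requiring M_{N|k} = C_{N|k} B_k' turns the recursion for C_{N|k} into
   C_{N|k}^-1 = C_{N|k+1}^-1 - B_{k+1}' G_{k+1} B_{k+1}, whose initial value [l I] is
   free: it only has to be large enough for all C_{N|k} to be positive definite. *)
pose Q k := (B k)^T *m G k *m B k.
have sQ k : (1 <= k <= N.-1)%N -> possemidefmx (Q k).
  by move=> hk; have := possemidef_cong (B k)^T (posdef_semi (hG _ hk)); rewrite trmxK.
have [l l0 hl] : exists2 l : R, 0 < l & posdefmx (l%:M - \sum_(1 <= j < N) Q j).
  apply: exists_dominating_scalar; rewrite raddf_sum/= big_nat [RHS]big_nat.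
  apply: eq_bigr => j /andP[j1 jN]; have [] // := sQ j.
  by rewrite j1 -ltnS prednK.
pose D k := l%:M - \sum_(k.+1 <= j < N) Q j.
have Drec k : (1 <= k <= N.-1)%N -> D k.-1 = D k - Q k.
  move=> /andP[k1 kN]; rewrite /D prednK// big_ltn; last by rewrite -(prednK N0) ltnS.
  by rewrite opprD addrA addrAC.
have D0 : posdefmx (D 0%N) by [].
have pD k : (k <= N.-1)%N -> posdefmx (D k).
  elim: k => [//|k IH] kN.
  have -> : D k.+1 = D k + Q k.+1 by rewrite (Drec k.+1) ?subrK.
  by apply: posdefD; [exact/IH/ltnW|exact: sQ].
pose C k := invmx (D k).
have pC k : (k <= N.-1)%N -> posdefmx (C k) by move=> kN; exact/posdef_inv/pD.
have DN : D N.-1 = l%:M by rewrite /D prednK// big_geq// subr0.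
(* The required M_k^-1 = G_k^-1 - B_k C_{N|k} B_k' is inverted by Woodbury's formula, in which
   C_{N|k-1} appears; [M k] then solves G_{k,k-1} = G_k M_k^-1 M_{k,k-1}. At k = N the values are
   those that start the recursions: M_N = C_{N|N-1} and M_{N,N-1} = C_{N|N-1} B_{N-1}'. *)
pose Mc k := if k == N then C N.-1 else G k + (G k *m B k) *m C k.-1 *m (G k *m B k)^T.
pose M k := if k == N then C N.-1 *m (B N.-1)^T else Mc k *m invmx (G k) *m G1 k.
have NE k : (k <= N.-1)%N -> (k == N) = false.
  by move=> kN; apply/negbTE; rewrite neq_ltn -(prednK N0) ltnS kN.
have pMc k : (1 <= k <= N)%N -> posdefmx (Mc k).
  move=> /andP[k1 kN]; rewrite /Mc; case: eqP => [_|/eqP kN']; first exact: pC.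
  have kN1 : (k <= N.-1)%N by rewrite -ltnS prednK// ltn_neqAle kN' kN.
  apply: posdefD; first by apply: hG; rewrite k1.
  by apply: possemidef_cong; apply: posdef_semi; apply: pC; rewrite (leq_trans (leq_pred _)).
(* This identity drives both recursions in [main]. It rests on C_k Q_k C_{k-1} = C_{k-1} - C_k,
   which is Q_k = D_k - D_{k-1} multiplied by the inverses on both sides. *)
have CBMc k : (1 <= k <= N.-1)%N -> C k *m (B k)^T *m Mc k = C k.-1 *m (B k)^T *m G k.
  move=> hk; have /andP[k1 kN] := hk; have [Gs _] := hG _ hk.
  rewrite /Mc NE// mulmxDr trmx_mul Gs !mulmxA.
  have uD := posdef_unit (pD _ kN).
  have uD1 : D k.-1 \in unitmx by apply/posdef_unit/pD; rewrite (leq_trans (leq_pred _)).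
  have -> : C k *m (B k)^T *m G k *m B k *m C k.-1 = C k.-1 - C k.
    have -> : C k *m (B k)^T *m G k *m B k = C k *m Q k by rewrite /Q !mulmxA.
    have -> : Q k = D k - D k.-1 by rewrite Drec// opprB addrCA subrr addr0.
    by rewrite mulmxBr mulVmx// mulmxBl mul1mx -mulmxA mulmxV// mulmx1.
  by rewrite !mulmxBl addrCA subrr addr0.
have McV k : (1 <= k <= N.-1)%N -> invmx (Mc k) = invmx (G k) - B k *m C k *m (B k)^T.
  move=> hk; have /andP[k1 kN] := hk; have [Gs _] := hG _ hk.
  have uG := posdef_unit (hG _ hk).
  have uMc : Mc k \in unitmx by apply/posdef_unit/pMc; rewrite k1 (leq_trans kN)// leq_pred.
  apply: (can_inj (mulmxK uMc)); rewrite mulVmx// mulmxBl -!mulmxA (mulmxA (C k)) CBMc//.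
  rewrite /Mc NE// mulmxDr mulVmx// !mulmxA mulVmx// mul1mx trmx_mul Gs !mulmxA.
  by rewrite addrK.
have main k : (1 <= k <= N.-1)%N ->
    M_to M N k = C k *m (B k)^T /\ C_to M Mc N k = C k.
  move=> /andP[k1 kN]; have [m [mN ->]] : exists m, (m < N.-1)%N /\ k = (N.-1 - m)%N.
    exists (N.-1 - k)%N; rewrite subKn//; split => //.
    by rewrite ltn_subrL k1 (leq_trans k1).
  elim: m mN {k k1 kN} => [|m IH] mN.
    have -> : (N.-1 - 0)%N = N.-1 by rewrite subn0.
    rewrite M_to_rec ?ltn_predL// C_to_rec ?ltn_predL// !prednK// M_to_last C_to_geq.
    by rewrite /M /Mc eqxx mul1mx add0r trmx1 mulmx1 mul1mx.
  have [IH1 IH2] := IH (ltnW mN).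
  set k := (N.-1 - m.+1)%N; have kE : (N.-1 - m)%N = k.+1 by rewrite /k subnSK// ltnW.
  rewrite kE in IH1 IH2.
  have k1 : (1 <= k)%N by rewrite /k subn_gt0.
  have kN : (k.+1 <= N.-1)%N by rewrite -kE leq_subr.
  have kN' : (k < N)%N by rewrite (leq_trans kN)// leq_pred.
  have hk1 : (1 <= k.+1 <= N.-1)%N by rewrite kN.
  have uG := posdef_unit (hG _ hk1).
  have [Cs _] := pC _ kN.
  rewrite (M_to_rec _ kN') (C_to_rec _ _ kN') IH1 IH2 {1}/M NE//; split.
    by rewrite !mulmxA CBMc//= mulmxK// (hB k)// trmx_mul trmxK mulmxA.
  rewrite CBMc//= trmx_mul trmxK Cs mulmxA.
  have -> : C k *m (B k.+1)^T *m G k.+1 *m B k.+1 *m C k.+1 = C k - C k.+1.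
    have -> : C k *m (B k.+1)^T *m G k.+1 *m B k.+1 = C k *m Q k.+1 by rewrite /Q !mulmxA.
    have -> : Q k.+1 = D k.+1 - D k by rewrite (Drec k.+1)// opprB addrCA subrr addr0.
    have uD := posdef_unit (pD _ kN); have uD1 := posdef_unit (pD _ (ltnW kN)).
    by rewrite mulmxBr mulVmx// mulmxBl mul1mx -mulmxA mulmxV// mulmx1.
  by rewrite addrC subrK.
exists M, Mc; split => // k hk; have [-> ->] := main k hk.
have /andP[k1 kN] := hk.
have uG := posdef_unit (hG _ hk); have uD := posdef_unit (pD _ kN).
have [Cs _] := pC _ kN.
have MtC : (C k *m (B k)^T)^T *m invmx (C k) = B k.
  by rewrite trmx_mul trmxK Cs mulmxK// /C unitmx_inv.
split.
- have E : G1 k = (G k *m invmx (Mc k)) *m M k.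
    rewrite /M NE//.
    have uMc : Mc k \in unitmx by apply/posdef_unit/pMc; rewrite k1 (leq_trans kN)// leq_pred.
    by rewrite !mulmxA mulmxKV// mulmxV// mul1mx.
  by rewrite {1}E McV// mulmxBr mulmxV// mulmxBl mul1mx !mulmxA.
- by rewrite -(mulmxA (G k)) MtC.
- by rewrite MtC McV// !mulmxA subrK invmxK.
Qed.

End InducedModel.

(** * Blocks of the precision matrix *)

Section PrecisionMatrix.
Variables (R : realType) (n : nat) (S : 'M[R]_n).
Hypothesis pS : posdefmx S.
Local Notation L := (invmx S).

(** D S D is invertible only on the range of the projection D; adding 1 - D gives a positive
    definite Q that commutes with D, and K = A S D Q^-1. *)
Lemma regression p (D : 'M[R]_n) (A : 'M[R]_(p, n)) : D^T = D -> D *m D = D ->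
  exists K : 'M[R]_(p, n), (A - K *m D) *m S *m D = 0.
Proof.
move=> Ds DD; have [Ss S0] := pS.
pose Q := D *m S *m D + (1%:M - D).
have DQ : D *m Q = D *m S *m D by rewrite mulmxDr mulmxBr mulmx1 DD subrr addr0 !mulmxA DD.
have QD : Q *m D = D *m S *m D by rewrite mulmxDl mulmxBl mul1mx DD subrr addr0 -!mulmxA DD.
have pD : possemidefmx (1%:M - D).
  have -> : 1%:M - D = (1%:M - D) *m 1%:M *m (1%:M - D)^T.
    by rewrite linearB/= trmx1 Ds mulmx1 mulmxBr mulmx1 mulmxBl mul1mx DD subrr subr0.
  by apply: possemidef_cong; apply: posdef_semi; exact: posdef_scalar.
have pDSD : possemidefmx (D *m S *m D).
  by rewrite -[X in _ *m X]Ds; apply: possemidef_cong; exact: posdef_semi.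
have uQ : Q \in unitmx.
  apply: posdef_unit; split; first by rewrite linearD/= pD.1 pDSD.1.
  move=> v v0; have [Dv|Dv] := eqVneq (D *m v) 0.
    suff -> : v^T *m Q *m v = v^T *m v by exact: sqnorm_gt0.
    by rewrite -!mulmxA /Q mulmxDl -!mulmxA Dv !mulmx0 add0r mulmxBl mul1mx Dv subr0.
  rewrite mulmxDr mulmxDl mxsum11 ltr_pwDl ?pD.2//.
  by have := S0 _ Dv; rewrite trmx_mul Ds !mulmxA.
have cDQ : invmx Q *m D = D *m invmx Q.
  by rewrite -[LHS](mulmxK uQ) -(mulmxA (invmx Q)) DQ -QD mulKmx.
exists (A *m S *m D *m invmx Q).
rewrite -(mulmxA (A *m S *m D)) cDQ !mulmxA -(mulmxA (A *m S)) DD !mulmxBl.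
suff -> : A *m S *m D *m invmx Q *m S *m D = A *m S *m D by rewrite subrr.
rewrite -(mulmxA (A *m S)) -cDQ -!mulmxA; congr (A *m (S *m _)).
by rewrite (mulmxA D S) -QD mulKmx.
Qed.

Section Masks.
Variables F J G : 'M[R]_n.
Hypotheses (sF : F^T = F) (sJ : J^T = J) (sG : G^T = G).
Hypotheses (FF : F *m F = F) (JJ : J *m J = J) (GG : G *m G = G).
Hypotheses (FJ : F *m J = 0) (FG : F *m G = 0) (JG : J *m G = 0).
Hypothesis FJG : F + J + G = 1%:M.

Let JF : J *m F = 0.
Proof. by apply: trmx_inj; rewrite trmx_mul sF sJ FJ trmx0. Qed.

Let GJ : G *m J = 0.
Proof. by apply: trmx_inj; rewrite trmx_mul sG sJ JG trmx0. Qed.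

Let uS := posdef_unit pS.

(* [(A - K J) S] is supported on [F], so [A - K J] is a combination of the
   [F]-rows of the precision matrix, which vanish on [G]. *)
Lemma precision_regression p (A : 'M[R]_(p, n)) : A *m F = A -> F *m L *m G = 0 ->
  exists K : 'M[R]_(p, n), (A - K *m J) *m S *m J = 0 /\ (A - K *m J) *m S *m G = 0.
Proof.
move=> AF FLG.
have [K] : exists K : 'M[R]_(p, n), (A - K *m (J + G)) *m S *m (J + G) = 0.
  apply: regression; first by rewrite linearD/= sJ sG.
  by rewrite mulmxDr !mulmxDl JJ GG JG GJ addr0 add0r.
set U := A - K *m (J + G) => U0.
have USF : U *m S = U *m S *m F.
  by rewrite -[LHS]mulmx1 -FJG -addrA mulmxDr U0 addr0.
have UL : U = U *m S *m F *m L by rewrite -USF mulmxK.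
have UG : U *m G = 0 by rewrite UL -!mulmxA (mulmxA F) FLG !mulmx0.
have KG : K *m G = 0.
  move: UG; rewrite /U mulmxBl -AF -(mulmxA A) FG mulmx0 sub0r -mulmxA mulmxDl JG GG add0r.
  by move/eqP; rewrite oppr_eq0 => /eqP.
exists K; have <- : U = A - K *m J by rewrite /U mulmxDr KG addr0.
split.
- have : U *m S *m (J + G) *m J = 0 by rewrite U0 mul0mx.
  by rewrite -[U *m S *m _ *m _]mulmxA (mulmxDl J) JJ GJ addr0.
- have : U *m S *m (J + G) *m G = 0 by rewrite U0 mul0mx.
  by rewrite -[U *m S *m _ *m _]mulmxA (mulmxDl J) JG GG add0r.
Qed.

(** With U = F - K J one has U = U S F L. Its F-columns give U S F L F = F, so F U S F inverts the
    F-block of L and is completed by 1 - F to an invertible Y; its G-columns vanish, so Y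
    annihilates F L G. *)
Lemma precision_regressionV (K : 'M[R]_n) :
  (F - K *m J) *m S *m J = 0 -> (F - K *m J) *m S *m G = 0 -> F *m L *m G = 0.
Proof.
set U := F - K *m J => UJ UG.
have USF : U *m S = U *m S *m F by rewrite -[LHS]mulmx1 -FJG !mulmxDr UJ UG !addr0.
have UL : U = U *m S *m F *m L by rewrite -USF mulmxK.
have E1 : U *m S *m F *m L *m F = F by rewrite -UL mulmxBl FF -mulmxA JF mulmx0 subr0.
have E2 : U *m S *m F *m L *m G = 0 by rewrite -UL mulmxBl FG -mulmxA JG mulmx0 subr0.
move: (U *m S) E1 E2 => X E1 E2 {USF UL UJ UG}.
pose Y := F *m X *m F + (1%:M - F); pose V := F *m L *m F + (1%:M - F).
have YF : Y *m F = F *m X *m F.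
  by rewrite mulmxDl mulmxBl mul1mx FF subrr addr0 -mulmxA FF.
have YV : Y *m V = 1%:M.
  have -> : Y *m V = Y *m F *m (L *m F) + (Y - Y *m F) by rewrite mulmxDr mulmxBr mulmx1 !mulmxA.
  rewrite YF !mulmxA -(mulmxA F X) -(mulmxA F) -(mulmxA F) E1 FF.
  have -> : Y - F *m (X *m F) = 1%:M - F by rewrite /Y mulmxA addrAC subrr add0r.
  by rewrite addrC subrK.
rewrite -[LHS]mul1mx -(mulmx1C YV) -(mulmxA V).
suff -> : Y *m (F *m L *m G) = 0 by rewrite mulmx0.
by rewrite !mulmxA YF -(mulmxA F X) -(mulmxA F) -(mulmxA F) E2 mulmx0.
Qed.

End Masks.
End PrecisionMatrix.

(** * Block selectors, masks and white residuals *)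

Section Blocks.
Variables (R : realType) (N d n : nat) (E : nat -> 'M[R]_(d, n)).
Hypothesis EE : forall k l, (k <= N)%N -> (l <= N)%N ->
  E k *m (E l)^T = if k == l then 1%:M else 0.
Hypothesis E1 : \sum_(k < N.+1) (E k)^T *m E k = 1%:M.
Implicit Types I J : pred nat.

(** The coordinate projection onto the blocks in I: subvectors stay in the full space, so no
    dimension depends on the index set. *)
Definition mask_mx I : 'M[R]_n := \sum_(k < N.+1 | I k) (E k)^T *m E k.

Lemma tr_mask I : (mask_mx I)^T = mask_mx I.
Proof. by rewrite /mask_mx raddf_sum; apply: eq_bigr => k _; rewrite /= trmx_mul trmxK. Qed.

Lemma block_mask I k : (k <= N)%N -> E k *m mask_mx I = if I k then E k else 0.
Proof.
move=> kN; rewrite /mask_mx mulmx_sumr big_mkcond/= (bigD1 (@Ordinal N.+1 k kN))//= big1 ?addr0.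
  by rewrite mulmxA EE// eqxx mul1mx.
by move=> l lk; case: ifP => // _; rewrite mulmxA EE ?leq_ord//; case: eqVneq => [kl|_]; [by rewrite -val_eqE/= kl eqxx in lk|rewrite mul0mx].
Qed.

Lemma mask_mul I J : mask_mx I *m mask_mx J = mask_mx [predI I & J].
Proof.
rewrite {1}/mask_mx mulmx_suml [RHS]/mask_mx big_mkcondr/=; apply: eq_bigr => k Ik.
by rewrite -mulmxA block_mask ?leq_ord// -[_ \in J]/(J k); case: ifP; rewrite ?mulmx0.
Qed.

Lemma eq_mask I J : (forall k, (k <= N)%N -> I k = J k) -> mask_mx I = mask_mx J.
Proof. by move=> IJ; apply: eq_bigl => k; rewrite IJ ?leq_ord. Qed.

Lemma mask_mx0 I : (forall k, (k <= N)%N -> ~~ I k) -> mask_mx I = 0.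
Proof. by move=> I0; rewrite /mask_mx big1// => k Ik; have := I0 k; rewrite Ik leq_ord => /(_ isT). Qed.

Lemma mask_partition I J (K : pred nat) :
  (forall k, (k <= N)%N -> (I k + J k + K k = 1)%N) -> mask_mx I + mask_mx J + mask_mx K = 1%:M.
Proof.
have maskE (H : pred nat) : mask_mx H = \sum_(k < N.+1) (if H k then (E k)^T *m E k else 0).
  by rewrite /mask_mx big_mkcond.
move=> h; rewrite !maskE -!big_split/= -E1.
apply: eq_bigr => k _; have := h k; rewrite leq_ord => /(_ isT).
by case: (I k) (J k) (K k) => [] [] []; rewrite ?addr0 ?add0r.
Qed.

Lemma mask_mul_eq0 I J (A : 'M[R]_n) :
  mask_mx I *m A *m mask_mx J = 0 <->
  forall a b, (a <= N)%N -> (b <= N)%N -> I a -> J b -> E a *m A *m (E b)^T = 0.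
Proof.
split=> [h a b aN bN Ia Jb|h].
  have <- : E a *m (mask_mx I *m A *m mask_mx J) *m (E b)^T = E a *m A *m (E b)^T.
    rewrite !mulmxA block_mask// Ia -mulmxA; congr (_ *m _).
    by apply: trmx_inj; rewrite trmx_mul tr_mask trmxK block_mask// Jb.
  by rewrite h mulmx0 mul0mx.
rewrite /mask_mx !mulmx_suml big1// => k Ik; rewrite mulmx_sumr big1// => l Jl.
by rewrite -!mulmxA (mulmxA (E k)) (mulmxA _ (E l)^T) h ?mul0mx ?mulmx0 ?leq_ord.
Qed.

Lemma block_ext p (A B : 'M[R]_(p, n)) :
  (forall m, (m <= N)%N -> A *m (E m)^T = B *m (E m)^T) -> A = B.
Proof.
move=> h; rewrite -[A]mulmx1 -[B]mulmx1 -E1 !mulmx_sumr; apply: eq_bigr => k _.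
by rewrite !mulmxA h ?leq_ord.
Qed.

(** For symmetric L the only blocks off the three diagonals left free are (0, N) and its transpose:
    the two endpoints may interact directly. *)
Definition interior_tridiag (L : 'M[R]_n) : Prop :=
  forall a b, (1 <= a < N)%N -> (b <= N)%N -> (b.+1 < a)%N || (a.+1 < b)%N ->
    E a *m L *m (E b)^T = 0.

Section Residuals.
Variables (S : 'M[R]_n) (G1 GN : nat -> 'M[R]_d).
Hypotheses (pS : posdefmx S) (N0 : (0 < N)%N).
Hypotheses (G10 : G1 0%N = 0) (G1N : G1 N = 0) (GNN : GN N = 0).

(** The noise e_k as a block row acting on the stacked vector. The conventions [G10], [G1N] and
    [GNN] cancel the spurious terms at k = 0, where [k.-1] is 0, and at k = N, so that one formula
    serves all k. *)
Definition resid k := E k - G1 k *m E k.-1 - GN k *m E N.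

Lemma resid_last : resid N = E N.
Proof. by rewrite /resid G1N GNN !mul0mx !subr0. Qed.

Lemma tr_resid k : (resid k)^T = (E k)^T - (E k.-1)^T *m (G1 k)^T - (E N)^T *m (GN k)^T.
Proof. by rewrite -(trmx_mul (G1 k)) -(trmx_mul (GN k)) -!linearB. Qed.

Lemma block_tr_resid k : (k <= N)%N -> E k *m (resid k)^T = 1%:M.
Proof.
move=> kN; have [->|kN'] := eqVneq k N; first by rewrite resid_last EE// eqxx.
rewrite tr_resid !mulmxBr !mulmxA !EE// ?(leq_trans (leq_pred _))// eqxx (negbTE kN') mul0mx subr0.
by case: k kN kN' => [|k] kN kN'; rewrite ?G10 ?trmx0 ?mulmx0 ?subr0//= gtn_eqF// mul0mx subr0.
Qed.

Lemma posdef_resid k : (k <= N)%N -> posdefmx (resid k *m S *m (resid k)^T).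
Proof. by move=> kN; apply: posdef_cong pS (block_tr_resid kN). Qed.

Definition white_resid := forall k l, (k <= N)%N -> (l <= N)%N -> k != l ->
  resid k *m S *m (resid l)^T = 0.

Lemma tr_residE l p (A : 'M[R]_(p, n)) : A *m (resid l)^T =
  A *m (E l)^T - A *m (E l.-1)^T *m (G1 l)^T - A *m (E N)^T *m (GN l)^T.
Proof. by rewrite tr_resid !mulmxBr !mulmxA. Qed.

(** As in the Gram-Schmidt process: in the order N, 0, 1, ..., N - 1 each residual is its block
    minus a combination of earlier blocks, so being uncorrelated with earlier residuals or with
    earlier blocks is the same. *)
Lemma white_residP : white_resid <->
  forall k m, (k < N)%N -> (m < k)%N || (m == N) -> resid k *m S *m (E m)^T = 0.
Proof.
split=> [h|h].
  have hN k : (k < N)%N -> resid k *m S *m (E N)^T = 0.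
    by move=> kN; rewrite -resid_last h// 1?ltnW// ltn_eqF.
  move=> k m kN /orP[mk|/eqP ->]; last exact: hN.
  elim: m mk => [|m IH] mk.
    have := h k 0%N (ltnW kN) isT; rewrite -lt0n mk => /(_ isT).
    by rewrite tr_residE G10 hN// trmx0 mulmx0 mul0mx !subr0.
  have := h k m.+1 (ltnW kN) (ltnW (ltn_trans mk kN)); rewrite (gtn_eqF mk) => /(_ isT).
  by rewrite tr_residE/= hN// IH ?(ltnW mk)// !mul0mx !subr0.
have lt k l : (k < N)%N -> (l < k)%N || (l == N) -> resid k *m S *m (resid l)^T = 0.
  move=> kN /orP[lk|/eqP ->]; last by rewrite resid_last h// eqxx orbT.
  rewrite tr_residE !(h k)// ?lk ?eqxx ?orbT// ?mul0mx ?subr0//.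
  by rewrite (leq_ltn_trans (leq_pred _)).
have [Ss _] := pS.
have sym k l : resid k *m S *m (resid l)^T = (resid l *m S *m (resid k)^T)^T.
  by rewrite !trmx_mul trmxK Ss mulmxA.
move=> k l kN lN; rewrite neq_ltn => /orP[] kl.
  have [->|lN'] := eqVneq l N; last first.
    by rewrite sym lt ?trmx0// ?kl// ltn_neqAle lN' lN.
  apply: lt; last by rewrite eqxx orbT.
  exact: leq_trans lN.
have [->|kN'] := eqVneq k N; last by rewrite lt ?kl// ltn_neqAle kN' kN.
by rewrite sym lt ?trmx0 ?eqxx ?orbT// (leq_trans kl).
Qed.

Section White.
Hypothesis wU : white_resid.
Local Notation Gm k := (resid k *m S *m (resid k)^T).
Let lowU := white_residP.1 wU.

Lemma resid_diag k : (k < N)%N -> resid k *m S *m (E k)^T = Gm k.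
Proof.
move=> kN; rewrite [RHS]tr_residE (lowU (m := N)) ?eqxx ?orbT// mul0mx subr0.
case: k kN => [|k] kN; first by rewrite G10 trmx0 mulmx0 subr0.
by rewrite (lowU (m := k)) ?leqnn// mul0mx subr0.
Qed.

(** The residual k is uncorrelated with the residual m + 1 and with block N, and these account for
    block m + 1 up to a multiple of block m. *)
Lemma resid_up k m : (k <= m)%N -> (m.+1 < N)%N ->
  resid k *m S *m (E m.+1)^T = resid k *m S *m (E m)^T *m (G1 m.+1)^T.
Proof.
move=> km mN; apply/eqP; rewrite -subr_eq0; apply/eqP.
have kN : (k < N)%N by rewrite (leq_ltn_trans km)// ltnW.
have := wU (ltnW kN) (ltnW mN); rewrite ltn_eqF// => /(_ isT).
by rewrite tr_residE (lowU (m := N)) ?eqxx ?orbT// mul0mx subr0.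
Qed.

(* Paired with [S], these combinations of residuals are dual to the blocks. *)
Lemma precision_row k : (k < N)%N -> E k *m invmx S =
  invmx (Gm k) *m resid k - (G1 k.+1)^T *m invmx (Gm k.+1) *m resid k.+1.
Proof.
move=> kN; have uS := posdef_unit pS.
set W := RHS; suff -> : E k = W *m S by rewrite mulmxK.
have uG l : (l <= N)%N -> Gm l \in unitmx by move=> lN; exact/posdef_unit/posdef_resid.
have WE m : W *m S *m (E m)^T = invmx (Gm k) *m (resid k *m S *m (E m)^T) -
    (G1 k.+1)^T *m invmx (Gm k.+1) *m (resid k.+1 *m S *m (E m)^T).
  have comb (A B : 'M[R]_d) (X Y : 'M[R]_(d, n)) (Z : 'M[R]_n) (Z' : 'M[R]_(n, d)) :
      (A *m X - B *m Y) *m Z *m Z' = A *m (X *m Z *m Z') - B *m (Y *m Z *m Z').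
    by rewrite !mulmxBl !mulmxA.
  exact: comb.
(* For k + 1 < N the residual k + 1 is uncorrelated with the blocks 0, ..., k and N; for k + 1 = N
   the coefficient vanishes by [G1N]. *)
have next m : (m <= k)%N || (m == N) ->
    (G1 k.+1)^T *m invmx (Gm k.+1) *m (resid k.+1 *m S *m (E m)^T) = 0.
  move=> mk; have [kN'|kN'] := ltnP k.+1 N; first by rewrite lowU ?mulmx0.
  by have -> : k.+1 = N; [apply/eqP; rewrite eqn_leq kN|rewrite G1N trmx0 !mul0mx].
apply: block_ext => m mN; rewrite EE//; last exact: ltnW.
rewrite WE; have [->|mN'] := eqVneq m N.
  by rewrite next ?eqxx ?orbT// lowU ?eqxx ?orbT// mulmx0 subr0 ltn_eqF.
have {mN mN'} mN : (m < N)%N by rewrite ltn_neqAle mN' mN.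
have [mk|km|->] := ltngtP m k.
- by rewrite next 1?ltnW// lowU ?mk// mulmx0 subr0.
(* At m = k + 1 both terms equal G_{k+1,k}'; from there on [resid_up] multiplies both by the same
   matrix. *)
- elim: m km mN => // m IH; rewrite ltnS leq_eqVlt => /orP[/eqP <-|km] mN.
    rewrite (resid_up (leqnn k))// !resid_diag// mulKmx; last exact/uG/ltnW.
    by rewrite mulmxKV ?subrr// uG// ltnW.
  rewrite !resid_up ?(ltnW km)// !(mulmxA _ _ (G1 m.+1)^T) -mulmxBl.
  by rewrite -(IH km (ltnW mN)) mul0mx.
- by rewrite next ?leqnn// resid_diag// mulVmx ?subr0// uG// ltnW.
Qed.

(** No condition arises at k = N - 1, to which N is adjacent, nor at k = 0, whose row is not an
    interior one. *)
Lemma tridiag_gain_compat : interior_tridiag (invmx S) <->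
  forall k, (1 <= k)%N -> (k.+1 < N)%N ->
    invmx (Gm k) *m GN k = (G1 k.+1)^T *m invmx (Gm k.+1) *m GN k.+1.
Proof.
have rowE k b : (k < N)%N -> (b <= N)%N -> (b.+1 < k)%N || (k.+1 < b)%N ->
    E k *m invmx S *m (E b)^T = if b == N then
      (G1 k.+1)^T *m invmx (Gm k.+1) *m GN k.+1 - invmx (Gm k) *m GN k else 0.
  move=> kN bN hb; rewrite precision_row//.
  have comb (A B : 'M[R]_d) (X Y : 'M[R]_(d, n)) (Z : 'M[R]_(n, d)) :
      (A *m X - B *m Y) *m Z = A *m (X *m Z) - B *m (Y *m Z) by rewrite mulmxBl !mulmxA.
  rewrite comb.
  have E0 l : (l <= N)%N -> l != b -> E l *m (E b)^T = 0.
    by move=> lN lb; rewrite EE// (negbTE lb).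
  have kb : k != b by move: hb; case: eqP => // ->; rewrite !ltnNge !leqnSn.
  have k1b : k.-1 != b.
    by apply: contraTneq hb => <-; case: (k) => //= k'; rewrite !ltnNge !leqnn/= leqW// leqW.
  have kb1 : k.+1 != b.
    by apply: contraTneq hb => <-; rewrite ltnn orbF ltnNge ltnW// ltnW.
  have EN : E N *m (E b)^T = if b == N then 1%:M else 0 by rewrite EE// eq_sym.
  have residE l : E l *m (E b)^T = 0 -> E l.-1 *m (E b)^T = 0 ->
      resid l *m (E b)^T = if b == N then - GN l else 0.
    move=> h1 h2; rewrite /resid !mulmxBl -!mulmxA h1 h2 EN mulmx0 subr0 sub0r.
    by case: ifP; rewrite ?mulmx1 ?mulmx0 ?oppr0.
  rewrite !residE ?E0 ?(ltnW kN) ?(leq_trans (leq_pred _) (ltnW kN))//.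
  by case: ifP; rewrite ?mulmx0 ?subr0// !mulmxN opprK addrC.
split=> [h k k1 kN|h a b /andP[a1 aN] bN hb].
  have := h k N; rewrite k1 (ltnW kN) leqnn kN orbT => /(_ isT isT isT).
  by rewrite rowE ?kN ?orbT ?eqxx// ?(ltnW kN)// => /eqP; rewrite subr_eq0 => /eqP ->.
rewrite rowE//; case: eqP => // bE; rewrite h ?subrr//.
by move: hb aN; rewrite bE; lia.
Qed.

End White.
End Residuals.

(** Block k is regressed on the blocks k - 1 and N. The precision rows k, ..., N - 1 vanish on the
    columns below k - 1, so by [precision_regression] the residual is uncorrelated with all earlier
    blocks, as [white_residP] demands. *)
Lemma exists_white_resid (S : 'M[R]_n) : posdefmx S -> (0 < N)%N ->
  interior_tridiag (invmx S) ->
  exists G1 GN : nat -> 'M[R]_d, [/\ G1 0%N = 0, G1 N = 0, GN N = 0 & white_resid S G1 GN].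
Proof.
move=> pS N0 tri.
have /choice[H hH] : forall k, exists K : 'M[R]_d * 'M[R]_d, (k < N)%N ->
    (k == 0%N -> K.1 = 0) /\
    forall m, (m < k)%N || (m == N) ->
      (E k - K.1 *m E k.-1 - K.2 *m E N) *m S *m (E m)^T = 0.
  move=> k; have [kN|] := ltnP k N; last by exists 0.
  (* At k = 0, [J] is {N} and [G] is empty; accordingly the coefficient of block [k.-1], which is
     then block 0 itself, is set to 0 below. *)
  pose F : pred nat := fun a => (k <= a < N)%N.
  pose J : pred nat := fun a => ((a.+1 == k) || (a == N)).
  pose G : pred nat := fun a => (a.+1 < k)%N.
  have disj I I' : (forall a, (a <= N)%N -> ~~ (I a && I' a)) -> mask_mx I *m mask_mx I' = 0.
    by move=> h; rewrite mask_mul mask_mx0.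
  have idem I : mask_mx I *m mask_mx I = mask_mx I.
    by rewrite mask_mul; apply: eq_mask => a _; rewrite /= andbb.
  have [K [KJ KG]] : exists K : 'M[R]_(d, n), (E k - K *m mask_mx J) *m S *m mask_mx J = 0 /\
      (E k - K *m mask_mx J) *m S *m mask_mx G = 0.
    apply: (precision_regression pS (F := mask_mx F)); rewrite ?tr_mask ?idem//.
    - by apply: disj => a aN; rewrite /F /G; lia.
    - by apply: disj => a aN; rewrite /J /G; lia.
    - by apply: mask_partition => a aN; rewrite /F /J /G; lia.
    - by rewrite block_mask// ?(ltnW kN)// /F leqnn kN.
    - apply/mask_mul_eq0 => a b aN bN; rewrite /F /G => Fa Gb; apply: tri => //; lia.
  exists (if k == 0%N then 0 else K *m (E k.-1)^T, K *m (E N)^T) => _ /=; split; first by case: eqP.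
  have KE : K *m mask_mx J = (if k == 0%N then 0 else K *m (E k.-1)^T) *m E k.-1 + K *m (E N)^T *m E N.
    apply: block_ext => m mN.
    have -> : K *m mask_mx J *m (E m)^T = if J m then K *m (E m)^T else 0.
      rewrite -mulmxA -[in LHS](tr_mask J) -trmx_mul block_mask//.
      by case: ifP => _; rewrite ?trmx0 ?mulmx0.
    rewrite mulmxDl -!mulmxA !EE//; last by lia.
    case: (eqVneq k 0%N) => [k0|k0].
      rewrite mul0mx add0r /J k0 /= eq_sym; case: eqP => [->|_]; by rewrite ?mulmx1 ?mulmx0.
    rewrite /J; have -> : (m.+1 == k) = (k.-1 == m) by lia.
    rewrite [N == m]eq_sym; case: (eqVneq k.-1 m) => [km|km] /=.
      have -> : (m == N) = false by lia.
      by rewrite mulmx1 !mulmx0 addr0 km.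
    by rewrite mulmx0 add0r; case: eqP => [->|_]; rewrite ?mulmx1 ?mulmx0.
  move=> m hm; rewrite -addrA -opprD -KE.
  have mN : (m <= N)%N by lia.
  have : J m || G m by rewrite /J /G; lia.
  case/orP => hm'.
    have -> : (E m)^T = mask_mx J *m (E m)^T.
      by apply: trmx_inj; rewrite trmx_mul trmxK tr_mask block_mask// hm'.
    by rewrite mulmxA KJ mul0mx.
  have -> : (E m)^T = mask_mx G *m (E m)^T.
    by apply: trmx_inj; rewrite trmx_mul trmxK tr_mask block_mask// hm'.
  by rewrite mulmxA KG mul0mx.
exists (fun k => if (k < N)%N then (H k).1 else 0), (fun k => if (k < N)%N then (H k).2 else 0).
have G10 : (if (0 < N)%N then (H 0%N).1 else 0) = 0 by rewrite N0; have [->] := hH _ N0.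
split; rewrite ?ltnn//; apply/white_residP; rewrite ?ltnn//.
by move=> k m kN hm; rewrite /resid kN; have [_ ->] := hH _ kN.
Qed.

End Blocks.

(** * The blocks of a stacked vector *)

Section StackedBlocks.
Variables (R : realType) (N d : nat).
Local Notation n := (\sum_(k < N.+1) d)%N.

Lemma eq_Rank (k l : 'I_N.+1) (i j : 'I_d) :
  (tagnat.Rank k i == tagnat.Rank l j :> 'I_n) = (k == l) && (i == j).
Proof.
apply/eqP/andP => [e|[/eqP -> /eqP ->]//].
have e1 := congr1 (@tagnat.sig1 _ (fun _ => d)) e.
have := congr1 (fun r : 'I_n => val (@tagnat.sig2 _ (fun _ => d) r)) e.
rewrite !tagnat.Rank2K /= => /val_inj ->.
by move: e1; rewrite !tagnat.Rank1K => ->.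
Qed.

Definition block (k : nat) : 'M[R]_(d, n) := submxcol (1%:M : 'M[R]_n) (inord k : 'I_N.+1).

Lemma submxcol_block m (A : 'M[R]_(n, m)) (k : 'I_N.+1) : submxcol A k = block k *m A.
Proof. by rewrite /block submxcol_mul mul1mx inord_val. Qed.

Lemma block_mul_tr k l : (k <= N)%N -> (l <= N)%N ->
  block k *m (block l)^T = if k == l then 1%:M else 0.
Proof.
move=> kN lN; rewrite /block tr_submxcol trmx1 mul_submxrow mulmx1.
apply/matrixP => i j; rewrite !mxE eq_Rank.
have -> : (inord k == inord l :> 'I_N.+1) = (k == l) by rewrite -val_eqE /= !inordK.
by case: (k == l); rewrite !mxE.
Qed.

Lemma sum_block : \sum_(k < N.+1) (block k)^T *m block k = 1%:M.
Proof.
rewrite -[RHS]mulmx1 -[X in _ = X *m _]submxrowK -[X in _ = _ *m X]submxcolK mul_mxrow_mxcol.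
by apply: eq_bigr => k _; rewrite /block tr_submxcol trmx1 inord_val.
Qed.

End StackedBlocks.

(** * Reciprocity and the precision matrix *)

Section ZMNGSequence.
Context (R : realType) (disp : measure_display) (T : measurableType disp).
Variables (P : probability T R) (N d : nat) (x : 'I_N.+1 -> T -> 'cV[R]_d).
Hypothesis hx : ZMNG P x.
Local Notation n := (\sum_(k < N.+1) d)%N.
Local Notation Z := (stack x).
Local Notation S := (cov_mx P Z Z).
Local Notation E := (@block R N d).
Local Notation Mask := (mask_mx N E).

Let gZ : gaussian_vec P Z. Proof. by case: hx. Qed.
Let mZ : mean_vec P Z = 0. Proof. by case: hx. Qed.
Let uS : S \in unitmx. Proof. by case: hx. Qed.
Let EE := @block_mul_tr R N d.
Let E1 := @sum_block R N d.

Lemma block_stack k w : E k *m Z w = x (inord k) w.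
Proof. by rewrite /block submxcol_mul mul1mx mxcolK. Qed.

Lemma cov_stack_posdef : posdefmx S.
Proof.
apply: possemidef_unit_posdef => //; split.
  by apply/matrixP => i j; rewrite !mxE covarianceC.
move=> v; rewrite -(cov_cmp gZ mZ v v).2.
by apply: Rintegral_ge0 => w _; rewrite -expr2 sqr_ge0.
Qed.

Lemma mask_stack (J : pred nat) w :
  Mask J *m Z w = \mxcol_(k < N.+1) if J k then x k w else 0.
Proof.
apply/mxcolP => k; rewrite mxcolK submxcol_block mulmxA (block_mask EE) ?leq_ord//.
by case: ifP => _; rewrite ?mul0mx// block_stack inord_val.
Qed.

(** Coordinates that are masked out are constantly 0 and add only trivial sets to the generators. *)
Lemma sigma_of_mask (J : set 'I_N.+1) (J' : pred nat) : (forall k : 'I_N.+1, J k <-> J' k) ->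
  sigma_of x J = sigma_vec (fun w => Mask J' *m Z w).
Proof.
move=> JJ'; apply/seteqP; split; apply: smallest_sub; try exact: smallest_sigma_algebra.
  move=> _ [k [i [B [/JJ' Jk mB ->]]]]; apply: sub_sigma_algebra.
  exists (tagnat.Rank k i), B; split => //.
  suff -> : (fun w => x k w i 0) = (fun w => (Mask J' *m Z w) (tagnat.Rank k i) 0) by [].
  apply/funext => w.
  have := congr1 (fun M : 'cV_d => M i 0) (congr1 (fun M : 'cV_n => submxcol M k) (mask_stack J' w)).
  by rewrite mxcolK Jk [RHS]/= => <-; rewrite mxE.
move=> _ [r [B [mB ->]]].
have E2 : (fun w => (Mask J' *m Z w) r 0) =
    (fun w => (if J' (tagnat.sig1 r) then x (tagnat.sig1 r) w else 0) (tagnat.sig2 r) 0).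
  by apply/funext => w; rewrite mask_stack mxE.
rewrite E2; case: (boolP (J' (tagnat.sig1 r))) => [Jr|nJ].
  apply: sub_sigma_algebra; exists (tagnat.sig1 r), (tagnat.sig2 r), B; split => //.
  exact/JJ'.
have [s0 sC sU] := smallest_sigma_algebra setT [set A | exists k i (B : set R),
         [/\ J k, measurable B & A = (fun w => x k w i 0) @^-1` B]].
rewrite preimage_cst; case: ifP => _; last exact: s0.
by rewrite -[X in _ X](setD0 setT); exact: sC.
Qed.

Lemma cond_indep_mask (F J G : pred nat) :
  (forall k, (k <= N)%N -> (F k + J k + G k = 1)%N) ->
  cond_indep P (sigma_vec (fun w => Mask J *m Z w)) (sigma_vec (fun w => Mask F *m Z w))
    (sigma_vec (fun w => Mask G *m Z w)) <->
  Mask F *m invmx S *m Mask G = 0.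
Proof.
move=> FJG; have pS := cov_stack_posdef; have [Ss _] := pS.
have disj I I' : (forall a, (a <= N)%N -> ~~ (I a && I' a)) -> Mask I *m Mask I' = 0.
  by move=> h; rewrite (mask_mul EE) mask_mx0.
have idem I : Mask I *m Mask I = Mask I.
  by rewrite (mask_mul EE); apply: eq_mask => a _; rewrite /= andbb.
have FJ : Mask F *m Mask J = 0 by apply: disj => a /FJG; case: (F a) (J a) => [] [].
have FG : Mask F *m Mask G = 0 by apply: disj => a /FJG; case: (F a) (J a) (G a) => [] [] [].
have JG : Mask J *m Mask G = 0 by apply: disj => a /FJG; case: (F a) (J a) (G a) => [] [] [].
have FJG1 := mask_partition E1 FJG.
have [L hL] := regression pS (Mask G) (tr_mask N E J) (idem J).
have trV (V : 'M[R]_n) : (V *m S *m Mask J)^T = Mask J *m S *m V^T.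
  by rewrite !trmx_mul tr_mask Ss mulmxA.
split => [ci|FLG].
  have [K hK] := regression pS (Mask F) (tr_mask N E J) (idem J).
  have := cond_indep_cov0 gZ mZ (K := K) (L := L) _ _ ci.
  rewrite tr_mask => /(_ hK hL) h.
  apply: (precision_regressionV pS (tr_mask _ _ F) (tr_mask _ _ J) (idem F) FJ FG JG FJG1 hK).
  (* [h] pairs F with the residual of G, whereas the residual of F has to be paired with G. Split G
     into its residual and its part in J: the residual of F is orthogonal to both. *)
  have -> : Mask G = (Mask G - L *m Mask J)^T + Mask J *m L^T.
    by rewrite linearB/= trmx_mul !tr_mask subrK.
  rewrite mulmxDr mulmxA hK mul0mx addr0 !mulmxBl h -!mulmxA (mulmxA (Mask J)) -trV hL.
  by rewrite trmx0 mulmx0 subr0.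
have [K [KJ KG]] : exists K : 'M[R]_n, (Mask F - K *m Mask J) *m S *m Mask J = 0 /\
    (Mask F - K *m Mask J) *m S *m Mask G = 0.
  by apply: (precision_regression pS (F := Mask F)); rewrite ?tr_mask ?idem.
apply: (gaussian_cond_indep gZ mZ (K := K) (L := L)); rewrite ?tr_mask//.
have -> : (Mask G - L *m Mask J)^T = Mask G - Mask J *m L^T.
  by rewrite linearB/= trmx_mul !tr_mask.
by rewrite mulmxBr KG mulmxA KJ mul0mx subr0.
Qed.

(** Conditioning on a - 1 and a + 1 isolates row a against all indices not adjacent to a;
    conversely, an index strictly between j and l is interior and not adjacent to any index outside
    [j, l]. *)
Lemma reciprocal_tridiag : reciprocal P x <-> interior_tridiag N E (invmx S).
Proof.
pose J (j l : nat) : pred nat := fun k => (k == j) || (k == l).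
pose F (j l : nat) : pred nat := fun k => (j < k < l)%N.
pose G (j l : nat) : pred nat := fun k => (k < j)%N || (l < k)%N.
have ci (j l : 'I_N.+1) : (j < l)%N ->
    cond_indep P (sigma_of x [set k | k = j \/ k = l])
               (sigma_of x [set k : 'I_N.+1 | (j < k < l)%N])
               (sigma_of x [set k : 'I_N.+1 | (k < j)%N \/ (l < k)%N]) <->
    Mask (F j l) *m invmx S *m Mask (G j l) = 0.
  move=> jl; rewrite -(cond_indep_mask (J := J j l)); last by move=> k _; rewrite /F /J /G; lia.
  rewrite (@sigma_of_mask _ (J j l)); last first.
    by move=> k; rewrite /J /=; split => [[->|->]|/orP[/eqP/val_inj|/eqP/val_inj]]; rewrite ?eqxx ?orbT//; [left|right].
  rewrite (@sigma_of_mask _ (F j l))// (@sigma_of_mask _ (G j l))//.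
  by move=> k; rewrite /G /=; split => /orP.
split=> [h a b /andP[a1 aN] bN hab|h j l jl].
  have aN' : (a.-1 < N.+1)%N by lia.
  pose j := Ordinal aN'; pose l := @Ordinal N.+1 a.+1 aN.
  have jl : (j < l)%N by rewrite /=; lia.
  have /(mask_mul_eq0 EE) := (ci j l jl).1 (h _ _ jl); apply => //; first exact: ltnW.
    by rewrite /F /=; lia.
  by rewrite /G /=; lia.
apply/(ci _ _ jl)/(mask_mul_eq0 EE) => a b aN bN; rewrite /F /G => Fa Gb.
by apply: h => //; have := ltn_ord l; lia.
Qed.

End ZMNGSequence.

(** * Covariances of linear images and of almost surely equal vectors *)

Section LinearTransforms.
Context (R : realType) (disp : measure_display) (T : measurableType disp).
Variables (P : probability T R) (n : nat) (Z : T -> 'cV[R]_n).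
Hypotheses (gZ : gaussian_vec P Z) (mZ : mean_vec P Z = 0).

Lemma coord_cmp p (A : 'M[R]_(p, n)) i w : (A *m Z w) i 0 = ((row i A)^T^T *m Z w) 0 0.
Proof. by rewrite trmxK -row_mul [RHS]mxE. Qed.

Lemma gaussian_vec_linear p (A : 'M[R]_(p, n)) : gaussian_vec P (fun w => A *m Z w).
Proof. by move=> a; under eq_fun do rewrite cmp_linear; exact: gZ. Qed.

Lemma mean_coord_linear p (A : 'M[R]_(p, n)) i :
  fine (\int[P]_w ((A *m Z w) i 0)%:E)%E = 0.
Proof. by rewrite -[RHS](mean_cmp gZ mZ (row i A)^T); apply: eq_Rintegral => w _; rewrite coord_cmp. Qed.

Lemma mean_vec_linear p (A : 'M[R]_(p, n)) : mean_vec P (fun w => A *m Z w) = 0.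
Proof. by apply/matrixP => i j; rewrite mxE [RHS]mxE unlock; exact: mean_coord_linear. Qed.

Lemma cov_mx_linear p q (A : 'M[R]_(p, n)) (B : 'M[R]_(q, n)) :
  cov_mx P (fun w => A *m Z w) (fun w => B *m Z w) = A *m cov_mx P Z Z *m B^T.
Proof.
apply/matrixP => i j; rewrite mxE covariance.unlock expectation.unlock !mean_coord_linear.
transitivity (\int[P]_w (((row i A)^T^T *m Z w) 0 0 * ((row j B)^T^T *m Z w) 0 0)).
  rewrite /Rintegral; congr fine; apply: eq_integral => w _; congr (_%:E).
  by rewrite -!coord_cmp -[RHS]/(((A *m Z w) i 0) * ((B *m Z w) j 0))
    -[LHS]/(((A *m Z w) i 0 - 0) * ((B *m Z w) j 0 - 0)) !subr0.
rewrite (cov_cmp gZ mZ _ _).2 trmxK -row_mul tr_row -!row_mul [LHS]mxE.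
by rewrite colE mulmxA -colE [LHS]mxE.
Qed.

End LinearTransforms.

Section AlmostEverywhere.
Context (R : realType) (disp : measure_display) (T : measurableType disp).
Variable P : probability T R.

Lemma integral_ae_eq_fin (f g : T -> R) : measurable_fun setT f -> measurable_fun setT g ->
  {ae P, forall w, f w = g w} -> (\int[P]_w (f w)%:E = \int[P]_w (g w)%:E)%E.
Proof.
move=> mf mg fg; apply: ae_eq_integral => //; [exact/measurable_EFinP|exact/measurable_EFinP|].
by apply: filterS fg => w -> .
Qed.

(** The model equations hold only almost surely; this carries the covariances of the noise over to
    the residuals. *)
Lemma cov_mx_ae p q (X X' : T -> 'cV[R]_p) (Y Y' : T -> 'cV[R]_q) :
  (forall i, measurable_fun setT (fun w => X w i 0)) ->
  (forall i, measurable_fun setT (fun w => X' w i 0)) ->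
  (forall i, measurable_fun setT (fun w => Y w i 0)) ->
  (forall i, measurable_fun setT (fun w => Y' w i 0)) ->
  {ae P, forall w, X w = X' w} -> {ae P, forall w, Y w = Y' w} ->
  cov_mx P X Y = cov_mx P X' Y'.
Proof.
move=> mX mX' mY mY' XX' YY'; apply/matrixP => i j; rewrite !mxE.
have eX : (\int[P]_w (X w i 0)%:E = \int[P]_w (X' w i 0)%:E)%E.
  by apply: integral_ae_eq_fin => //; apply: filterS XX' => w ->.
have eY : (\int[P]_w (Y w j 0)%:E = \int[P]_w (Y' w j 0)%:E)%E.
  by apply: integral_ae_eq_fin => //; apply: filterS YY' => w ->.
rewrite covariance.unlock expectation.unlock /= eX eY; congr fine.
apply: (@integral_ae_eq_fin
  (fun w => (X w i 0 - fine (\int[P]_w (X' w i 0)%:E)%E) * (Y w j 0 - fine (\int[P]_w (Y' w j 0)%:E)%E))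
  (fun w => (X' w i 0 - fine (\int[P]_w (X' w i 0)%:E)%E) * (Y' w j 0 - fine (\int[P]_w (Y' w j 0)%:E)%E))).
- by apply: measurable_funM; apply: measurable_funB.
- by apply: measurable_funM; apply: measurable_funB.
- by apply: filterS2 XX' YY' => w -> ->.
Qed.

End AlmostEverywhere.

(** * The induced models of a reciprocal sequence *)

Section MarkovInducedModel.
Context (R : realType) (disp : measure_display) (T : measurableType disp).
Variables (P : probability T R) (N d : nat) (x : 'I_N.+1 -> T -> 'cV[R]_d).
Hypotheses (N0 : (0 < N)%N) (hx : ZMNG P x).
Local Notation n := (\sum_(k < N.+1) d)%N.
Local Notation Z := (stack x).
Local Notation S := (cov_mx P Z Z).
Local Notation E := (@block R N d).

Let gZ : gaussian_vec P Z. Proof. by case: hx. Qed.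
Let mZ : mean_vec P Z = 0. Proof. by case: hx. Qed.
Let pS : posdefmx S. Proof. exact: cov_stack_posdef hx. Qed.
Let EE := @block_mul_tr R N d.
Let E1 := @sum_block R N d.

Lemma resid_stack (G1 GN : nat -> 'M[R]_d) k w : resid N E G1 GN k *m Z w =
  x (inord k) w - G1 k *m x (inord k.-1) w - GN k *m x ord_max w.
Proof.
rewrite /resid !mulmxBl -!mulmxA !block_stack; congr (_ - _ - _ *m x _ _).
by apply/val_inj; rewrite /= inordK.
Qed.

Lemma tridiag_induced_model : interior_tridiag N E (invmx S) ->
  exists M Mc : nat -> 'M[R]_d,
    (forall k : nat, (1 <= k <= N)%N -> posdefmx (Mc k)) /\
    exists (G1 GN G : nat -> 'M[R]_d) (e : 'I_N.+1 -> T -> 'cV[R]_d),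
      [/\ white_ZMNG P e,
          forall k : nat, (k <= N)%N -> G k = cov_mx P (e (inord k)) (e (inord k)),
          obeys_CML P x G1 GN e &
          forall k : nat, (1 <= k <= N.-1)%N ->
            [/\ G1 k = M k - GN k *m M_to M N k *m M k,
                GN k = G k *m (M_to M N k)^T *m invmx (C_to M Mc N k) &
                G k = invmx (invmx (Mc k) +
                  (M_to M N k)^T *m invmx (C_to M Mc N k) *m M_to M N k)]].
Proof.
move=> tri; have [G1 [GN [G10 G1N GNN wU]]] := exists_white_resid EE E1 pS N0 tri.
pose U := resid N E G1 GN; pose G k := U k *m S *m (U k)^T.
have pG k : (k <= N)%N -> posdefmx (G k) by move=> kN; exact: (posdef_resid EE).
have kN1 k : (1 <= k <= N.-1)%N -> (k <= N)%N by lia.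
have compat := (tridiag_gain_compat EE E1 pS N0 G10 G1N GNN wU).1 tri.
have [|k k1 kN|M [Mc [pMc hM]]] := @induced_model_exists R d N G1 G (fun k => invmx (G k) *m GN k) N0.
- by move=> k hk; exact/pG/kN1.
- by rewrite mulmxA; apply: compat => //; lia.
(* The noise is the residual itself, so the model equations hold at every point. *)
exists M, Mc; split => //; exists G1, GN, G, (fun k w => U k *m Z w); split.
- split.
  + have -> : stack (fun (k : 'I_N.+1) w => U k *m Z w) = (fun w => (\mxcol_(k < N.+1) U k) *m Z w).
      by apply/funext => w; rewrite mxcol_mul.
    exact: gaussian_vec_linear.
  + by move=> k; exact: mean_vec_linear.
  + by move=> k l kl; rewrite cov_mx_linear// wU ?leq_ord.
  + by move=> k; rewrite cov_mx_linear//; apply: posdef_unit; apply: pG; rewrite leq_ord.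
- by move=> k kN; rewrite cov_mx_linear// inordK.
- split=> [k hk||]; apply: aeW => w.
  + by rewrite /U inordK ?ltnS ?kN1// resid_stack addrC -[X in X + _]addrA -opprD subrK.
  + by rewrite /U resid_stack G1N GNN !mul0mx !subr0; congr x; apply/val_inj; rewrite /= inordK.
  + rewrite /U resid_stack G10 mul0mx subr0 addrCA subrr addr0.
    by congr x; apply/val_inj; rewrite /= inordK.
- move=> k hk; have [h1 h2 h3] := hM k hk; move: h1 h2.
  by rewrite mulKVmx; [|exact/posdef_unit/pG/kN1].
Qed.

Lemma induced_model_tridiag (M Mc G1 GN G : nat -> 'M[R]_d) (e : 'I_N.+1 -> T -> 'cV[R]_d) :
  (forall k : nat, (1 <= k <= N)%N -> posdefmx (Mc k)) ->
  white_ZMNG P e ->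
  (forall k : nat, (k <= N)%N -> G k = cov_mx P (e (inord k)) (e (inord k))) ->
  obeys_CML P x G1 GN e ->
  (forall k : nat, (1 <= k <= N.-1)%N ->
    [/\ G1 k = M k - GN k *m M_to M N k *m M k,
        GN k = G k *m (M_to M N k)^T *m invmx (C_to M Mc N k) &
        G k = invmx (invmx (Mc k) +
          (M_to M N k)^T *m invmx (C_to M Mc N k) *m M_to M N k)]) ->
  interior_tridiag N E (invmx S).
Proof.
move=> pMc [ge me we ue] hG [hk hN h0] hM.
(* Setting [G1] to 0 outside [1, N - 1] and [GN] to 0 from N on meets the boundary conventions of
   [resid] without altering the model equations. *)
pose G1' k := if (1 <= k <= N.-1)%N then G1 k else 0.
pose GN' k := if (k < N)%N then GN k else 0.
have G10 : G1' 0%N = 0 by [].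
have G1N : G1' N = 0 by rewrite /G1'; case: ifP => //; lia.
have GNN : GN' N = 0 by rewrite /GN' ltnn.
pose U := resid N E G1' GN'.
have eU k : (k <= N)%N -> {ae P, forall w, e (inord k) w = U k *m Z w}.
  move=> kN; have [->|kN'] := eqVneq k N.
    have o : inord N = ord_max :> 'I_N.+1 by apply/val_inj; rewrite /= inordK.
    apply: filterS hN => w hw.
    by rewrite o -hw /U resid_stack G1N GNN !mul0mx !subr0 o.
  have {kN kN'} kN : (k < N)%N by rewrite ltn_neqAle kN' kN.
  case: k kN => [|k] kN.
    have o : inord 0 = ord0 :> 'I_N.+1 by apply/val_inj; rewrite /= inordK.
    apply: filterS h0 => w hw.
    by rewrite /U resid_stack G10 mul0mx subr0 /GN' N0 o hw addrC addKr.
  have hk1 : (1 <= k.+1 <= N.-1)%N by lia.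
  apply: filterS (hk _ hk1) => w hw.
  by rewrite /U resid_stack /G1' /GN' hk1 kN hw -[RHS]addrA -opprD [X in X - _]addrC addrK.
have me' (k : 'I_N.+1) i : measurable_fun setT (fun w => e k w i 0).
  have := measurable_coord ge (tagnat.Rank k i).
  suff -> : (fun w => e k w i 0) = (fun w => stack e w (tagnat.Rank k i) 0) by [].
  apply/funext => w; have := congr1 (fun M : 'cV_d => M i 0) (mxcolK (fun k => e k w) k).
  by rewrite mxE.
have mU k i : measurable_fun setT (fun w => (U k *m Z w) i 0).
  exact: measurable_coord (gaussian_vec_linear gZ (U k)) i.
have cU k l : (k <= N)%N -> (l <= N)%N ->
    U k *m S *m (U l)^T = cov_mx P (e (inord k)) (e (inord l)).
  by move=> kN lN; rewrite -(cov_mx_linear gZ mZ); apply/esym/cov_mx_ae => //; exact: eU.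
have wU : white_resid N E S G1' GN'.
  move=> k l kN lN kl; rewrite -/U cU// we//.
  by apply: contra_neq kl => /(congr1 val); rewrite /= !inordK.
apply/(tridiag_gain_compat EE E1 pS N0 G10 G1N GNN wU) => k k1 kN.
have UG l : (l <= N)%N -> resid N E G1' GN' l *m S *m (resid N E G1' GN' l)^T = G l.
  by move=> lN; rewrite hG// -cU.
have hk1 : (1 <= k <= N.-1)%N by lia.
have hk2 : (1 <= k.+1 <= N.-1)%N by lia.
rewrite !UG ?(ltnW kN) ?(ltnW (ltnW kN))//.
have [_ GNk _] := hM _ hk1; have [G1k1 GNk1 Gk1] := hM _ hk2.
rewrite /G1' hk2 /GN' kN (ltnW kN).
apply: (induced_gain_compat pMc k1 kN GNk _ G1k1 GNk1 Gk1).
rewrite -UG; last exact: ltnW (ltnW kN).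
by apply: posdef_unit; apply: (posdef_resid EE) => //; exact: ltnW (ltnW kN).
Qed.

End MarkovInducedModel.

Theorem theorem3p2 (R : realType) (disp : measure_display)
    (T : measurableType disp) (P : probability T R) (N d : nat)
    (x : 'I_N.+1 -> T -> 'cV[R]_d)
    (hN : (0 < N)%N) (hx : ZMNG P x) :
  reciprocal P x <->
  exists M Mc : nat -> 'M[R]_d,
    (forall k : nat, (1 <= k <= N)%N -> posdefmx (Mc k)) /\
    exists (G1 GN G : nat -> 'M[R]_d) (e : 'I_N.+1 -> T -> 'cV[R]_d),
      [/\ white_ZMNG P e,
          forall k : nat, (k <= N)%N -> G k = cov_mx P (e (inord k)) (e (inord k)),
          obeys_CML P x G1 GN e &
          forall k : nat, (1 <= k <= N.-1)%N ->
            [/\ G1 k = M k - GN k *m M_to M N k *m M k,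
                GN k = G k *m (M_to M N k)^T *m invmx (C_to M Mc N k) &
                G k = invmx (invmx (Mc k) +
                  (M_to M N k)^T *m invmx (C_to M Mc N k) *m M_to M N k)]].
Proof.
rewrite (reciprocal_tridiag hx); split; first exact: tridiag_induced_model.
move=> [M [Mc [pMc [G1 [GN [G [e [we hG ob hM]]]]]]]].
exact: (induced_model_tridiag hN hx pMc we hG ob hM).
Qed.
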